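(* Let $\mathbf p=(p_1,\dots,p_{n+1})$ and $\mathbf q=(q_1,\dots,q_n)$ be signatures such that $\mathbf p$ and $\mathbf q^*=(-q_n,\dots,-q_1)$ are interlacing, i.e. $p_1\ge -q_n\ge p_2\ge -q_{n-1}\ge\dots\ge p_n\ge -q_1\ge p_{n+1}$. Put $$L_{\mathbf p,\mathbf q}(U,Z)=\Phi_1^{p_n+q_1}\Psi_1^{-p_n-q_2}\Phi_2^{p_{n-1}+q_2}\Psi_2^{-p_{n-1}-q_3}\cdots\Phi_n^{p_1+q_n}.$$ Then the expression $$J_{\mathbf p,\mathbf q}(\phi,\psi)=\int_{N_{n+1}^+\times N_n^+}\overline{L_{\mathbf p,\mathbf q}(U,Z)}\,\phi(Z)\,\psi(U)\,d\mu^{n+1}_{\mathbf p}(Z)\,d\mu^n_{\mathbf q}(U)$$ determines a nonzero $\mathrm{GL}(n,\mathbb C)$-invariant pairing $V^{n+1}_{\mathbf p}\times V^n_{\mathbf q}\to\mathbb C$, where $g\in\mathrm{GL}(n,\mathbb C)$ acts on $V^{n+1}_{\mathbf p}$ by $\rho_{\mathbf p}\begin{pmatrix}g&0\\0&1\end{pmatrix}$ and on $V^n_{\mathbf q}$ by $\rho_{\mathbf q}(g)$.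
   Context: $N_n^+$ is the group of upper triangular complex $n\times n$ matrices $Z=(z_{ij})$ with unit diagonal; $B_n^-$ is the group of invertible lower triangular matrices. A signature of $\mathrm{GL}(n,\mathbb C)$ is an integer vector $\mathbf p=(p_1\ge\dots\ge p_n)$. $V^n_{\mathbf p}$ is the space of polynomials on $N_n^+$ that are restrictions to $N_n^+$ of functions $f$ on $\mathrm{GL}(n,\mathbb C)$, polynomial in the matrix entries and $\det(g)^{-1}$, with $f(bg)=\prod_j b_{jj}^{p_j}f(g)$ for all $b\in B_n^-$. $\mathrm{GL}(n,\mathbb C)$ acts on it by right shifts; in coordinates $(\rho_{\mathbf p}(g)f)(Z)=f(Z^{[g]})\prod_{j=1}^n b_{jj}(Z,g)^{p_j}$, where $Zg=b(Z,g)Z^{[g]}$, $b(Z,g)\in B_n^-$, $Z^{[g]}\in N_n^+$. For a matrix $X$, $[X]_{\alpha\beta}$ is its upper-left $\alpha\times\beta$ corner. The measure on $N_n^+$ is $$d\mu^n_{\mathbf p}(Z)=\prod_{j=1}^{n-1}\det\bigl([Z]_{jn}([Z]_{jn})^*\bigr)^{-(p_j-p_{j+1})-2}\,d\dot Z,\qquad d\dot Z=\prod_{k<l}d\,\mathrm{Re}\,z_{kl}\,d\,\mathrm{Im}\,z_{kl},$$ where $X^*$ for a matrix is the conjugate transpose. For $Z\in N_{n+1}^+$ and $U\in N_n^+$, let $Z^{cut}$ be $Z$ with its last column removed and $U^{ext}$ the $n\times(n+1)$ matrix obtained from $U$ by appending a zero last column. Put $$\Phi_\alpha=\det\begin{pmatrix}[Z]_{(n+1-\alpha)(n+1)}\\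 [U^{ext}]_{\alpha(n+1)}\end{pmatrix}\ (1\le\alpha\le n),\qquad \Psi_\alpha=\det\begin{pmatrix}[Z^{cut}]_{(n-\alpha)n}\\ [U]_{\alpha n}\end{pmatrix}\ (1\le\alpha\le n-1).$$ *)

(* Defs.v *)
From HB Require Import structures.
From mathcomp Require Import all_boot all_order all_algebra.
From mathcomp Require Import complex.
From mathcomp Require Import all_classical all_reals all_analysis.
From mathcomp Require mpoly.
Import (canonicals) mpoly.

Set Implicit Arguments.
Unset Strict Implicit.
Unset Printing Implicit Defensive.

Import Order.TTheory GRing.Theory Num.Theory.
Import numFieldNormedType.Exports.

Local Open Scope classical_set_scope.
Local Open Scope ring_scope.
Local Open Scope complex_scope.

(* All sequences of integers are 0-based: the p_j of the mathematical text is
   p`_(j - 1). *)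
Definition is_signature (p : seq int) : bool := sorted >=%R p.

Definition dual_sig n (q : n.-tuple int) : n.-tuple int :=
  [tuple of map -%R (rev q)].

Definition interlacing n (p : (n + 1).-tuple int) (r : n.-tuple int) : Prop :=
  forall j, (j < n)%N -> p`_j.+1 <= r`_j <= p`_j.

Section Corners.
Variables (K : nzRingType) (m n : nat).

(* The upper-left a x b corner. Entries outside of X are set to 0, which only
   matters when a > m or b > n. *)
Definition corner (a b : nat) (X : 'M[K]_(m, n)) : 'M[K]_(a, b) :=
  \matrix_(i, j)
    if (insub (i : nat), insub (j : nat)) is (Some i', Some j')
    then X i' j' else 0.

End Corners.

(* The a x n matrix A on top of the b x n matrix B, as a square matrix of
   size n; conform_mx is the cast along a + b = n. *)
Definition stack (K : nzRingType) n a b (A : 'M[K]_(a, n)) (B : 'M[K]_(b, n)) :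
  'M[K]_n := conform_mx 0 (col_mx A B).

Section Regular.
Variables (K : fieldType) (n : nat).

(* A polynomial in the n * n matrix entries and in det(g)^-1. *)
Definition regular_on_GL (f : 'M[K]_n -> K) : Prop :=
  exists P : mpoly.mpoly (n * n + 1) K,
    forall g, g \in unitmx ->
      f g = mpoly.meval (fun i => row_mx (mxvec g) ((\det g)^-1)%:M 0 i) P.

Lemma regular_on_GL_shift (g : 'M[K]_n) f : g \in unitmx ->
  regular_on_GL f -> regular_on_GL (fun h => f (h *m g)).
Proof.
move=> gU [P fP].
pose A := \matrix_(a < n, c < n)
  mpoly.mpolyX K (mpoly.mnm1 (lshift 1 (mxvec_index a c))).
pose D : mpoly.mpoly (n * n + 1) K := mpoly.mpolyC _ (\det g)^-1 *
  mpoly.mpolyX K (mpoly.mnm1 (rshift (n * n) (@ord0 0))).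
pose M := row_mx (mxvec (A *m map_mx (@mpoly.mpolyC _ K) g)) D%:M.
exists (mpoly.comp_mpoly [tuple M 0 i | i < n * n + 1] P) => h hU.
rewrite fP ?unitmx_mul ?hU// mpoly.comp_mpoly_meval.
apply: mpoly.meval_eq => i; rewrite tnth_mktuple.
set v := fun j => _.
suff -> : row_mx (mxvec (h *m g)) ((\det (h *m g))^-1)%:M =
    map_mx (mpoly.meval v) M by rewrite mxE.
rewrite map_row_mx map_mxvec map_scalar_mx; congr (row_mx (mxvec _) _%:M).
  apply/matrixP => a c; rewrite !mxE raddf_sum/=; apply: eq_bigr => k _.
  by rewrite !mxE mpoly.mevalM mpoly.mevalC mpoly.mevalXU /v row_mxEl mxvecE.
rewrite /D /= mpoly.mevalM mpoly.mevalC mpoly.mevalXU /v row_mxEr mxE eqxx mulr1n.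
by rewrite det_mulmx invfM mulrC.
Qed.

End Regular.

Section Unipotent.
Variables (R : realType) (n : nat).

Definition is_unipotent (Z : 'M[R[i]]_n) : bool :=
  [forall i : 'I_n, forall j : 'I_n, (j <= i)%N ==> (Z i j == (i == j)%:R)].

Definition Nplus : Type := {Z : 'M[R[i]]_n | is_unipotent Z}.

Definition in_Bminus (b : 'M[R[i]]_n) : Prop := is_trig_mx b /\ b \in unitmx.

Definition covariant (p : n.-tuple int) (f : 'M[R[i]]_n -> R[i]) : Prop :=
  forall b g, in_Bminus b -> g \in unitmx ->
    f (b *m g) = (\prod_(j < n) b j j ^ p`_j) * f g.

Definition extends (p : n.-tuple int) (phi : Nplus -> R[i])
    (f : 'M[R[i]]_n -> R[i]) : Prop :=
  [/\ regular_on_GL f, covariant p f & forall Z : Nplus, phi Z = f (val Z)].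

(* Restrictions to Nplus of regular functions on GL are automatically
   polynomial, since the determinant is 1 on Nplus. *)
Definition Vspace (p : n.-tuple int) : set (Nplus -> R[i]) :=
  [set phi | exists f, extends p phi f].

Definition extension (p : n.-tuple int) (phi : Nplus -> R[i]) :
  'M[R[i]]_n -> R[i] := xget (fun=> 0) (extends p phi).

(* Right shift of the extension of phi, which is unique on GL because the matrices
   b *m Z are dense there. See rho_coord for the formula in coordinates. *)
Definition rho (p : n.-tuple int) (g : 'M[R[i]]_n) (phi : Nplus -> R[i]) :
  Nplus -> R[i] := fun Z => extension p phi (val Z *m g).

Lemma extensionP p phi : Vspace p phi -> extends p phi (extension p phi).
Proof. by move=> [f ?]; exact: xgetPex (ex_intro _ f _). Qed.

Lemma unipotent_det (Z : 'M[R[i]]_n) : is_unipotent Z -> \det Z = 1.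
Proof.
move=> /forallP ZP.
have ZE (i j : 'I_n) : (j <= i)%N -> Z i j = (i == j)%:R.
  by move=> ji; move: (ZP i) => /forallP/(_ j)/implyP/(_ ji)/eqP.
rewrite -det_tr det_trig; last first.
  apply/is_trig_mxP => i j ij; rewrite mxE ZE 1?ltnW//.
  by rewrite -val_eqE /= gtn_eqF.
by rewrite big1// => i _; rewrite mxE ZE// eqxx.
Qed.

Lemma unipotent_unitmx (Z : Nplus) : val Z \in unitmx.
Proof. by rewrite unitmxE unipotent_det ?unitr1//; exact: valP. Qed.

Lemma rho_coord p g phi (Z Z' : Nplus) b : Vspace p phi -> in_Bminus b ->
  val Z *m g = b *m val Z' ->
  rho p g phi Z = phi Z' * \prod_(j < n) b j j ^ p`_j.
Proof.
move=> /extensionP[_ cov phiE] Bb ZgE.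
by rewrite /rho ZgE cov ?unipotent_unitmx// phiE mulrC.
Qed.

Lemma rho_V p g phi : g \in unitmx -> Vspace p phi -> Vspace p (rho p g phi).
Proof.
move=> gU /extensionP[reg cov phiE].
exists (fun h => extension p phi (h *m g)); split=> //.
  exact: regular_on_GL_shift.
by move=> b h Bb hU; rewrite -mulmxA cov// unitmx_mul hU.
Qed.

End Unipotent.

Lemma product_sigma_finite d1 d2 (T1 : measurableType d1)
    (T2 : measurableType d2) (R : realType)
    (m1 : {sigma_finite_measure set T1 -> \bar R})
    (m2 : {sigma_finite_measure set T2 -> \bar R}) :
  sigma_finite setT (product_measure1 m1 m2).
Proof.
have /sigma_finiteP[F [TF ndF Foo]] := sigma_finiteT m1.
have /sigma_finiteP[G [TG ndG Goo]] := sigma_finiteT m2.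
exists (fun n => F n `*` G n).
  rewrite -setXTT TF TG predeqE => -[x y]; split.
    move=> [/= [n _ Fnx] [k _ Gky]]; exists (maxn n k) => //; split.
    - by move: x Fnx; exact/subsetPset/ndF/leq_maxl.
    - by move: y Gky; exact/subsetPset/ndG/leq_maxr.
  by move=> [n _ []/= ? ?]; split; exists n.
move=> k; have [? ?] := Foo k; have [? ?] := Goo k.
split; first exact: measurableX.
by rewrite product_measure1E// lte_mul_pinfty// ge0_fin_numE.
Qed.

(* Complex numbers are identified with pairs (Re, Im). *)
Definition lebesgueC (R : realType) :
    set (measurableTypeR R * measurableTypeR R) -> \bar R :=
  product_measure1 lebesgue_measure lebesgue_measure.

HB.instance Definition _ (R : realType) := Measure.on (@lebesgueC R).
HB.instance Definition _ (R : realType) := Measure_isSigmaFinite.Build _ _ _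
  (@lebesgueC R) (product_sigma_finite _ _).

Section Power_measure.
Context d (T : measurableType d) (R : realType).
Variable mu : {sigma_finite_measure set T -> \bar R}.

Fixpoint power_measure m : set (m.-tuple T) -> \bar R :=
  match m with
  | 0 => \d_[tuple]
  | m'.+1 => pushforward (product_measure1 mu (@power_measure m'))
               (fun xt : T * m'.-tuple T => [tuple of xt.1 :: xt.2])
  end.

Lemma power_measure_subproof m :
  exists nu : {sigma_finite_measure set (m.-tuple T) -> \bar R},
    nu = @power_measure m :> (set (m.-tuple T) -> \bar R).
Proof.
elim: m => [|m [nu nuE]] /=; first by exists (@dirac _ _ [tuple] R).
rewrite -nuE.
pose cns (xt : T * m.-tuple T) := [tuple of xt.1 :: xt.2].
have mcns : measurable_fun setT cns by exact: measurable_cons.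
pose pm_ : {measure set (m.+1.-tuple T) -> \bar R} :=
  pushforward (product_measure1 mu nu) cns.
pose pm := pm_ mcns.
have sf : sigma_finite setT pm.
  have [F FT Ffin] : sigma_finite setT (product_measure1 mu nu).
    exact: product_sigma_finite.
  pose uncns (t : m.+1.-tuple T) := (thead t, [tuple of behead t]).
  have cnsK : cancel cns uncns.
    by move=> [x t]; congr pair; apply/val_inj.
  have uncnsK : cancel uncns cns.
    by move=> t; rewrite /cns/= -tuple_eta.
  have muncns : measurable_fun setT uncns.
    apply/measurable_fun_pairP; split; last exact: measurable_behead.
    exact: measurable_tnth.
  exists (fun k => uncns @^-1` F k).
    by rewrite -preimage_bigcup -FT preimage_setT.
  move=> k; split.
    by rewrite -[X in measurable X]setTI; apply: muncns => //; exact: (Ffin k).1.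
  rewrite /pm/= /pushforward -comp_preimage (_ : uncns \o cns = id).
    exact: (Ffin k).2.
  by apply/funext => x; exact: cnsK.
pose sfpm := Measure_isSigmaFinite.Build _ _ _ pm sf.
pose nu' : {sigma_finite_measure set (m.+1.-tuple T) -> \bar R} :=
  HB.pack (pm : set _ -> _) (Measure.class pm) sfpm.
by exists nu'.
Qed.

Let power_measure0 m : @power_measure m set0 = 0%E.
Proof. by have [nu <-] := power_measure_subproof m; exact: measure0. Qed.

Let power_measure_ge0 m A : (0 <= @power_measure m A)%E.
Proof. by have [nu <-] := power_measure_subproof m; exact: measure_ge0. Qed.

Let power_measure_sigma_additive m : semi_sigma_additive (@power_measure m).
Proof.
by have [nu <-] := power_measure_subproof m; exact: measure_semi_sigma_additive.
Qed.

HB.instance Definition _ m := isMeasure.Build _ _ _ (@power_measure m)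
  (power_measure0 m) (@power_measure_ge0 m) (@power_measure_sigma_additive m).

Let power_measure_sigma_finite m : sigma_finite setT (@power_measure m).
Proof.
by have [nu <-] := power_measure_subproof m; exact: sigma_finiteT.
Qed.

HB.instance Definition _ m := Measure_isSigmaFinite.Build _ _ _
  (@power_measure m) (@power_measure_sigma_finite m).

End Power_measure.
Arguments power_measure {d T R} mu m _.

Section Coordinates.
Variables (R : realType) (n : nat).

Definition upper : Type := {kl : 'I_n * 'I_n | (kl.1 < kl.2)%N}.

(* The pair (Re z_kl, Im z_kl) is stored at position enum_rank (k, l). *)
Definition coords : Type :=
  #|{: upper}|.-tuple (measurableTypeR R * measurableTypeR R).

Definition coords_mx (x : coords) : 'M[R[i]]_n :=
  \matrix_(k, l)
    if insub (k, l) is Some kl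
    then let z := tnth x (enum_rank (kl : upper)) in z.1 +i* z.2
    else (k == l)%:R.

Lemma coords_unipotent x : is_unipotent (coords_mx x).
Proof.
apply/forallP => k; apply/forallP => l; apply/implyP => lk.
by rewrite mxE insubN//= -leqNgt.
Qed.

Definition of_coords (x : coords) : Nplus R n :=
  exist _ (coords_mx x) (coords_unipotent x).

(* Product over k < l of dRe z_kl dIm z_kl. *)
Definition dZ : {sigma_finite_measure set coords -> \bar R} :=
  power_measure (@lebesgueC R) #|{: upper}|.

(* The density of mu_p with respect to dZ; the determinants are positive reals. *)
Definition density (p : seq int) (Z : Nplus R n) : R :=
  \prod_(1 <= j < n)
    complex.Re (\det (corner j n (val Z) *m (map_mx conjc (corner j n (val Z)))^T)) ^
      (- (p`_j.-1 - p`_j) - 2).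

End Coordinates.

Section Complex_integral.
Context d (T : measurableType d) (R : realType).
Variables (mu : {measure set T -> \bar R}) (f : T -> R[i]).

Definition Cintegrable : Prop :=
  mu.-integrable setT (fun x => (complex.Re (f x))%:E) /\
  mu.-integrable setT (fun x => (complex.Im (f x))%:E).

Definition Cintegral : R[i] :=
  (\int[mu]_x complex.Re (f x)) +i* (\int[mu]_x complex.Im (f x)).

End Complex_integral.

Section Pairing.
Variables (R : realType) (n : nat).
Variables (p : (n + 1).-tuple int) (q : n.-tuple int).

Definition Phi (Z : Nplus R (n + 1)) (U : Nplus R n) (a : nat) : R[i] :=
  let Uext : 'M[R[i]]_(n, n + 1) := row_mx (val U) 0 in
  \det (stack (corner (n + 1 - a) (n + 1) (val Z)) (corner a (n + 1) Uext)).

Definition Psi (Z : Nplus R (n + 1)) (U : Nplus R n) (a : nat) : R[i] :=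
  let Zcut : 'M[R[i]]_(n + 1, n) := lsubmx (val Z) in
  \det (stack (corner (n - a) n Zcut) (corner a n (val U))).

(* Phi_a has exponent p_{n+1-a} + q_a and Psi_a has exponent
   - p_{n+1-a} - q_{a+1}, in 1-based notation. *)
Definition L (U : Nplus R n) (Z : Nplus R (n + 1)) : R[i] :=
  (\prod_(1 <= a < n.+1) Phi Z U a ^ (p`_(n - a) + q`_a.-1)) *
  (\prod_(1 <= a < n) Psi Z U a ^ (- p`_(n - a) - q`_a)).

Definition J_integrand (phi : Nplus R (n + 1) -> R[i]) (psi : Nplus R n -> R[i])
    (xy : coords R (n + 1) * coords R n) : R[i] :=
  let Z := of_coords xy.1 in let U := of_coords xy.2 in
  (L U Z)^* * phi Z * psi U * (density p Z * density q U)%:C.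

Definition J_converges (phi : Nplus R (n + 1) -> R[i])
    (psi : Nplus R n -> R[i]) : Prop :=
  Cintegrable (product_measure1 (dZ R (n + 1)) (dZ R n)) (J_integrand phi psi).

Definition J (phi : Nplus R (n + 1) -> R[i]) (psi : Nplus R n -> R[i]) : R[i] :=
  Cintegral (product_measure1 (dZ R (n + 1)) (dZ R n)) (J_integrand phi psi).

End Pairing.

Definition embed_GL (R : realType) n (g : 'M[R[i]]_n) : 'M[R[i]]_(n + 1) :=
  block_mx g 0 0 1%:M.

(* Main.v *)
Require Import Defs.
From mathcomp Require Import all_boot all_order all_algebra.
From mathcomp Require Import complex.
From mathcomp Require Import all_classical all_reals all_analysis.
From mathcomp Require Import fingroup perm measurable_realfun ring lra.
From mathcomp Require mpoly.
Import (canonicals) mpoly.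
Import Order.TTheory GRing.Theory Num.Theory.
Import numFieldNormedType.Exports.
Set Implicit Arguments.
Unset Strict Implicit.
Unset Printing Implicit Defensive.
Local Open Scope classical_set_scope.
Local Open Scope ring_scope.
Local Open Scope complex_scope.

(** Write [<f, f'>_p] for the integral over the unipotent group of
    [f * conj f'] against the density of [mu_p]; it is defined for functions
    [f, f'] on GL that are regular and covariant of weight [p] under lower
    triangular matrices.

    The function [L] is the restriction of a kernel [F] on [GL(n+1) x GL(n)]:
    put the factors [det h], [det g] and a leading minor of [h], all equal to 1
    on unipotent matrices, in front of the minors [Phi] and [Psi] ([kernel]).
    Then [F] is covariant of weight [p] in [h] and of weight [q] in [g], it is
    regular in each variable because interlacing makes the exponents
    nonnegative, and [F (h k) (g k) = F h g] for [k] in [GL(n)], embedded in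
    [GL(n+1)] ([kernel_translate]). A regular kernel has finite rank, so the double
    integral splits into products of single ones, and
      [J phi psi = <f, T f'>_p] with [T f' h = <F h, f'>_q],
    where [f, f'] extend [phi, psi] ([pairing_transform]).

    Two facts about [<f, f'>_p] are needed. It converges: [|f|^2] times a weight
    built from the Gram determinants [det ([Z]_jn [Z]_jn^* )] is invariant under
    lower triangular matrices, hence bounded by its values on the compact
    unitary group, and the remaining density has finite total mass, as one sees in
    Gram-Schmidt coordinates ([finite_volume]). And the adjoint of the right
    translation by [g] is the right translation by [g^*]
    ([has_adjoint_unitmx]). For unitary [g] this is invariance: the
    integrand extends to a function [K] on GL that transforms under lower
    triangular [b] by a character [delta], and the integral of such a function over
    the unipotent matrices does not change under right translations
    ([preserves_unitmx]); it suffices to check triangular matrices and simple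
    transvections, where the substitution is affine or [z / (1 + c z)] in one
    coordinate after the other. For diagonal [g] both
    sides of the adjunction are Laurent polynomials in the entries of [g] that
    agree on the unit circle. The general case follows by singular values.

    Given these facts, [T] intertwines the translations by [g] and by the
    adjoint of the embedded [g], which gives the invariance of [J]. Finally [J]
    is nonzero: [F h g] is nonzero at an explicit point, so with [f' = F h] and
    [f = T f'] one has [f h = <f', f'>_q], which is nonzero as a nonzero regular
    function vanishes almost nowhere, and then [J = <f, f>_p] is nonzero
    for the same reason ([ip_definite]). *)

(** * Ring operations, squared moduli and measurable complex functions *)

Section PointwiseRing.
Context (T : Type) (K : comNzRingType) (Q : (T -> K) -> Prop).

(** Measurability, regularity, finite rank and being a Laurent polynomial are all
    classes of functions of this kind. *)
Definition ring_closed : Prop :=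
  [/\ forall c, Q (fun=> c),
      forall f g, Q f -> Q g -> Q (fun t => f t + g t) &
      forall f g, Q f -> Q g -> Q (fun t => f t * g t)].

Hypothesis Qring : ring_closed.

Lemma closed_sum (I : Type) (r : seq I) (P : pred I) (f : I -> T -> K) :
  (forall i, P i -> Q (f i)) -> Q (fun t => \sum_(i <- r | P i) f i t).
Proof.
case: Qring => Qc QD _ Qf; elim: r => [|i r IH].
  by under eq_fun do rewrite big_nil.
under eq_fun do rewrite big_cons.
by case: (boolP (P i)) => [/Qf Qi|_] //; exact: QD.
Qed.

Lemma closed_prod (I : Type) (r : seq I) (P : pred I) (f : I -> T -> K) :
  (forall i, P i -> Q (f i)) -> Q (fun t => \prod_(i <- r | P i) f i t).
Proof.
case: Qring => Qc _ QM Qf; elim: r => [|i r IH].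
  by under eq_fun do rewrite big_nil.
under eq_fun do rewrite big_cons.
by case: (boolP (P i)) => [/Qf Qi|_] //; exact: QM.
Qed.

Lemma closedX f m : Q f -> Q (fun t => f t ^+ m).
Proof.
case: Qring => Qc _ QM Qf; elim: m => [|m IH]; first exact: (Qc 1).
by under eq_fun do rewrite exprS; exact: QM.
Qed.

Lemma closed_det m (M : T -> 'M[K]_m) :
  (forall i j, Q (fun t => M t i j)) -> Q (fun t => \det (M t)).
Proof.
case: (Qring) => Qc _ QM QMij; apply: closed_sum => s _.
by apply: QM; [exact: Qc|apply: closed_prod => i _; exact: QMij].
Qed.

End PointwiseRing.

Section CMeas.
Context (R : realType).
Local Notation C := R[i].

Local Notation plane := (measurableTypeR R * measurableTypeR R)%type.

Definition toC (z : plane) : C := z.1 +i* z.2.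
Definition ofC (w : C) : plane := (complex.Re w, complex.Im w).

Lemma toCK : cancel toC ofC. Proof. by case. Qed.
Lemma ofCK : cancel ofC toC. Proof. by case. Qed.

(** The squared modulus as an element of [R], unlike [`|z| ^+ 2], which is complex. *)
Definition nrm2 (z : C) : R := complex.Re z ^+ 2 + complex.Im z ^+ 2.

Lemma nrm2E (z : C) : (nrm2 z)%:C = z * z^*.
Proof. by case: z => a b; apply/eqP; rewrite eq_complex /nrm2 /=; apply/andP; split; apply/eqP; ring. Qed.

Lemma nrm2M (z w : C) : nrm2 (z * w) = nrm2 z * nrm2 w.
Proof. by case: z w => a b [c d]; rewrite /nrm2 /=; ring. Qed.

Lemma nrm2_ge0 z : 0 <= nrm2 z.
Proof. by rewrite addr_ge0// sqr_ge0. Qed.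

Lemma nrm2_eq0 z : (nrm2 z == 0) = (z == 0).
Proof. by case: z => a b; rewrite eq_complex /nrm2 /= paddr_eq0 ?sqr_ge0// !sqrf_eq0. Qed.

Lemma nrm2_1 : nrm2 1 = 1.
Proof. by rewrite /nrm2 /= expr1n expr0n addr0. Qed.

Lemma nrm2V z : nrm2 z^-1 = (nrm2 z)^-1.
Proof.
have [->|z0] := eqVneq z 0; first by rewrite invr0 /nrm2 /= expr0n addr0 invr0.
apply: (@mulfI _ (nrm2 z)); first by rewrite nrm2_eq0.
by rewrite -nrm2M divff// nrm2_1 divff// nrm2_eq0.
Qed.

Lemma nrm2_conj z : nrm2 z^* = nrm2 z.
Proof. by case: z => a b; rewrite /nrm2 /= sqrrN. Qed.

Lemma nrm2_real (x : R) : nrm2 x%:C = x ^+ 2.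
Proof. by rewrite /nrm2 /= expr0n addr0. Qed.

Lemma nrm2_prod (I : Type) (r : seq I) (P : pred I) (f : I -> C) :
  nrm2 (\prod_(i <- r | P i) f i) = \prod_(i <- r | P i) nrm2 (f i).
Proof. exact: (big_morph nrm2 nrm2M nrm2_1). Qed.

Lemma nrm2X z n : nrm2 (z ^+ n) = nrm2 z ^+ n.
Proof. by elim: n => [|n IH]; rewrite ?nrm2_1// !exprS nrm2M IH. Qed.

Lemma nrm2Xz z (e : int) : nrm2 (z ^ e) = nrm2 z ^ e.
Proof. by case: e => n; [exact: nrm2X | rewrite !NegzE -!exprnN nrm2V nrm2X]. Qed.

Section Maps.
Context d (T : measurableType d).
Implicit Types f g : T -> C.

Lemma measurable_funV (h : T -> R) :
  measurable_fun setT h -> measurable_fun setT (fun x => (h x)^-1).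
Proof.
move=> mh.
have -> : (fun x => (h x)^-1) = (fun x => h x * powR (h x ^+ 2) (-1)).
  apply/funext => x; rewrite powR_inv1 ?sqr_ge0//.
  have [->|h0] := eqVneq (h x) 0; first by rewrite invr0 mul0r.
  by rewrite expr2 invfM mulrA divff// mul1r.
apply: measurable_funM => //.
apply: (measurableT_comp (measurable_powR _)); exact: measurable_funX.
Qed.

Lemma measurable_funXz (h : T -> R) (e : int) :
  measurable_fun setT h -> measurable_fun setT (fun x => h x ^ e).
Proof.
move=> mh; case: e => n; first exact: measurable_funX.
by apply: measurable_funV; exact: measurable_funX.
Qed.

Definition cmeas f := measurable_fun setT (fun x => complex.Re (f x)) /\
  measurable_fun setT (fun x => complex.Im (f x)).

Lemma cmeas_cst c : cmeas (fun=> c).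
Proof. by split; exact: measurable_cst. Qed.

Lemma cmeasD f g : cmeas f -> cmeas g -> cmeas (fun x => f x + g x).
Proof.
move=> [f1 f2] [g1 g2]; split.
  by under eq_fun do rewrite raddfD; exact: measurable_funD.
by under eq_fun do rewrite raddfD; exact: measurable_funD.
Qed.

Lemma cmeasN f : cmeas f -> cmeas (fun x => - f x).
Proof.
move=> [f1 f2]; split.
  by under eq_fun do rewrite raddfN; exact: measurable_funN.
by under eq_fun do rewrite raddfN; exact: measurable_funN.
Qed.

Lemma complex_ReM (z w : C) : complex.Re (z * w) =
  complex.Re z * complex.Re w - complex.Im z * complex.Im w.
Proof. by case: z w => [? ?] [? ?]. Qed.

Lemma complex_ImM (z w : C) : complex.Im (z * w) =
  complex.Re z * complex.Im w + complex.Im z * complex.Re w.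
Proof. by case: z w => [? ?] [? ?]. Qed.

Lemma cmeasM f g : cmeas f -> cmeas g -> cmeas (fun x => f x * g x).
Proof.
move=> [f1 f2] [g1 g2]; split.
  under eq_fun do rewrite complex_ReM.
  by apply: measurable_funB; exact: measurable_funM.
under eq_fun do rewrite complex_ImM.
by apply: measurable_funD; exact: measurable_funM.
Qed.

Lemma cmeas_conj f : cmeas f -> cmeas (fun x => (f x)^*).
Proof.
move=> [f1 f2]; split.
  by rewrite (_ : (fun _ => _) = fun x => complex.Re (f x))//; apply/funext => x; case: (f x).
rewrite (_ : (fun _ => _) = fun x => - complex.Im (f x)).
  exact: measurable_funN.
by apply/funext => x; case: (f x).
Qed.

Lemma cmeas_real (h : T -> R) : measurable_fun setT h -> cmeas (fun x => (h x)%:C).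
Proof. by move=> mh; split=> //=; exact: measurable_cst. Qed.

Lemma measurable_nrm2 f : cmeas f -> measurable_fun setT (fun x => nrm2 (f x)).
Proof. by move=> [? ?]; apply: measurable_funD; exact: measurable_funX. Qed.

Lemma cmeasV f : cmeas f -> cmeas (fun x => (f x)^-1).
Proof.
move=> mf; have -> : (fun x => (f x)^-1) = (fun x => ((nrm2 (f x))^-1)%:C * (f x)^*).
  apply/funext => x; have [->|f0] := eqVneq (f x) 0.
    by rewrite invr0 rmorph0 mulr0.
  apply: (@mulfI _ (f x)) => //; rewrite divff// mulrCA -nrm2E -rmorphM mulVf//.
  by rewrite nrm2_eq0.
apply: cmeasM; last exact: cmeas_conj.
by apply: cmeas_real; apply: measurable_funV; exact: measurable_nrm2.
Qed.

Lemma cmeas_ring : ring_closed cmeas.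
Proof. by split; [exact: cmeas_cst|exact: cmeasD|exact: cmeasM]. Qed.

Lemma cmeas_sum (I : Type) (r : seq I) (P : pred I) (f : I -> T -> C) :
  (forall i, cmeas (f i)) -> cmeas (fun x => \sum_(i <- r | P i) f i x).
Proof. by move=> mf; exact: (closed_sum cmeas_ring). Qed.

Lemma cmeas_prod (I : Type) (r : seq I) (P : pred I) (f : I -> T -> C) :
  (forall i, cmeas (f i)) -> cmeas (fun x => \prod_(i <- r | P i) f i x).
Proof. by move=> mf; exact: (closed_prod cmeas_ring). Qed.

Lemma cmeasX f n : cmeas f -> cmeas (fun x => f x ^+ n).
Proof. exact: (closedX cmeas_ring). Qed.

Lemma cmeas_det n (M : T -> 'M[C]_n) :
  (forall i j, cmeas (fun x => M x i j)) -> cmeas (fun x => \det (M x)).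
Proof. exact: (closed_det cmeas_ring). Qed.

Lemma measurable_ofC f : cmeas f -> measurable_fun setT (fun x => ofC (f x)).
Proof. by move=> [? ?]; apply/measurable_fun_pairP; split. Qed.

Lemma cmeas_toC (h : T -> plane) : measurable_fun setT h ->
  cmeas (fun x => toC (h x)).
Proof.
move=> mh; split.
  exact: (measurableT_comp (@measurable_fst _ _ _ _) mh).
exact: (measurableT_comp (@measurable_snd _ _ _ _) mh).
Qed.

End Maps.
End CMeas.

(** * Affine substitutions and inversion in the complex plane *)

Section OneDim.
Variable R : realType.
Local Notation mu := (@lebesgue_measure R).
Local Open Scope ereal_scope.

Lemma lebesgue_affine_itv (a b : R) (X : set R) : a != 0%R -> ocitv X ->
  mu X = `|a|%:E * mu ((fun x => a * x + b)%R @^-1` X).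
Proof.
move=> a0 [[c d] _ <-] /=; have [a_gt0|a_lt0|/eqP] := ltgtP 0%R a; last first.
- by rewrite eq_sym (negbTE a0).
- have -> : (fun x => a * x + b)%R @^-1` `]c, d]%classic =
      `[((d - b) / a)%R, ((c - b) / a)%R[%classic.
    apply/seteqP; split => x /=; rewrite !in_itv /= ler_ndivrMr// ltr_ndivlMr//.
      by rewrite lerBrDr ltrBlDr mulrC => /andP[-> ->].
    by rewrite lerBrDr ltrBlDr mulrC => /andP[-> ->].
  rewrite !lebesgue_measure_itv /= !lte_fin ltr_nM2r ?invr_lt0// ltrD2r.
  case: ifPn => // _; last by rewrite mule0.
  rewrite -!EFinB -EFinM ltr0_norm//; congr EFin; field.
  by rewrite lt_eqF.
- have -> : (fun x => a * x + b)%R @^-1` `]c, d]%classic =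
      `]((c - b) / a)%R, ((d - b) / a)%R]%classic.
    apply/seteqP; split => x /=; rewrite !in_itv /= ler_pdivlMr// ltr_pdivrMr//.
      by rewrite lerBrDr ltrBlDr mulrC => /andP[-> ->].
    by rewrite lerBrDr ltrBlDr mulrC => /andP[-> ->].
  rewrite !lebesgue_measure_itv /= !lte_fin ltr_pM2r ?invr_gt0// ltrD2r.
  case: ifPn => // _; last by rewrite mule0.
  rewrite -!EFinB -EFinM gtr0_norm//; congr EFin; field.
  by rewrite gt_eqF.
Qed.

Lemma measurable_affine (a b : R) :
  measurable_fun [set: measurableTypeR R]
    (fun x => a * x + b : measurableTypeR R)%R.
Proof.
apply: measurable_funD; last exact: measurable_cst.
by apply: measurable_funM; [exact: measurable_cst|exact: measurable_id].
Qed.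

Lemma ge0_integral_affine (a b : R) (f : measurableTypeR R -> \bar R) :
  a != 0%R -> measurable_fun setT f -> (forall x, 0 <= f x) ->
  \int[mu]_x (`|a|%:E * f (a * x + b)%R) = \int[mu]_x f x.
Proof.
move=> a0 mf f0.
pose ma := measurable_affine a b.
rewrite ge0_integralZl//; last exact: (measurableT_comp mf ma).
have -> : \int[mu]_x f (a * x + b)%R =
    \int[pushforward mu (fun x : measurableTypeR R => a * x + b : measurableTypeR R)%R]_y f y.
  by rewrite (ge0_integral_pushforward ma).
have abs0 : (0 <= `|a|)%R by [].
have := @ge0_integral_mscale _ _ _
  (pushforward mu (fun x : measurableTypeR R => a * x + b : measurableTypeR R)%R)
  setT measurableT (NngNum abs0) f mf (fun x _ => f0 x).
rewrite /= => <-; apply: eq_measure_integral => A mA _.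
symmetry; apply: lebesgue_measure_unique => // X oX.
by rewrite /mscale/= /pushforward (lebesgue_affine_itv b a0 oX).
Qed.

End OneDim.

Section Plane.
Variable R : realType.
Local Notation C := R[i].
Local Notation plane := (measurableTypeR R * measurableTypeR R)%type.
Local Notation mu := (@lebesgue_measure R).
Local Notation lam := (@lebesgueC R).

Lemma measurable_comp_ofC d (T : measurableType d) (f : plane -> \bar R)
    (g : T -> C) : measurable_fun setT f -> cmeas g ->
  measurable_fun setT (fun x => f (ofC (g x))).
Proof. by move=> mf mg; apply: (measurableT_comp mf); exact: measurable_ofC. Qed.

Lemma lebesgueC_tonelli1 (f : plane -> \bar R) :
  measurable_fun setT f -> (forall z, (0 <= f z)%E) ->
  (\int[lam]_z f z = \int[mu]_x \int[mu]_y f (x, y))%E.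
Proof. by move=> mf f0; rewrite /lebesgueC fubini_tonelli1. Qed.

Lemma lebesgueC_tonelli2 (f : plane -> \bar R) :
  measurable_fun setT f -> (forall z, (0 <= f z)%E) ->
  (\int[lam]_z f z = \int[mu]_y \int[mu]_x f (x, y))%E.
Proof. by move=> mf f0; rewrite /lebesgueC fubini_tonelli2. Qed.

Lemma measurable_affine2 (a b c : R) :
  measurable_fun [set: plane] (fun z => a * z.1 + b * z.2 + c).
Proof.
apply: measurable_funD; last exact: measurable_cst.
apply: measurable_funD; apply: measurable_funM => //; exact: measurable_cst.
Qed.

(** As an [R]-linear map [z |-> a z] is a product of shears and a real dilation of
    each coordinate, except when [a] is purely imaginary: then it exchanges the
    two coordinates. *)
Lemma ge0_integral_Caffine (a b : C) (f : plane -> \bar R) :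
  a != 0 -> measurable_fun setT f -> (forall z, (0 <= f z)%E) ->
  (\int[lam]_z ((nrm2 a)%:E * f (ofC (a * toC z + b)%R)) = \int[lam]_z f z)%E.
Proof.
move=> a0 mf f0; set n := nrm2 a.
have n0 : n != 0 by rewrite nrm2_eq0.
have nge0 : 0 <= n by exact: nrm2_ge0.
case: a b @n a0 n0 nge0 => al be [b1 b2] n a0 n0 nge0.
have mfa (p q r s t u : R) : measurable_fun [set: plane]
    (fun z => f (p * z.1 + q * z.2 + r, s * z.1 + t * z.2 + u)).
  apply: (measurableT_comp mf); apply/measurable_fun_pairP.
  by split; exact: measurable_affine2.
have mF (p q r : R) : measurable_fun [set: plane]
    (fun z => f (z.1, p * z.1 + q * z.2 + r)).
  apply: (measurableT_comp mf); apply/measurable_fun_pairP.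
  by split; [exact: measurable_fst | exact: measurable_affine2].
have E (z : plane) : f (ofC ((al +i* be) * toC z + (b1 +i* b2))) =
    f (al * z.1 + (- be) * z.2 + b1, be * z.1 + al * z.2 + b2).
  by case: z => x y; rewrite /toC /ofC /= mulNr [_ + be * x]addrC.
have F0 (k : R) z : 0 <= k -> (0 <= k%:E * f z)%E by move=> k0; rewrite mule_ge0.
under eq_integral do rewrite E.
have mf1 (y : measurableTypeR R) : measurable_fun setT (fun x => f (x, y)).
  exact: measurableT_comp mf (pair2_measurable _).
have mf2 (x : measurableTypeR R) : measurable_fun setT (fun y => f (x, y)).
  exact: measurableT_comp mf (pair1_measurable _).
have [al0|al0] := eqVneq al 0.
  have be0 : be != 0.
    by apply: contraNneq a0 => ->; rewrite al0.
  have -> : n = `|be| * `|be|.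
    by rewrite /n /nrm2 /= al0 expr0n add0r -normrM -expr2 ger0_norm ?sqr_ge0.
  rewrite [LHS]lebesgueC_tonelli1; last 2 first.
  - by apply: emeasurable_funM => //; exact: measurable_cst.
  - by move=> z; rewrite F0// mulr_ge0.
  rewrite [RHS]lebesgueC_tonelli2// -[RHS](@ge0_integral_affine _ be b2)//; last 2 first.
  - exact: (measurable_fun_fubini_tonelli_G (m1 := mu) f).
  - by move=> x; exact: integral_ge0.
  apply: eq_integral => x _ /=.
  transitivity (\int[mu]_y (`|be|%:E *
      (`|be|%:E * f ((- be * y + b1), (be * x + b2))%R)))%E.
    by apply: eq_integral => y _; rewrite al0 mul0r add0r (mul0r y) addr0 EFinM -muleA.
  rewrite ge0_integralZl//; last 2 first.
  - apply: emeasurable_funM; first exact: measurable_cst.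
    exact: (measurableT_comp (mf1 _) (measurable_affine _ _)).
  - by move=> y _; rewrite F0.
  congr (_ * _)%E; rewrite -[RHS](@ge0_integral_affine _ (- be) b1) ?oppr_eq0//.
  by rewrite normrN.
rewrite [LHS]lebesgueC_tonelli2; last 2 first.
- by apply: emeasurable_funM => //; exact: measurable_cst.
- by move=> z; rewrite F0.
rewrite [RHS]lebesgueC_tonelli1//.
(* Substitute u for the first coordinate of a z + b at fixed y. *)
transitivity (\int[mu]_y \int[mu]_u ((n / `|al|)%:E *
    f (u, be / al * u + n / al * y + (b2 - be / al * b1))%R))%E.
  apply: eq_integral => y _.
  rewrite -[RHS](@ge0_integral_affine _ al (- be * y + b1))//; last 2 first.
  - apply: emeasurable_funM; first exact: measurable_cst.
    exact: (measurableT_comp (mF _ _ _) (pair2_measurable y)).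
  - by move=> x; rewrite F0// divr_ge0.
  apply: eq_integral => x _ /=; rewrite muleA -EFinM mulrCA divff ?normr_eq0// mulr1.
  congr (_ * f (_, _))%E; first by rewrite addrA.
  by rewrite /n /nrm2 /=; field.
rewrite -(lebesgueC_tonelli2 (f := fun z => (n / `|al|)%:E *
    f (z.1, be / al * z.1 + n / al * z.2 + (b2 - be / al * b1))%R)%E)/=; last 2 first.
- apply: emeasurable_funM; first exact: measurable_cst.
  exact: mF.
- by move=> z; rewrite F0// divr_ge0.
rewrite [LHS]lebesgueC_tonelli1; last 2 first.
- apply: emeasurable_funM; first exact: measurable_cst.
  exact: mF.
- by move=> z; rewrite F0// divr_ge0.
apply: eq_integral => x _ /=.
rewrite -[RHS](@ge0_integral_affine _ (n / al) (be / al * x + (b2 - be / al * b1)))//; last first.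
  by rewrite mulf_neq0// invr_eq0.
apply: eq_integral => y _; rewrite normrM normfV (ger0_norm nge0).
by congr (_ * f (_, _))%E; ring.
Qed.

Lemma lebesgueC_set1 (z : plane) : lam [set z] = 0%E.
Proof.
case: z => x y; have -> : [set (x, y)] = [set x] `*` [set y] :> set plane.
  by apply/seteqP; split => [[? ?] [-> ->]|[? ?] [/= -> ->]].
by rewrite /lebesgueC product_measure1E//= lebesgue_measure_set1 mul0e.
Qed.

End Plane.

Section Inversion.
Variable R : realType.
Local Notation C := R[i].
Local Notation plane := (measurableTypeR R * measurableTypeR R)%type.
Local Notation mu := (@lebesgue_measure R).
Local Notation lam := (@lebesgueC R).

Lemma ae_integral_neq0 (f g : plane -> \bar R) :
  measurable_fun setT f -> measurable_fun setT g ->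
  (forall z, 0 <= f z)%E -> (forall z, 0 <= g z)%E ->
  (forall z, toC z != 0 -> f z = g z) ->
  (\int[lam]_z f z = \int[lam]_z g z)%E.
Proof.
move=> mf mg f0 g0 fg; apply: ge0_ae_eq_integral => //.
exists [set (0, 0)]; split.
- by have -> : [set (0, 0)] = [set (0 : R)] `*` [set (0 : R)] :> set plane;
    [apply/seteqP; split => [[? ?] [-> ->]|[? ?] [/= -> ->]] | exact: measurableX].
- exact: lebesgueC_set1.
move=> z /= /not_implyP[_ fgz]; apply: contra_notP fgz => z0; apply: fg.
by apply/eqP => /(congr1 (@ofC R)); rewrite toCK.
Qed.

(** The density of the Haar measure of [C^*]. *)
Let kap (z : plane) : R := (nrm2 (toC z))^-1.

Let kap00 z : toC z = 0 -> kap z = 0.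
Proof. by rewrite /kap => ->; rewrite /nrm2 /= expr0n addr0 invr0. Qed.

Let kap_ge0 z : 0 <= kap z.
Proof. by rewrite invr_ge0 nrm2_ge0. Qed.

Let cmeas_id : cmeas (fun z : plane => toC z).
Proof. by apply: cmeas_toC; exact: measurable_id. Qed.

Let mkap : measurable_fun setT kap.
Proof. by apply: measurable_funV; exact: measurable_nrm2. Qed.

Let cfst : cmeas (fun z : plane * plane => toC z.1).
Proof. by apply: cmeas_toC; exact: measurable_fst. Qed.

Let csnd : cmeas (fun z : plane * plane => toC z.2).
Proof. by apply: cmeas_toC; exact: measurable_snd. Qed.

(** The group [C^*] is abelian, so inversion preserves its Haar measure
    [dz / |z|^2]: convolving with a test function [g] in the two possible orders
    only uses the invariance of that measure under dilations. *)
Lemma haar_inversion (h g : plane -> \bar R) :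
  measurable_fun setT h -> measurable_fun setT g ->
  (forall z, 0 <= h z)%E -> (forall z, 0 <= g z)%E ->
  (\int[lam]_x ((kap x)%:E * h (ofC ((toC x)^-1)%R)) * \int[lam]_x ((kap x)%:E * g x) =
   \int[lam]_x ((kap x)%:E * h x) * \int[lam]_x ((kap x)%:E * g x))%E.
Proof.
move=> mh mg h0 g0.
have mk1 : measurable_fun setT (fun z : plane * plane => (kap z.1)%:E).
  by apply/measurable_EFinP; apply: measurable_funV; exact: measurable_nrm2.
have mk2 : measurable_fun setT (fun z : plane * plane => (kap z.2)%:E).
  by apply/measurable_EFinP; apply: measurable_funV; exact: measurable_nrm2.
have mk : measurable_fun setT (fun z : plane => (kap z)%:E) by apply/measurable_EFinP.
have k0 z : (0 <= (kap z)%:E)%E by rewrite lee_fin.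
have dil (a : C) (f : plane -> \bar R) : a != 0 -> measurable_fun setT f ->
    (forall z, 0 <= f z)%E ->
    (\int[lam]_x ((kap x)%:E * f (ofC (a * toC x)%R)) =
     \int[lam]_x ((kap x)%:E * f x))%E.
  move=> a0 mf f0; rewrite -[RHS](@ge0_integral_Caffine _ a 0)//; last 2 first.
  - exact: emeasurable_funM.
  - by move=> z; rewrite mule_ge0.
  apply: eq_integral => x _; rewrite addr0 muleA -EFinM; congr (_%:E * _)%E.
  by rewrite /kap ofCK nrm2M invfM mulrA divff ?mul1r// nrm2_eq0.
pose A (z : plane * plane) := ((kap z.1)%:E * (kap z.2)%:E *
  (h (ofC ((toC z.1)^-1)%R) * g (ofC (toC z.1 * toC z.2)%R)))%E.
pose B (z : plane * plane) := ((kap z.1)%:E * (kap z.2)%:E *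
  (h (ofC (toC z.2 / toC z.1)%R) * g z.1))%E.
have A0 z : (0 <= A z)%E by rewrite !mule_ge0.
have B0 z : (0 <= B z)%E by rewrite !mule_ge0.
have mA : measurable_fun setT A.
  apply: emeasurable_funM; first exact: emeasurable_funM.
  apply: emeasurable_funM; apply: measurable_comp_ofC => //.
    exact: cmeasV.
  exact: cmeasM.
have mB : measurable_fun setT B.
  apply: emeasurable_funM; first exact: emeasurable_funM.
  apply: emeasurable_funM; last exact: (measurableT_comp mg (@measurable_fst _ _ _ _)).
  by apply: measurable_comp_ofC => //; apply: cmeasM => //; exact: cmeasV.
have mhV : measurable_fun setT (fun x : plane => h (ofC ((toC x)^-1)%R)).
  by apply: measurable_comp_ofC => //; exact: cmeasV.
have cm (a : C) : cmeas (fun z : plane => a * toC z).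
  by apply: cmeasM => //; exact: cmeas_cst.
transitivity (\int[lam]_x \int[lam]_y A (x, y))%E.
  rewrite -ge0_integralZr//; last 3 first.
  - exact: emeasurable_funM.
  - by move=> x _; rewrite mule_ge0.
  - by apply: integral_ge0 => x _; rewrite mule_ge0.
  apply: eq_integral => x _; have [x0|x0] := eqVneq (toC x) 0.
    rewrite [RHS]integral0_eq; first by rewrite (kap00 x0) !mul0e.
    by move=> y _; rewrite /A /= (kap00 x0) !mul0e.
  rewrite -(dil (toC x) g)// -ge0_integralZl//; last 3 first.
  - by apply: emeasurable_funM => //; exact: measurable_comp_ofC.
  - by move=> y _; rewrite mule_ge0.
  - by rewrite mule_ge0.
  apply: eq_integral => y _; rewrite /A /=.
  by rewrite -!muleA; congr (_ * _)%E; rewrite muleCA.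
rewrite (fubini_tonelli A)//.
transitivity (\int[lam]_y \int[lam]_x B (x, y))%E.
  apply: eq_integral => y _; rewrite /A /B /=.
  have [y0|y0] := eqVneq (toC y) 0.
    by rewrite !integral0_eq// => x _; rewrite (kap00 y0) mule0 mul0e.
  transitivity (\int[lam]_x ((kap x)%:E *
     ((kap y)%:E * (h (ofC (toC y / (toC y * toC x))%R) * g (ofC (toC y * toC x)%R)))))%E.
    apply: eq_integral => x _; rewrite -muleA; congr (_ * (_ * (h (ofC _) * g (ofC _))))%E.
      by rewrite invfM mulrA divff// mul1r.
    exact: mulrC.
  transitivity (\int[lam]_x ((kap x)%:E *
     ((kap y)%:E * (h (ofC (toC y / toC x)%R) * g x))))%E; last first.
    by apply: eq_integral => x _; rewrite muleA.
  rewrite -[RHS](dil (toC y) (fun x => (kap y)%:E * (h (ofC (toC y / toC x)%R) * g x))%E)//;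
    last 2 first.
  - apply: emeasurable_funM; first exact: measurable_cst.
    apply: emeasurable_funM => //; apply: measurable_comp_ofC => //.
    by apply: cmeasM; [exact: cmeas_cst | exact: cmeasV].
  - by move=> z; rewrite !mule_ge0.
rewrite -(fubini_tonelli B)// [RHS]muleC -ge0_integralZr//; last 3 first.
- exact: emeasurable_funM.
- by move=> x _; rewrite mule_ge0.
- by apply: integral_ge0 => x _; rewrite mule_ge0.
apply: eq_integral => x _; have [x0|x0] := eqVneq (toC x) 0.
  rewrite [LHS]integral0_eq; first by rewrite (kap00 x0) !mul0e.
  by move=> y _; rewrite /B /= (kap00 x0) !mul0e.
rewrite -(dil (toC x)^-1 h) ?invr_eq0// -ge0_integralZl//; last 3 first.
- by apply: emeasurable_funM => //; exact: measurable_comp_ofC.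
- by move=> y _; rewrite mule_ge0.
- by rewrite mule_ge0.
apply: eq_integral => y _; rewrite /B /= [toC y / _]mulrC -!muleA.
by congr (_ * _)%E; rewrite [RHS]muleC muleA.
Qed.

(** The Haar measure identity, for a test function [g] of total mass 1. *)
Lemma ge0_integral_Cinv (f : plane -> \bar R) :
  measurable_fun setT f -> (forall z, (0 <= f z)%E) ->
  (\int[lam]_z (((nrm2 (toC z))^-1 ^+ 2)%:E * f (ofC ((toC z)^-1)%R)) = \int[lam]_z f z)%E.
Proof.
move=> mf f0.
pose box : set plane := `[1, 2]%classic `*` `[0, 1]%classic.
(* A box of area 1 that avoids the origin. *)
pose g (z : plane) : \bar R := (nrm2 (toC z) * \1_box z)%:E.
pose h (z : plane) : \bar R := ((nrm2 (toC z))%:E * f z)%E.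
have mn : measurable_fun setT (fun z : plane => nrm2 (toC z)) by exact: measurable_nrm2.
have mbox : measurable box by apply: measurableX; exact: measurable_itv.
have mh : measurable_fun setT h.
  by apply: emeasurable_funM => //; exact/measurable_EFinP.
have mg : measurable_fun setT g.
  apply/measurable_EFinP; apply: measurable_funM => //; exact: measurable_indic.
have h0 z : (0 <= h z)%E by rewrite mule_ge0// lee_fin nrm2_ge0.
have g0 z : (0 <= g z)%E by rewrite lee_fin mulr_ge0// nrm2_ge0.
have Ig : (\int[lam]_z ((kap z)%:E * g z) = 1)%E.
  transitivity (\int[lam]_z (\1_box z)%:E)%E.
    apply: eq_integral => z _; rewrite /g -EFinM; congr EFin.
    rewrite /indic; case: (boolP (z \in box)) => [|_]; last by rewrite !mulr0.
    move=> /set_mem[]/=; rewrite !in_itv/= => /andP[z1 _] _.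
    rewrite mulr1 /kap mulVf// nrm2_eq0; apply/eqP => -[z10].
    by rewrite z10 ler10 in z1.
  rewrite integral_indic// setIT.
  transitivity (mu `[1%R, 2%R]%classic * mu `[0%R, 1%R]%classic)%E.
    by apply: product_measure1E; exact: measurable_itv.
  rewrite !lebesgue_measure_itv /= !lte_fin ltr1n ltr01 -!EFinB -EFinM.
  by congr EFin; ring.
have := haar_inversion mh mg h0 g0; rewrite Ig !mule1.
have -> : (\int[lam]_x ((kap x)%:E * h (ofC ((toC x)^-1)%R)) =
           \int[lam]_z (((nrm2 (toC z))^-1 ^+ 2)%:E * f (ofC ((toC z)^-1)%R)))%E.
  apply: eq_integral => z _; rewrite /h muleA -EFinM; congr (_%:E * _)%E.
  by rewrite ofCK nrm2V.
move=> ->; apply: ae_integral_neq0 => //.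
- apply: emeasurable_funM => //; exact/measurable_EFinP.
- by move=> z; rewrite mule_ge0// lee_fin.
move=> z z0; rewrite /h muleA -EFinM /kap mulVf ?mul1e//.
by rewrite nrm2_eq0.
Qed.

(** The map [z / (1 + c z)] is the inversion between two affine maps:
    it equals [c^-1 (1 - (1 + c z)^-1)]. *)
Lemma ge0_integral_moebius (c : C) (f : plane -> \bar R) :
  measurable_fun setT f -> (forall z, (0 <= f z)%E) ->
  (\int[lam]_z (((nrm2 (1 + c * toC z))^-1 ^+ 2)%:E *
     f (ofC (toC z / (1 + c * toC z))%R)) = \int[lam]_z f z)%E.
Proof.
move=> mf f0; have [->|c0] := eqVneq c 0.
  apply: eq_integral => z _; rewrite mul0r addr0 nrm2_1 invr1 expr1n mul1e.
  by rewrite divr1 toCK.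
pose F (z : plane) := f (ofC ((1 - toC z) / c)%R).
have mF : measurable_fun setT F.
  apply: measurable_comp_ofC => //; apply: cmeasM; last exact: cmeas_cst.
  by apply: cmeasD; [exact: cmeas_cst | exact: cmeasN].
have n0 : (0 <= (nrm2 c)^-1%:E)%E by rewrite lee_fin invr_ge0 nrm2_ge0.
pose G (z : plane) := (((nrm2 (toC z))^-1 ^+ 2)%:E * F (ofC ((toC z)^-1)%R))%E.
have mG : measurable_fun setT G.
  apply: emeasurable_funM.
    apply/measurable_EFinP; apply: measurable_funX; apply: measurable_funV.
    exact: measurable_nrm2.
  by apply: measurable_comp_ofC => //; exact: cmeasV.
have G0 z : (0 <= G z)%E.
  by apply: mule_ge0; [rewrite lee_fin sqr_ge0 | exact: f0].
transitivity (\int[lam]_z ((nrm2 c)^-1%:E * ((nrm2 c)%:E * G (ofC (c * toC z + 1)%R))))%E.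
  apply: eq_integral => z _; rewrite muleA -EFinM mulVf ?nrm2_eq0// mul1e /G /F.
  rewrite !ofCK [1 + _]addrC; have [w0|w0] := eqVneq (c * toC z + 1) 0.
    by rewrite w0 /nrm2 /= expr0n addr0 invr0 expr0n !mul0e.
  by congr (_ * f (ofC _))%E; field; rewrite c0 w0.
have mGc : measurable_fun setT (fun z : plane => G (ofC (c * toC z + 1)%R)).
  apply: measurable_comp_ofC => //; apply: cmeasD; last exact: cmeas_cst.
  by apply: cmeasM => //; exact: cmeas_cst.
rewrite ge0_integralZl//; last 2 first.
- by apply: emeasurable_funM => //; exact: measurable_cst.
- by move=> z _; rewrite mule_ge0 ?lee_fin ?nrm2_ge0.
rewrite ge0_integral_Caffine// /G ge0_integral_Cinv//; last by move=> z; exact: f0.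
rewrite -(@ge0_integral_Caffine _ (- c^-1) c^-1 f)//; last first.
  by rewrite oppr_eq0 invr_eq0.
rewrite -ge0_integralZl//; last by move=> z _; exact: f0.
apply: eq_integral => z _; rewrite /F; congr (_ * f (ofC _))%E.
  by rewrite -nrm2V /nrm2 !raddfN /= !sqrrN.
by field.
Qed.

(** Since [(1 + |z|^2)^2 >= (1 + x^2) (1 + y^2)], the integral is at most the square
    of that of [1 / (1 + x^2)]. *)
Lemma integral_cauchyC_lty :
  (\int[lam]_z ((1 + nrm2 (toC z))^-1 ^+ 2)%:E < +oo)%E.
Proof.
have m1 : measurable_fun [set: measurableTypeR R] (fun x => (1 + x ^+ 2 : R)^-1).
  apply: measurable_funV; apply: measurable_funD; first exact: measurable_cst.
  exact: exprn_measurable.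
have p0 (x : R) : 0 < 1 + x ^+ 2 by rewrite ltr_pwDl// sqr_ge0.
have i1 : (\int[mu]_x ((1 + x ^+ 2)^-1)%:E < +oo)%E.
  rewrite (ge0_symfun_integralT (f := fun x => (1 + x ^+ 2)^-1)); last 3 first.
  - by move=> x; rewrite invr_ge0 ltW.
  - by move=> x; have := @continuous_oneDsqrV R x; rewrite /oneDsqr.
  - by move=> x /=; rewrite sqrrN.
  have := @integral0y_oneDsqr R; rewrite /oneDsqr.
  rewrite (_ : [set x | _] = `[0, +oo[%classic); last first.
    by apply/seteqP; split => x /=; rewrite in_itv /= andbT.
  by move=> ->; rewrite -EFinM ltry.
apply: (@le_lt_trans _ _ (\int[lam]_z ((1 + z.1 ^+ 2)^-1%:E * (1 + z.2 ^+ 2)^-1%:E))%E).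
  apply: ge0_le_integral => //.
  - by move=> z _; rewrite lee_fin sqr_ge0.
  - apply/measurable_EFinP; apply: measurable_funX; apply: measurable_funV.
    apply: measurable_funD; [exact: measurable_cst|exact: measurable_nrm2].
  - apply: emeasurable_funM; apply/measurable_EFinP.
      exact: (measurableT_comp m1 (@measurable_fst _ _ _ _)).
    exact: (measurableT_comp m1 (@measurable_snd _ _ _ _)).
  - move=> [x y] _; rewrite -EFinM lee_fin /nrm2 /= -invfM exprVn lef_pV2 ?posrE.
    + have := sqr_ge0 x; have := sqr_ge0 y; move: (x ^+ 2) (y ^+ 2) => a b a0 b0.
      by nra.
    + by rewrite exprn_gt0// ltr_pwDl// addr_ge0// sqr_ge0.
    + by rewrite mulr_gt0.
rewrite lebesgueC_tonelli1; last 2 first.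
- apply: emeasurable_funM; apply/measurable_EFinP.
    exact: (measurableT_comp m1 (@measurable_fst _ _ _ _)).
  exact: (measurableT_comp m1 (@measurable_snd _ _ _ _)).
- by move=> z; rewrite mule_ge0// lee_fin invr_ge0 ltW.
set I := (\int[mu]_x ((1 + x ^+ 2)^-1)%:E)%E in i1 *.
have I0 : (0 <= I)%E by apply: integral_ge0 => x _; rewrite lee_fin invr_ge0 ltW.
rewrite (_ : (\int[mu]_x _)%E = (I * I)%E); first by rewrite lte_mul_pinfty// ge0_fin_numE.
rewrite -[in RHS]ge0_integralZr//; last 2 first.
- exact/measurable_EFinP.
- by move=> x _; rewrite lee_fin invr_ge0 ltW.
apply: eq_integral => x _ /=; rewrite ge0_integralZl//.
- exact/measurable_EFinP.
- by move=> y _; rewrite lee_fin invr_ge0 ltW.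
- by rewrite lee_fin invr_ge0 ltW.
Qed.

End Inversion.

(** * Powers of a measure, one coordinate at a time *)

Section PowerMeasure.
Context d (T : measurableType d) (R : realType).
Variable mu : {sigma_finite_measure set T -> \bar R}.

Definition upd m (t : m.-tuple T) (i : 'I_m) (z : T) : m.-tuple T :=
  [tuple if k == i then z else tnth t k | k < m].

Lemma tnth_upd m (t : m.-tuple T) i z k :
  tnth (upd t i z) k = if k == i then z else tnth t k.
Proof. by rewrite tnth_mktuple. Qed.

Lemma upd_upd m (t : m.-tuple T) i z z' : upd (upd t i z) i z' = upd t i z'.
Proof. by apply: eq_from_tnth => k; rewrite !tnth_upd; case: eqP. Qed.

Lemma upd_id m (t : m.-tuple T) i : upd t i (tnth t i) = t.
Proof. by apply: eq_from_tnth => k; rewrite tnth_upd; case: eqP => // ->. Qed.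

Lemma upd_cons0 m x z (t : m.-tuple T) : upd [tuple of x :: t] ord0 z = [tuple of z :: t].
Proof.
apply: eq_from_tnth => k; rewrite tnth_upd.
by have [j ->|->] := unliftP ord0 k; rewrite ?eqxx ?tnth0 // !tnthS.
Qed.

Lemma upd_consS m x z (t : m.-tuple T) j :
  upd [tuple of x :: t] (lift ord0 j) z = [tuple of x :: upd t j z].
Proof.
apply: eq_from_tnth => k; rewrite tnth_upd.
have [l ->|->] := unliftP ord0 k; last by rewrite tnth0.
by rewrite (inj_eq lift_inj) !tnthS tnth_upd.
Qed.

Lemma measurable_upd m (t : m.-tuple T) i : measurable_fun setT (upd t i).
Proof.
apply/measurable_fun_tnthP => k; have [->|ki] := eqVneq k i.
  rewrite (_ : _ \o _ = id); first exact: measurable_id.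
  by apply/funext => z /=; rewrite tnth_upd eqxx.
rewrite (_ : _ \o _ = cst (tnth t k)); first exact: measurable_cst.
by apply/funext => z /=; rewrite tnth_upd (negbTE ki).
Qed.

Lemma measurable_consT m :
  measurable_fun setT (fun xt : T * m.-tuple T => [tuple of xt.1 :: xt.2]).
Proof. by apply: measurable_cons; [exact: measurable_fst|exact: measurable_snd]. Qed.

Lemma power_measureS m (F : m.+1.-tuple T -> \bar R) :
  measurable_fun setT F -> (forall t, 0 <= F t)%E ->
  (\int[power_measure mu m.+1]_t F t =
   \int[(mu \x power_measure mu m)%E]_xt F [tuple of xt.1 :: xt.2])%E.
Proof.
move=> mF F0.
transitivity (\int[pushforward (mu \x power_measure mu m)%E
    (fun xt : T * m.-tuple T => [tuple of xt.1 :: xt.2])]_t F t)%E.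
  by apply: eq_measure_integral; first exact: measurable_consT.
by rewrite (ge0_integral_pushforward (@measurable_consT m)).
Qed.

Lemma power_measure_tonelli1 m (F : m.+1.-tuple T -> \bar R) :
  measurable_fun setT F -> (forall t, 0 <= F t)%E ->
  (\int[power_measure mu m.+1]_t F t =
   \int[mu]_x \int[power_measure mu m]_t F [tuple of x :: t])%E.
Proof.
move=> mF F0; rewrite power_measureS// fubini_tonelli1//.
exact: (measurableT_comp mF (@measurable_consT m)).
Qed.

Lemma power_measure_tonelli2 m (F : m.+1.-tuple T -> \bar R) :
  measurable_fun setT F -> (forall t, 0 <= F t)%E ->
  (\int[power_measure mu m.+1]_t F t =
   \int[power_measure mu m]_t \int[mu]_x F [tuple of x :: t])%E.
Proof.
move=> mF F0; rewrite power_measureS// fubini_tonelli2//.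
exact: (measurableT_comp mF (@measurable_consT m)).
Qed.

(** Only one coordinate is integrated at a time below; by Tonelli, agreement of
    the integrals along all lines in one coordinate direction is enough. *)
Lemma eq_integral_fiber m (i : 'I_m) (F G : m.-tuple T -> \bar R) :
  measurable_fun setT F -> measurable_fun setT G ->
  (forall t, 0 <= F t)%E -> (forall t, 0 <= G t)%E ->
  (forall t, \int[mu]_z F (upd t i z) = \int[mu]_z G (upd t i z))%E ->
  (\int[power_measure mu m]_t F t = \int[power_measure mu m]_t G t)%E.
Proof.
elim: m i F G => [[]//|m IH] i F G mF mG F0 G0 FG.
have [j ij|i0] := unliftP ord0 i; last first.
  rewrite !power_measure_tonelli2//; apply: eq_integral => t _.
  have [z0|Tvoid] := pselect (exists z : T, True).
    have [z _] := z0; have := FG [tuple of z :: t]; rewrite i0.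
    by under eq_integral do rewrite upd_cons0; under [RHS]eq_integral do rewrite upd_cons0.
  by apply: eq_integral => z _; case: Tvoid; exists z.
rewrite !power_measure_tonelli1//; apply: eq_integral => x _.
have mcx : measurable_fun setT (fun t : m.-tuple T => [tuple of x :: t]).
  by apply: measurable_cons; [exact: measurable_cst|exact: measurable_id].
apply: (IH j) => //; try exact: measurableT_comp.
move=> t; have := FG [tuple of x :: t]; rewrite ij.
by under eq_integral do rewrite upd_consS; under [RHS]eq_integral do rewrite upd_consS.
Qed.

(** Triangular change of variables: the new value [M i t] of the coordinate
    [i] depends on [i] itself and on coordinates of smaller rank only, so that
    the coordinates can be changed one after the other by decreasing rank, each
    with its own one-variable substitution rule. *)
Lemma triangular_change m (r : 'I_m -> nat) (M : 'I_m -> m.-tuple T -> T)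
    (W : 'I_m -> m.-tuple T -> R) (F : m.-tuple T -> \bar R) :
  (forall i, measurable_fun setT (M i)) ->
  (forall i, measurable_fun setT (W i)) -> (forall i t, 0 <= W i t) ->
  (forall i t t', (forall j, (r j < r i)%N || (j == i) -> tnth t j = tnth t' j) ->
    M i t = M i t' /\ W i t = W i t') ->
  (forall i t f, measurable_fun setT f -> (forall z, 0 <= f z)%E ->
    (\int[mu]_z ((W i (upd t i z))%:E * f (M i (upd t i z))) = \int[mu]_z f z)%E) ->
  measurable_fun setT F -> (forall t, 0 <= F t)%E ->
  (\int[power_measure mu m]_t ((\prod_i W i t)%:E * F [tuple M i t | i < m]) =
   \int[power_measure mu m]_t F t)%E.
Proof.
move=> mM mW W0 loc fib.
pose step (s : seq 'I_m) (t : m.-tuple T) := [tuple if i \in s then M i t else tnth t i | i < m].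
have mstep s : measurable_fun setT (step s).
  apply/measurable_fun_tnthP => i; have [is_|is_] := boolP (i \in s).
    rewrite (_ : _ \o _ = M i); first exact: mM.
    by apply/funext => t /=; rewrite tnth_mktuple is_.
  rewrite (_ : _ \o _ = (fun t => tnth t i)); first exact: measurable_tnth.
  by apply/funext => t /=; rewrite tnth_mktuple (negbTE is_).
pose le_r : rel 'I_m := relpre r leq.
suff main s G : uniq s -> sorted le_r s -> measurable_fun setT G ->
    (forall t, 0 <= G t)%E ->
    (\int[power_measure mu m]_t ((\prod_(i <- s) W i t)%:E * G (step s t)) =
     \int[power_measure mu m]_t G t)%E.
  move=> mF F0; pose s := sort le_r (enum 'I_m).
  have ss : forall i, i \in s by move=> i; rewrite mem_sort mem_enum.
  rewrite -(main s F) ?sort_uniq ?enum_uniq//; last first.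
    by apply: sort_sorted => i j; exact: leq_total.
  apply: eq_integral => t _; congr (_%:E * F _)%E.
    rewrite -big_enum; apply: perm_big; rewrite perm_sym /s.
    by rewrite perm_sort.
  by apply: eq_from_tnth => i; rewrite !tnth_mktuple ss.
elim: s G => [|i s IH] G /=.
  move=> _ _ mG G0; apply: eq_integral => t _; rewrite big_nil mul1e; congr G.
  by apply: eq_from_tnth => i; rewrite tnth_mktuple.
move=> /andP[is_ us] pis mG G0.
have ss : sorted le_r s by exact: path_sorted pis.
have rs : {in s, forall j, (r i <= r j)%N}.
  have le_trans : transitive le_r by move=> a b c; exact: leq_trans.
  by move: pis; rewrite (path_sortedE le_trans) => /andP[/allP].
pose S t := upd t i (M i t).
have mS : measurable_fun setT S.
  apply/measurable_fun_tnthP => k; have [->|ki] := eqVneq k i.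
    rewrite (_ : _ \o _ = M i); first exact: mM.
    by apply/funext => t /=; rewrite tnth_upd eqxx.
  rewrite (_ : _ \o _ = (fun t => tnth t k)); first exact: measurable_tnth.
  by apply/funext => t /=; rewrite tnth_upd (negbTE ki).
pose G' t := ((W i t)%:E * G (S t))%E.
have mG' : measurable_fun setT G'.
  by apply: emeasurable_funM; [exact/measurable_EFinP | exact: measurableT_comp].
have G'0 t : (0 <= G' t)%E by rewrite mule_ge0// lee_fin.
have Mstep t : M i (step s t) = M i t /\ W i (step s t) = W i t.
  apply: loc => j ji; rewrite tnth_mktuple; case: ifPn => // js; exfalso.
  case/orP: ji => [|/eqP ji]; first by rewrite ltnNge rs.
  by move: is_; rewrite -ji js.
transitivity (\int[power_measure mu m]_t ((\prod_(j <- s) W j t)%:E * G' (step s t)))%E.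
  apply: eq_integral => t _; rewrite big_cons /G' (Mstep t).2 muleA -EFinM [W i t * _]mulrC.
  congr (_ * G _)%E; apply: eq_from_tnth => k.
  rewrite tnth_mktuple tnth_upd in_cons; have [->|ki] := eqVneq k i => /=.
    by rewrite (Mstep t).1.
  by rewrite tnth_mktuple.
rewrite IH//; apply: (@eq_integral_fiber _ i) => // t.
rewrite -(fib i t (fun z => G (upd t i z)))//.
  by apply: eq_integral => z _; rewrite /G' /S upd_upd.
exact: measurableT_comp (measurable_upd _ _).
Qed.

End PowerMeasure.

Section NullSets.
Variable R : realType.
Local Notation C := R[i].
Local Notation plane := (measurableTypeR R * measurableTypeR R)%type.
Local Notation lam := (@lebesgueC R).

Lemma measurable_zeros d (T : measurableType d) (f : T -> C) :
  cmeas f -> measurable [set t | f t = 0].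
Proof.
move=> mf; have := measurable_nrm2 mf.
move=> /(_ measurableT [set 0] (measurable_set1 _)); rewrite setTI.
rewrite (_ : _ @^-1` _ = [set t | f t = 0])//.
apply/seteqP; split => t /=.
  by move/eqP; rewrite nrm2_eq0 => /eqP.
by move=> ->; apply/eqP; rewrite nrm2_eq0.
Qed.

Lemma negligible_poly_zeros (p : {poly C}) : p != 0 ->
  lam.-negligible [set z : plane | p.[toC z] = 0].
Proof.
move=> p0; have [r rE] := closed_field_poly_normal p.
apply: (@negligibleS _ _ _ _ [set z : plane | toC z \in r]).
  move=> z /= /rootP; rewrite rE rootZ ?lead_coef_eq0// root_prod_XsubC //.
elim: r {rE} => [|a r IH].
  by rewrite (_ : [set _ | _] = set0); [exact: negligible_set0|apply/seteqP; split].
apply: (@negligibleS _ _ _ _ ([set ofC a] `|` [set z : plane | toC z \in r])).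
  by move=> z /=; rewrite in_cons => /orP[/eqP <-|]; [left; rewrite toCK|right].
apply: negligibleU IH; exists [set ofC a]; split => //.
  case: a => x y; rewrite (_ : [set ofC _] = [set x] `*` [set y]).
    exact: measurableX.
  by apply/seteqP; split => [[? ?] [-> ->]|[? ?] [/= -> ->]].
exact: lebesgueC_set1.
Qed.

Definition separately_poly m (f : m.-tuple plane -> C) :=
  forall t i, exists p : {poly C}, forall z, f (upd t i z) = p.[toC z].

(** A nonzero polynomial in one variable has finitely many zeros; the general case
    follows by Fubini, one coordinate at a time. *)
Lemma power_measure_zeros m (f : m.-tuple plane -> C) (t0 : m.-tuple plane) :
  cmeas f -> separately_poly f -> f t0 != 0 ->
  power_measure lam m [set t | f t = 0] = 0%E.
Proof.
elim: m f t0 => [|m IH] f t0 mf pf ft0.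
  rewrite (_ : [set t | f t = 0] = set0) ?measure0//; apply/seteqP; split => // t /=.
  by rewrite (tuple0 t) => /eqP; rewrite -[X in f X](tuple0 t0) (negbTE ft0).
have [x [s t0E]] : exists (x : plane) (s : m.-tuple plane),
    t0 = [tuple of x :: s].
  by exists (thead t0), [tuple of behead t0]; exact: tuple_eta.
pose N := [set t : m.-tuple plane | f [tuple of x :: t] = 0].
have mcx : measurable_fun setT (fun t : m.-tuple plane => [tuple of x :: t]).
  by apply: measurable_cons; [exact: measurable_cst|exact: measurable_id].
have mg : cmeas (fun t : m.-tuple plane => f [tuple of x :: t]).
  by split; [apply: (measurableT_comp mf.1 mcx)|apply: (measurableT_comp mf.2 mcx)].
have N0 : power_measure lam m N = 0%E.
  apply: (IH (fun t => f [tuple of x :: t]) s) => //; last by rewrite -t0E.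
  move=> t i; have [p pE] := pf [tuple of x :: t] (lift ord0 i).
  by exists p => z; rewrite -pE upd_consS.
have mZ : measurable [set t | f t = 0] by exact: measurable_zeros.
pose Z := [set t | f t = 0].
have mZi : measurable_fun setT (fun t => (\1_Z t)%:E : \bar R).
  by apply/measurable_EFinP; exact: measurable_indic.
have Zi0 t : (0 <= (\1_Z t)%:E :> \bar R)%E by rewrite lee_fin.
have <- : (\int[power_measure lam m.+1]_t (\1_Z t)%:E = power_measure lam m.+1 Z)%E.
  by rewrite integral_indic// setIT.
rewrite power_measure_tonelli2//.
rewrite -[RHS](integral0 (power_measure lam m) setT).
apply: ge0_ae_eq_integral => //.
- have := measurable_fun_fubini_tonelli_G (m1 := lam)
    (fun xt : plane * m.-tuple plane => (\1_Z [tuple of xt.1 :: xt.2])%:E).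
  apply => //; exact: (measurableT_comp mZi (@measurable_consT _ _ m)).
- by move=> t _; exact: integral_ge0.
exists N; split => //; first exact: (measurable_zeros mg).
move=> t /= /not_implyP[_]; apply: contra_notP => ft.
have [p pE] := pf [tuple of x :: t] ord0.
have p0 : p != 0.
  apply: contra_notN ft => /eqP p0; rewrite /N /= -[[tuple of x :: t]](upd_id _ ord0).
  by rewrite pE p0 horner0.
rewrite -[RHS](integral0 lam setT); apply: ge0_ae_eq_integral => //.
  apply: (measurableT_comp mZi); apply: measurable_cons; first exact: measurable_id.
  exact: measurable_cst.
apply: (@negligibleS _ _ _ _ [set z : plane | p.[toC z] = 0]); last exact: negligible_poly_zeros.
move=> z /= /not_implyP[_]; apply: contra_notP => pz.
by rewrite indicE memNset// /Z /= -(upd_cons0 x) pE.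
Qed.

End NullSets.

(** * Coordinates on the unipotent group *)

Section Coords.
Context (R : realType) (n : nat).
Local Notation C := R[i].
Local Notation plane := (measurableTypeR R * measurableTypeR R)%type.
Local Notation lam := (@lebesgueC R).
Local Notation mx := 'M[C]_n.
Local Notation upper := (upper n).

Definition position (i : 'I_#|{: upper}|) : 'I_n * 'I_n := val (enum_val i).

Lemma position_lt i : ((position i).1 < (position i).2)%N.
Proof. exact: (valP (enum_val i)). Qed.

Lemma position_inj : injective position.
Proof. by move=> i j /val_inj /enum_val_inj. Qed.

Lemma positionP (k l : 'I_n) : (k < l)%N -> {i | position i = (k, l)}.
Proof.
move=> kl; exists (enum_rank (exist _ (k, l) kl : upper)).
by rewrite /position enum_rankK.
Qed.

Lemma prod_position (S : comPzRingType) (f : 'I_n * 'I_n -> S) :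
  \prod_i f (position i) = \prod_(kl : 'I_n * 'I_n | (kl.1 < kl.2)%N) f kl.
Proof.
rewrite (big_sub (fun kl : 'I_n * 'I_n => (kl.1 < kl.2)%N)).
by rewrite (reindex (@enum_val upper predT)) //; exact/onW_bij/enum_val_bij.
Qed.

Implicit Types x : coords R n.

Lemma coords_mx_position x i :
  coords_mx x (position i).1 (position i).2 = toC (tnth x i).
Proof.
rewrite mxE -surjective_pairing.
rewrite (@insubT _ (fun kl : 'I_n * 'I_n => (kl.1 < kl.2)%N) _ _ (position_lt i)) /=.
rewrite (_ : Sub _ _ = enum_val i) ?enum_valK//.
exact: val_inj.
Qed.

Lemma coords_mx_le x (k l : 'I_n) : (l <= k)%N -> coords_mx x k l = (k == l)%:R.
Proof. by move=> lk; rewrite mxE insubN//= -leqNgt. Qed.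

Lemma cmeas_coords k l : cmeas (fun x => coords_mx x k l).
Proof.
have [kl|lk] := ltnP k l.
  have [i ikl] := positionP kl.
  have -> : (fun x => coords_mx x k l) = (fun x => toC (tnth x i)).
    by apply/funext => x; rewrite -coords_mx_position ikl.
  by apply: cmeas_toC; exact: measurable_tnth.
have -> : (fun x => coords_mx x k l) = (fun=> (k == l)%:R).
  by apply/funext => x; exact: coords_mx_le.
exact: cmeas_cst.
Qed.

Lemma add_delta_mxE a b (A : 'M[C]_(a, b)) c i j k l :
  (A + c *: delta_mx i j) k l = A k l + c * ((k == i) && (l == j))%:R.
Proof. by rewrite !mxE. Qed.

Lemma coords_mx_upd x i z : coords_mx (upd x i z) =
  coords_mx (upd x i (0, 0)) + toC z *: delta_mx (position i).1 (position i).2.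
Proof.
apply/matrixP => k l; rewrite add_delta_mxE.
have [kl|lk] := ltnP k l; last first.
  rewrite !coords_mx_le//; case: andP => [[/eqP ki /eqP li]|_]; last by rewrite mulr0 addr0.
  by have := position_lt i; rewrite -ki -li ltnNge lk.
have [j jkl] := positionP kl.
have -> : k = (position j).1 by rewrite jkl.
have -> : l = (position j).2 by rewrite jkl.
rewrite !coords_mx_position !tnth_upd -xpair_eqE -!surjective_pairing.
rewrite (inj_eq position_inj); case: ifP => _; last by rewrite mulr0 addr0.
by rewrite mulr1 [toC (0, 0)](_ : _ = 0) ?add0r.
Qed.

Lemma is_unipotentP (Z : mx) : reflect
  (forall k l : 'I_n, (l <= k)%N -> Z k l = (k == l)%:R) (is_unipotent Z).
Proof.
apply: (iffP forallP) => ZP k.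
  by move=> l lk; apply/eqP; move/forallP/(_ l)/implyP/(_ lk) : (ZP k).
by apply/forallP => l; apply/implyP => lk; rewrite ZP.
Qed.

Definition mx_coords (Z : mx) : coords R n :=
  [tuple ofC (Z (position i).1 (position i).2) | i < _].

Lemma mx_coordsK (Z : mx) : is_unipotent Z -> coords_mx (mx_coords Z) = Z.
Proof.
move=> /is_unipotentP ZU; apply/matrixP => k l; have [kl|lk] := ltnP k l.
  have [j jkl] := positionP kl.
  have -> : k = (position j).1 by rewrite jkl.
  have -> : l = (position j).2 by rewrite jkl.
  by rewrite coords_mx_position tnth_mktuple ofCK.
by rewrite coords_mx_le// ZU.
Qed.

(** The form in which changes of coordinates on the unipotent group are given. *)
Definition unip_mx (N : 'I_n -> 'I_n -> mx -> C) (Z : mx) : mx :=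
  \matrix_(k, l) if (k < l)%N then N k l Z else (k == l)%:R.

Lemma unip_mxE N Z k l :
  unip_mx N Z k l = if (k < l)%N then N k l Z else (k == l)%:R.
Proof. by rewrite mxE. Qed.

Lemma unip_mx_unipotent N Z : is_unipotent (unip_mx N Z).
Proof. by apply/is_unipotentP => k l lk; rewrite mxE ltnNge lk. Qed.

(** The triangular change of variables, read on unipotent matrices. *)
Lemma unipotent_change (r : 'I_n -> 'I_n -> nat)
    (N : 'I_n -> 'I_n -> mx -> C) (W : 'I_n -> 'I_n -> mx -> R) (K : mx -> R) :
  (forall k l : 'I_n, (k < l)%N -> cmeas (fun x => N k l (coords_mx x))) ->
  (forall k l : 'I_n, (k < l)%N -> measurable_fun setT (fun x => W k l (coords_mx x))) ->
  (forall k l Z, 0 <= W k l Z) ->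
  (forall (k l : 'I_n) Z Z', (k < l)%N -> is_unipotent Z -> is_unipotent Z' ->
    (forall k' l' : 'I_n, (k' < l')%N -> (r k' l' < r k l)%N || ((k', l') == (k, l)) ->
       Z k' l' = Z' k' l') -> N k l Z = N k l Z' /\ W k l Z = W k l Z') ->
  (forall (k l : 'I_n) (A : mx) f, (k < l)%N -> is_unipotent A -> A k l = 0 ->
    measurable_fun setT f -> (forall z, 0 <= f z)%E ->
    (\int[lam]_z ((W k l (A + toC z *: delta_mx k l)%R)%:E *
       f (ofC (N k l (A + toC z *: delta_mx k l)%R))) = \int[lam]_z f z)%E) ->
  measurable_fun setT (fun x => K (coords_mx x)) -> (forall Z, 0 <= K Z) ->
  (\int[dZ R n]_x ((\prod_(kl : 'I_n * 'I_n | (kl.1 < kl.2)%N)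
      W kl.1 kl.2 (coords_mx x)) * K (unip_mx N (coords_mx x)))%:E =
   \int[dZ R n]_x (K (coords_mx x))%:E)%E.
Proof.
move=> mN mW W0 loc fib mK K0.
pose M i x := ofC (N (position i).1 (position i).2 (coords_mx x)).
pose V i x := W (position i).1 (position i).2 (coords_mx x).
have := @triangular_change _ _ _ (@lebesgueC R) _
  (fun i => r (position i).1 (position i).2) M V (fun x => (K (coords_mx x))%:E).
move=> <- //.
- apply: eq_integral => x _; rewrite EFinM; congr (_%:E * (K _)%:E)%E.
    by rewrite -(prod_position (fun kl => W kl.1 kl.2 (coords_mx x))).
  rewrite -[LHS](mx_coordsK (unip_mx_unipotent _ _)); congr coords_mx.
  apply: eq_from_tnth => i; rewrite !tnth_mktuple.
  by rewrite /M mxE position_lt.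
- by move=> i; apply: measurable_ofC; apply: mN; exact: position_lt.
- by move=> i; apply: mW; exact: position_lt.
- by move=> i x; exact: W0.
- move=> i x x' xx'.
  have [|NE WE] := loc _ _ _ _ (position_lt i) (coords_unipotent x)
    (coords_unipotent x').
    move=> k l kl rkl; have [j jkl] := positionP kl.
    have -> : k = (position j).1 by rewrite jkl.
    have -> : l = (position j).2 by rewrite jkl.
    rewrite !coords_mx_position xx'// jkl /=.
    case/orP: rkl => [->//|/eqP]; rewrite -jkl -surjective_pairing => /position_inj ->.
    by rewrite eqxx orbT.
  by rewrite /M /V NE WE.
- move=> i x f mf f0; rewrite -[RHS](fib (position i).1 (position i).2
    (coords_mx (upd x i (0, 0))) f)//.
  + by apply: eq_integral => z _; rewrite /V /M coords_mx_upd.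
  + exact: position_lt.
  + exact: coords_unipotent.
  + by rewrite coords_mx_position tnth_upd eqxx.
- exact/measurable_EFinP.
- by move=> x; rewrite lee_fin.
Qed.

End Coords.

(** * Right translations and the invariant integral *)

Section Translation.
Context (R : realType) (n : nat).
Local Notation C := R[i].
Local Notation plane := (measurableTypeR R * measurableTypeR R)%type.
Local Notation lam := (@lebesgueC R).
Local Notation mx := 'M[C]_n.

(** The character of [B^-] that compensates the Jacobian of the action of GL on
    the unipotent matrices, seen as an open part of the flag manifold [B^-\GL]. *)
Definition delta (b : mx) : R :=
  \prod_(k < n) \prod_(l < n | (k < l)%N) (nrm2 (b l l) / nrm2 (b k k)).

Lemma prod_pairs (S : comPzRingType) (f : 'I_n -> 'I_n -> S) :
  \prod_(kl : 'I_n * 'I_n | (kl.1 < kl.2)%N) f kl.1 kl.2 =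
  \prod_(k < n) \prod_(l < n | (k < l)%N) f k l.
Proof. by rewrite pair_big_dep. Qed.

(** Nonnegative densities on [B^-\GL], written as functions on GL. *)
Definition top_density (K : mx -> R) : Prop :=
  [/\ forall h, 0 <= K h,
      forall b g, in_Bminus b -> g \in unitmx -> K (b *m g) = delta b * K g &
      forall M : coords R n -> mx, (forall x, M x \in unitmx) ->
        (forall k l, cmeas (fun x => M x k l)) ->
        measurable_fun setT (fun x => K (M x))].

(** The integral of a density over the big cell is unchanged by the translation by
    [g]; these [g] form a group, and the aim is to show that it is all of GL. *)
Definition preserves (g : mx) : Prop := g \in unitmx /\
  forall K, top_density K ->
  (\int[dZ R n]_x (K (coords_mx x *m g))%:E = \int[dZ R n]_x (K (coords_mx x))%:E)%E.

Lemma unipotent_unit (Z : mx) : is_unipotent Z -> Z \in unitmx.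
Proof. by move=> ZU; rewrite unitmxE unipotent_det ?unitr1. Qed.

Lemma coords_unit (x : coords R n) : coords_mx x \in unitmx.
Proof. exact/unipotent_unit/coords_unipotent. Qed.

Lemma cmeas_mulmx d (T : measurableType d) m p q (A : T -> 'M[C]_(m, p))
    (B : T -> 'M[C]_(p, q)) :
  (forall k l, cmeas (fun x => A x k l)) -> (forall k l, cmeas (fun x => B x k l)) ->
  forall k l, cmeas (fun x => (A x *m B x) k l).
Proof.
move=> mA mB k l; under eq_fun do rewrite mxE.
by apply: cmeas_sum => i; exact: cmeasM.
Qed.

Lemma top_density_translate (K : mx -> R) g : g \in unitmx ->
  top_density K -> top_density (fun h => K (h *m g)).
Proof.
move=> gU [K0 Kcov Kmeas]; split => //.
  by move=> b h Bb hU; rewrite -mulmxA Kcov// unitmx_mul hU.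
move=> M MU mM; apply: Kmeas => [x|]; first by rewrite unitmx_mul MU.
by apply: cmeas_mulmx => // k l; exact: cmeas_cst.
Qed.

Lemma preservesM g h : preserves g -> preserves h -> preserves (g *m h).
Proof.
move=> [gU Qg] [hU Qh]; split=> [|K dK]; first by rewrite unitmx_mul gU.
rewrite -(Qh _ dK) -(Qg _ (top_density_translate hU dK)).
by apply: eq_integral => x _; rewrite mulmxA.
Qed.

Lemma mul_add_delta (A g : mx) c k i l :
  ((A + c *: delta_mx k i) *m g) k l = (A *m g) k l + c * g i l.
Proof.
rewrite !mxE (bigD1 i)//= [in RHS](bigD1 i)//= add_delta_mxE !eqxx mulr1 mulrDl.
rewrite -!addrA; congr (_ + _); rewrite addrC; congr (_ + _).
by apply: eq_bigr => j /negbTE ji; rewrite add_delta_mxE ji andbF mulr0 addr0.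
Qed.

Lemma fiber_affine (a b : C) (f : plane -> \bar R) : a != 0 ->
  measurable_fun setT f -> (forall z, (0 <= f z)%E) ->
  forall (w : plane -> R) (N : plane -> C), (forall z, w z = nrm2 a) ->
    (forall z, N z = a * toC z + b) ->
  (\int[lam]_z ((w z)%:E * f (ofC (N z))) = \int[lam]_z f z)%E.
Proof.
move=> a0 mf f0 w N wE NE; rewrite -(ge0_integral_Caffine b a0 mf f0).
by apply: eq_integral => z _; rewrite wE NE.
Qed.

Lemma trig_unitmx (b : mx) : is_trig_mx b -> (forall k, b k k != 0) -> in_Bminus b.
Proof.
move=> bt b0; split => //; rewrite unitmxE det_trig// unitfE.
by apply/prodf_neq0 => k _.
Qed.

Lemma Bminus_diag_neq0 (b : mx) k : in_Bminus b -> b k k != 0.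
Proof.
move=> [bt]; rewrite unitmxE det_trig// unitfE => /prodf_neq0; exact.
Qed.

(** Decompositions [Z g = b Z'] are available only off the zeros of a polynomial
    [f], a null set. *)
Lemma eq_density_integral (F G : coords R n -> R) (t : coords R n) (f : coords R n -> C) :
  measurable_fun setT F -> measurable_fun setT G ->
  (forall x, 0 <= F x) -> (forall x, 0 <= G x) ->
  cmeas f -> separately_poly f -> f t != 0 ->
  (forall x, f x != 0 -> F x = G x) ->
  (\int[dZ R n]_x (F x)%:E = \int[dZ R n]_x (G x)%:E)%E.
Proof.
move=> mF mG F0 G0 mf pf ft FG; apply: ge0_ae_eq_integral => //.
- exact/measurable_EFinP.
- exact/measurable_EFinP.
- by move=> x _; rewrite lee_fin.
- by move=> x _; rewrite lee_fin.
exists [set x | f x = 0]; split; first exact: measurable_zeros.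
  exact: (power_measure_zeros mf pf ft).
move=> x /= /not_implyP[_]; apply: contra_notP => /eqP fx.
by rewrite FG.
Qed.

(** For upper triangular [g] one has [Z g = b Z'] with [b] the diagonal of [g].
    Each entry of [Z'] is affine in the corresponding entry of [Z], with
    coefficients from the columns further to the left. *)
Lemma preserves_upper (g : mx) : is_trig_mx g^T -> (forall k, g k k != 0) ->
  preserves g.
Proof.
move=> gT g0.
have gle (k l : 'I_n) : (l < k)%N -> g k l = 0.
  by move=> lk; have /is_trig_mxP/(_ _ _ lk) := gT; rewrite mxE.
have gU : g \in unitmx.
  by rewrite -unitmx_tr; apply: (proj2 (trig_unitmx gT _)) => k; rewrite mxE.
split => // K dK; have [K0 Kcov Kmeas] := dK.
pose N (k l : 'I_n) (Z : mx) := (Z *m g) k l / g k k.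
pose W (k l : 'I_n) (Z : mx) := nrm2 (g l l / g k k).
have mZ : measurable_fun setT (fun x : coords R n => K (coords_mx x)).
  by apply: Kmeas; [exact: coords_unit|move=> *; exact: cmeas_coords].
rewrite -(@unipotent_change R n (fun k l => l : nat) N W K)//.
- apply: eq_integral => x _; congr EFin.
  pose b : mx := diag_mx (\row_k g k k).
  have Bb : in_Bminus b.
    apply: trig_unitmx => [|k]; last by rewrite !mxE eqxx mulr1n.
    by apply/is_trig_mxP => k l kl; rewrite !mxE -val_eqE /= (ltn_eqF kl).
  have -> : coords_mx x *m g = b *m unip_mx N (coords_mx x).
    apply/matrixP => k l; rewrite mul_diag_mx [RHS]mxE [(\row_k _) 0 k]mxE.
    rewrite unip_mxE; have [kl|lk] := ltnP k l; first by rewrite /N mulrCA divff// mulr1.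
    rewrite mxE (bigD1 k)//= coords_mx_le// eqxx mul1r big1 ?addr0; last first.
      move=> i ik; have [ki|ik'] := ltnP k i.
        by rewrite (gle i l) ?mulr0// (leq_ltn_trans lk ki).
      by rewrite coords_mx_le// eq_sym (negbTE ik) mul0r.
    have [->|kl] := eqVneq k l; first by rewrite mulr1.
    by rewrite mulr0 gle// ltn_neqAle lk andbT eq_sym.
  rewrite Kcov//; last exact: unipotent_unit (unip_mx_unipotent _ _).
  congr (_ * _); rewrite /W (prod_pairs (fun k l => nrm2 (g l l / g k k))).
  apply: eq_bigr => k _; apply: eq_bigr => l _.
  by rewrite nrm2M nrm2V !mxE !eqxx !mulr1n.
- move=> k l kl; apply: cmeasM; last exact: cmeas_cst.
  by apply: (@cmeas_mulmx _ _ _ _ _ (fun x => coords_mx x) (fun=> g)) => *;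
    [exact: cmeas_coords | exact: cmeas_cst].
- by move=> *; exact: nrm2_ge0.
- move=> k l Z Z' kl ZU ZU' ZZ'; split => //; congr (_ / _).
  rewrite !mxE; apply: eq_bigr => i _.
  have [il|li] := ltnP l i; first by rewrite (gle i l)// !mulr0.
  have [ik|ki] := leqP i k; first by rewrite (elimT (is_unipotentP _) ZU)// (elimT (is_unipotentP _) ZU').
  congr (_ * _); apply: ZZ' => //; move: li; rewrite leq_eqVlt => /orP[|->//].
  by move=> /eqP/val_inj ->; rewrite eqxx orbT.
- move=> k l A f kl AU Akl mf f0.
  apply: (@fiber_affine (g l l / g k k) ((A *m g) k l / g k k)) => //.
    by rewrite mulf_neq0// invr_eq0.
  by move=> z; rewrite /N mul_add_delta; ring.
Qed.

End Translation.

Section LowerTransvection.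
Context (R : realType) (n : nat).
Local Notation C := R[i].
Local Notation plane := (measurableTypeR R * measurableTypeR R)%type.
Local Notation lam := (@lebesgueC R).
Local Notation mx := 'M[C]_n.

Lemma measurable_bigprod d (T : measurableType d) (I : Type) (r : seq I) (P : pred I)
    (f : I -> T -> R) : (forall i, P i -> measurable_fun setT (f i)) ->
  measurable_fun setT (fun x => \prod_(i <- r | P i) f i x).
Proof.
move=> mf; elim: r => [|i r IH].
  by under eq_fun do rewrite big_nil; exact: measurable_cst.
have [Pi|/negbTE nPi] := boolP (P i); last by under eq_fun do rewrite big_cons nPi.
under eq_fun do rewrite big_cons Pi.
by apply: measurable_funM => //; exact: mf.
Qed.

Lemma cmeas_eq0 d (T : measurableType d) (f : T -> C) : cmeas f ->
  cmeas (fun x => (f x == 0)%:R : C).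
Proof.
move=> mf; have -> : (fun x => (f x == 0)%:R : C) =
    (fun x => (\1_[set t | f t = 0] x)%:C :> C).
  apply/funext => x; rewrite indicE; have [fx|fx] := eqVneq (f x) 0.
    by rewrite mem_set.
  by rewrite memNset//; exact/eqP.
apply: cmeas_real; apply: measurable_indic; exact: measurable_zeros.
Qed.

Lemma separately_poly_entry (k l : 'I_n) :
  separately_poly (fun x : coords R n => coords_mx x k l).
Proof.
move=> t i; exists ((coords_mx (upd t i (0, 0)) k l)%:P +
  ((k == (position i).1) && (l == (position i).2))%:R *: 'X) => z.
by rewrite coords_mx_upd add_delta_mxE hornerD hornerC hornerZ hornerX mulrC.
Qed.

Section Generator.
Variables (c : C) (j j' : 'I_n).
Hypothesis jj' : j' = j.+1 :> nat.

Let y : mx := 1%:M + c *: delta_mx j' j.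
Let u (Z : mx) : C := 1 + c * Z j j'.
(** A version of [u] without zeros: the substitution has to be invertible on every
    line, also on the null set where [u] vanishes. *)
Let w (Z : mx) : C := u Z + (u Z == 0)%:R.

Let w0 Z : w Z != 0.
Proof.
rewrite /w; have [->|u0] := eqVneq (u Z) 0; first by rewrite add0r oner_eq0.
by rewrite addr0.
Qed.

Let wE Z : u Z != 0 -> w Z = u Z.
Proof. by rewrite /w => /negbTE ->; rewrite addr0. Qed.

Let ltjj' : (j < j')%N. Proof. by rewrite jj'. Qed.
Let neq_j'j : (j' == j) = false. Proof. by rewrite -val_eqE /= gtn_eqF. Qed.
Let neq_jj' : (j == j') = false. Proof. by rewrite eq_sym. Qed.

Let N (k l : 'I_n) (Z : mx) : C :=
  if k == j then (if l == j' then Z j j' / u Z else Z j l / w Z)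
  else if k == j' then w Z * Z j' l - c * Z j l
  else if l == j then Z k j + c * Z k j' else Z k l.

Let W (k l : 'I_n) (Z : mx) : R :=
  if k == j then (if l == j' then (nrm2 (u Z))^-1 ^+ 2 else nrm2 (w Z)^-1)
  else if k == j' then nrm2 (w Z) else 1.

(** The order of substitution: row [j'] uses row [j], which uses the entry
    [(j, j')]; column [j] uses column [j'] in the other rows. *)
Let rk (k l : 'I_n) : nat :=
  if k == j' then 2%N else if k == j then (l != j') else (l == j).

Let b (Z : mx) : mx := \matrix_(k, l)
  if k == l then (if k == j then u Z else if k == j' then (u Z)^-1 else 1)
  else if (k == j') && (l == j) then c else 0.

Lemma lower_mulE (Z : mx) k l : (Z *m y) k l = Z k l + (l == j)%:R * (c * Z k j').
Proof.
rewrite mulmxDr mulmx1 mxE -scalemxAr; congr (_ + _); rewrite !mxE (bigD1 j')//= !mxE eqxx /=.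
rewrite big1 ?addr0; first by ring.
by move=> i /negbTE ij; rewrite mxE ij mulr0.
Qed.

(** Right multiplication by [y] adds a multiple of column [j'] to column [j], which
    only disturbs the unit diagonal in row [j] and the zero at [(j', j)]. Dividing row
    [j] by [u Z], clearing the other entry with row [j] and rescaling row [j'] gives the
    factorization [Z y = b Z']. *)
Lemma lower_factor (Z : mx) : is_unipotent Z -> u Z != 0 ->
  Z *m y = b Z *m unip_mx N Z.
Proof.
move=> /is_unipotentP ZU uZ; apply/matrixP => k l; rewrite lower_mulE.
have [->|kj'] := eqVneq k j'; last first.
  rewrite mxE (bigD1 k)//= big1 ?addr0; last first.
    by move=> i ik; rewrite mxE eq_sym (negbTE ik) (negbTE kj') /= mul0r.
  rewrite mxE eqxx (negbTE kj') unip_mxE /N (negbTE kj').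
  have [->|kj] := eqVneq k j.
    have [jl|lj] := ltnP j l.
      rewrite [l == j]gtn_eqF// mul0r addr0; case: eqP => [->|_].
        by rewrite mulrC divfK.
      by rewrite wE// mulrC divfK.
    rewrite ZU// [j == l]eq_sym; have [_|lj'] := eqVneq l j.
      by rewrite /u mulr1 mul1r.
    by rewrite mul0r addr0 mulr0.
  rewrite mul1r; have [kl|lk] := ltnP k l.
    by case: eqP => [->|]; rewrite ?mul1r// mul0r addr0.
  rewrite ZU//; have [lj|lj] := eqVneq l j; last by rewrite mul0r addr0.
  rewrite ZU ?mulr0 ?addr0 ?(negbTE kj')//; first by rewrite mul1r mulr0 addr0.
  have : (j < k)%N by rewrite ltn_neqAle -lj lk andbT lj eq_sym; exact: kj.
  by rewrite jj'.
rewrite mxE (bigD1 j')//= (bigD1 j)//=; last by rewrite neq_jj'.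
rewrite big1 ?addr0; last first.
  move=> i /andP[ij' ij]; rewrite mxE eq_sym (negbTE ij') eqxx (negbTE ij) /=.
  by rewrite mul0r.
rewrite !mxE neq_j'j !eqxx /= /N neq_j'j !eqxx.
have [j'l|lj'] := ltnP j' l.
  have jl : (j < l)%N by exact: ltn_trans j'l.
  rewrite jl [l == j]gtn_eqF// [l == j']gtn_eqF// wE// mul0r addr0.
  by field; rewrite uZ.
rewrite ZU// ZU//; have [->|nlj'] := eqVneq l j'.
  rewrite ltjj' neq_j'j mul0r addr0 (_ : true%:R = 1 :> C)//.
  by transitivity (u Z / u Z); [rewrite divff|rewrite {1}/u; ring].
have lj : (l <= j)%N by rewrite -ltnS -jj' ltn_neqAle nlj'.
rewrite ltnNge lj /= [j == l]eq_sym eqxx (_ : true%:R = 1 :> C)// (_ : false%:R = 0 :> C)//.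
by case: (l == j) => /=; ring.
Qed.

Lemma b_in_Bminus Z : u Z != 0 -> in_Bminus (b Z).
Proof.
move=> uZ; apply: trig_unitmx => [|k].
  apply/is_trig_mxP => k l kl; rewrite mxE -val_eqE /= (ltn_eqF kl).
  case: andP => // -[/eqP kj' /eqP lj].
  by move: kl; rewrite kj' lj jj' ltnNge leqnSn.
rewrite mxE eqxx; have [_//|_] := eqVneq k j.
by have [_|_] := eqVneq k j'; rewrite ?invr_eq0 ?oner_eq0.
Qed.

Lemma delta_b Z : u Z != 0 ->
  delta (b Z) = \prod_(k < n) \prod_(l < n | (k < l)%N) W k l Z.
Proof.
move=> uZ; rewrite /delta; apply: eq_bigr => k _.
pose s := nrm2 (u Z); have s0 : s != 0 by rewrite nrm2_eq0.
have bE i : nrm2 (b Z i i) = if i == j then s else if i == j' then s^-1 else 1.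
  rewrite mxE eqxx; have [_//|_] := eqVneq i j.
  by have [_|_] := eqVneq i j'; rewrite ?nrm2V ?nrm2_1.
have [kj|jk] := ltnP k j.
  have kj' : (k < j')%N by exact: ltn_trans ltjj'.
  have kjF : (k == j) = false by rewrite -val_eqE /= ltn_eqF.
  have kj'F : (k == j') = false by rewrite -val_eqE /= ltn_eqF.
  rewrite [RHS]big1; last by move=> l _; rewrite /W kjF kj'F.
  rewrite (bigD1 j)//= (bigD1 j')/=; last by rewrite kj' neq_j'j.
  rewrite big1 ?mulr1; last first.
    move=> l /andP[/andP[_ /negbTE lj] /negbTE lj'].
    by rewrite !bE lj lj' kjF kj'F divr1.
  by rewrite !bE neq_j'j !eqxx kjF kj'F !divr1 divff.
apply: eq_bigr => l kl; rewrite !bE /W.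
have [kj|kj] := eqVneq k j.
  have -> : (l == j) = false by rewrite -val_eqE /= gtn_eqF// -kj.
  by case: eqP => _; rewrite -?/s -?expr2 // wE// nrm2V div1r.
have j'k : (j' <= k)%N by rewrite jj' ltn_neqAle jk andbT eq_sym.
have -> : (l == j) = false.
  by rewrite -val_eqE /= gtn_eqF// (leq_ltn_trans jk).
have -> : (l == j') = false.
  by rewrite -val_eqE /= gtn_eqF// (leq_ltn_trans j'k).
by case: eqP => _; rewrite ?divr1// invrK mul1r wE.
Qed.

(** Under [Z |-> Z'] the entry at [(j, j')] undergoes the substitution
    [z / (1 + c z)] and all other entries affine ones. *)
Lemma preserves_lower : preserves y.
Proof.
have yU : y \in unitmx.
  apply: (proj2 (trig_unitmx _ _)).
    apply/is_trig_mxP => k l kl; rewrite !mxE -val_eqE /= (ltn_eqF kl) add0r.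
    case: andP => [[/eqP kj' /eqP lj]|_]; last by rewrite mulr0.
    by move: kl; rewrite kj' lj jj' ltnNge leqnSn.
  move=> k; rewrite !mxE eqxx; case: andP => [[/eqP -> /eqP]|_].
    by move/eqP; rewrite neq_j'j.
  by rewrite mulr0 addr0 oner_eq0.
split=> // K dK; have [K0 Kcov Kmeas] := dK.
have mE k l : cmeas (fun x : coords R n => coords_mx x k l) by exact: cmeas_coords.
have mu_ : cmeas (fun x : coords R n => u (coords_mx x)).
  apply: cmeasD; first exact: cmeas_cst.
  by apply: cmeasM; [exact: cmeas_cst|exact: mE].
have mw : cmeas (fun x : coords R n => w (coords_mx x)).
  by apply: cmeasD => //; exact: cmeas_eq0.
have mN k l : cmeas (fun x : coords R n => N k l (coords_mx x)).
  rewrite /N; case: eqP => _.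
    by case: eqP => _; apply: cmeasM => //; exact: cmeasV.
  case: eqP => _.
    apply: cmeasD; first exact: cmeasM.
    by apply: cmeasN; apply: cmeasM => //; exact: cmeas_cst.
  case: eqP => _ //; apply: cmeasD => //.
  by apply: cmeasM => //; exact: cmeas_cst.
have mW k l : measurable_fun setT (fun x : coords R n => W k l (coords_mx x)).
  rewrite /W; case: eqP => _.
    case: eqP => _.
      by apply: measurable_funX; apply: measurable_funV; exact: measurable_nrm2.
    by apply: measurable_nrm2; exact: cmeasV.
  by case: eqP => _; [exact: measurable_nrm2|exact: measurable_cst].
have W0 k l Z : 0 <= W k l Z.
  by rewrite /W; case: eqP => _; case: eqP => _; rewrite ?sqr_ge0 ?nrm2_ge0.
have mZ : measurable_fun setT (fun x : coords R n => K (coords_mx x)).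
  by apply: Kmeas; [exact: coords_unit|].
rewrite -(@unipotent_change R n rk N W K)//.
- apply: (@eq_density_integral R n _ _ (mx_coords 1%:M) (fun x => u (coords_mx x))) => //.
  + apply: Kmeas => [x|]; first by rewrite unitmx_mul coords_unit.
    by apply: cmeas_mulmx => // k l; exact: cmeas_cst.
  + apply: measurable_funM; first by apply: measurable_bigprod => kl _; exact: mW.
    apply: Kmeas => [x|k l]; first exact: unipotent_unit (unip_mx_unipotent _ _).
    rewrite (_ : (fun x => _) =
      (fun x : coords R n => if (k < l)%N then N k l (coords_mx x) else (k == l)%:R)).
      by case: (k < l)%N => //; exact: cmeas_cst.
    by apply/funext => x; rewrite unip_mxE.
  + by move=> x; apply: mulr_ge0 => //; apply: prodr_ge0 => kl _.
  + move=> t i; have [p pE] := separately_poly_entry j j' t i.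
    exists (1 + c *: p) => z; rewrite /u pE.
    by rewrite hornerD hornerC hornerZ.
  + rewrite mx_coordsK; last by apply/is_unipotentP => k l _; rewrite mxE.
    by rewrite /u mxE neq_jj' mulr0 addr0 oner_eq0.
  + move=> x ux; rewrite lower_factor//; last exact: coords_unipotent.
    rewrite Kcov; [|exact: b_in_Bminus|exact: unipotent_unit (unip_mx_unipotent _ _)].
    by rewrite delta_b// (prod_pairs (fun k l => W k l (coords_mx x))).
- move=> k l Z Z' kl ZU ZU' ZZ'.
  have Ekl : Z k l = Z' k l by apply: ZZ' => //; rewrite eqxx orbT.
  rewrite /N /W; have [kj|kj] := eqVneq k j.
    have [lj'|lj'] := eqVneq l j'; first by rewrite /u -lj' -kj Ekl.
    have E : Z j j' = Z' j j'.
      by apply: ZZ' => //; rewrite kj /rk neq_jj' !eqxx /= lj'.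
    by rewrite /w /u E -kj Ekl.
  have [kj'|kj'] := eqVneq k j'.
    have E : Z j j' = Z' j j'.
      by apply: ZZ' => //; rewrite kj' /rk neq_jj' !eqxx.
    have E' : Z j l = Z' j l.
      apply: ZZ'; first by rewrite (ltn_trans ltjj')// -kj'.
      by rewrite kj' /rk neq_jj' !eqxx; case: (l == j').
    by rewrite /w /u E E' -kj' Ekl.
  have [lj|lj] := eqVneq l j; last by rewrite Ekl.
  rewrite -lj Ekl; split => //; congr (_ + _ * _); apply: ZZ'.
    by rewrite (ltn_trans kl)// lj.
  by rewrite /rk (negbTE kj') (negbTE kj) lj eqxx neq_j'j.
- move=> k l A f kl AU Akl mf f0.
  have [kj|kj] := eqVneq k j.
    have [lj'|lj'] := eqVneq l j'.
      rewrite -(ge0_integral_moebius c mf f0); apply: eq_integral => z _.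
      rewrite /N /W kj lj' !eqxx /u add_delta_mxE !eqxx mulr1.
      by rewrite kj lj' in Akl; rewrite Akl add0r.
    apply: (@fiber_affine _ (w A)^-1 0) => // [|z|z]; first by rewrite invr_eq0.
      by rewrite /W kj eqxx (negbTE lj') /w /u add_delta_mxE eq_sym (negbTE lj') andbF mulr0 addr0.
    rewrite /N kj eqxx (negbTE lj') /w /u !add_delta_mxE [j' == l]eq_sym (negbTE lj') !eqxx /=.
    by rewrite kj in Akl; rewrite mulr0 !addr0 mulr1 Akl add0r mulrC.
  have [kj'|kj'] := eqVneq k j'.
    have lj' : (l == j') = false by rewrite -val_eqE /= gtn_eqF// -kj'.
    have lj : (l == j) = false.
      by rewrite -val_eqE /= gtn_eqF// (ltn_trans ltjj')// -kj'.
    apply: (@fiber_affine _ (w A) (- (c * A j l))) => // z.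
      by rewrite /W kj' neq_j'j eqxx /w /u add_delta_mxE neq_jj' mulr0 addr0.
    rewrite kj' in Akl.
    rewrite /N kj' neq_j'j eqxx /w /u !add_delta_mxE neq_jj' !eqxx /= Akl.
    by rewrite !mulr0 !addr0 mulr1 add0r.
  have [lj|lj] := eqVneq l j.
    apply: (@fiber_affine _ 1 (c * A k j')) => // z.
      by rewrite /W (negbTE kj) (negbTE kj') nrm2_1.
    rewrite lj in Akl.
    rewrite /N (negbTE kj) (negbTE kj') lj eqxx !add_delta_mxE !eqxx neq_j'j andbF /=.
    by rewrite Akl mulr0 addr0 mulr1 add0r mul1r.
  apply: (@fiber_affine _ 1 0) => // z.
    by rewrite /W (negbTE kj) (negbTE kj') nrm2_1.
  rewrite /N (negbTE kj) (negbTE kj') (negbTE lj) add_delta_mxE !eqxx Akl.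
  by rewrite mulr1 add0r mul1r addr0.
Qed.

End Generator.
End LowerTransvection.

Section Generation.
Context (R : realType).
Local Notation C := R[i].

Section Perms.
Variable n : nat.
Local Notation mx := 'M[C]_n.

Lemma preserves_upper_transvection (c : C) (j j' : 'I_n) : (j < j')%N ->
  preserves (1%:M + c *: delta_mx j j' : mx).
Proof.
move=> jj'; have jj'F : (j' == j) = false by rewrite -val_eqE /= gtn_eqF.
apply: preserves_upper => [|k].
  apply/is_trig_mxP => k l kl; rewrite !mxE -val_eqE /= (gtn_eqF kl) add0r.
  case: andP => [[/eqP lj /eqP kj']|_]; last by rewrite mulr0.
  by move: kl; rewrite lj kj' ltnNge ltnW.
rewrite !mxE eqxx; have [->|_] := eqVneq k j; last by rewrite mulr0 addr0 oner_eq0.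
by rewrite [j == j']eq_sym jj'F mulr0 addr0 oner_eq0.
Qed.

(** The simple reflection of [GL(2)] as a product of transvections, up to a sign. *)
Lemma adjacent_tperm_factor (j j' : 'I_n) : j' != j ->
  perm_mx (tperm j j') = diag_mx (\row_k (-1) ^+ (k == j')) *m
    ((1%:M + 1 *: delta_mx j j') *m ((1%:M + (-1) *: delta_mx j' j) *m
      (1%:M + 1 *: delta_mx j j'))) :> mx.
Proof.
move=> jj'; have jj'F : (j' == j) = false by rewrite (negbTE jj').
have j'jF : (j == j') = false by rewrite eq_sym.
have -> : (1%:M + 1 *: delta_mx j j') *m ((1%:M + (-1) *: delta_mx j' j) *m
      (1%:M + 1 *: delta_mx j j')) =
    1%:M - delta_mx j j - delta_mx j' j' + delta_mx j j' - delta_mx j' j :> mx.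
  rewrite !scale1r scaleN1r !(mulmxDl, mulmxDr, mulmx1, mul1mx, mulmxN, mulNmx).
  rewrite !mul_delta_mx mul_delta_mx_0// addr0.
  by apply/matrixP => a b; rewrite !mxE; ring.
rewrite mul_diag_mx; apply/matrixP => a b; rewrite !mxE.
case: tpermP => [->|->|/eqP/negbTE aj /eqP/negbTE aj']; last first.
- by rewrite aj aj' /=; ring.
- rewrite eqxx jj'F /= expr1 [j' == b]eq_sym [j == b]eq_sym; ring.
- rewrite eqxx j'jF /= expr0 [j' == b]eq_sym [j == b]eq_sym; ring.
Qed.

Lemma preserves_adjacent (j j' : 'I_n) : j' = j.+1 :> nat ->
  preserves (perm_mx (tperm j j') : mx).
Proof.
move=> jj'; have jj : (j < j')%N by rewrite jj'.
rewrite adjacent_tperm_factor; last by rewrite -val_eqE /= gtn_eqF.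
apply: preservesM.
  apply: preserves_upper => [|k]; last by rewrite !mxE eqxx mulr1n signr_eq0.
  by rewrite tr_diag_mx diag_mx_is_trig.
apply: preservesM; first exact: preserves_upper_transvection.
by apply: preservesM; [exact: preserves_lower|exact: preserves_upper_transvection].
Qed.

Lemma preserves_tperm (i j : 'I_n) : (i < j)%N -> preserves (perm_mx (tperm i j) : mx).
Proof.
case: j => j jn /= ij; rewrite -(subnKC ij) in jn *.
elim: (j - i.+1)%N jn => [|k IH] jn; first by apply: preserves_adjacent; rewrite /= addn0.
have kn : (i.+1 + k < n)%N by apply: leq_trans jn; rewrite addnS.
pose a := Ordinal kn; pose b := Ordinal jn.
have ab : b = a.+1 :> nat by rewrite /= addnS.
have ia : i != a by rewrite -val_eqE /= ltn_eqF// leq_addr.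
have ib : i != b by rewrite -val_eqE /= ltn_eqF// leq_addr.
have -> : tperm i b = (tperm a b * (tperm i a * tperm a b))%g.
  rewrite -[X in (X * _)%g]tpermV -[RHS]/(conjg (tperm i a) (tperm a b)) tpermJ.
  by rewrite tpermL tpermD// eq_sym.
rewrite !perm_mxM; apply: preservesM; first exact: preserves_adjacent.
by apply: preservesM; [exact: IH|exact: preserves_adjacent].
Qed.

Lemma preserves1 : preserves (1%:M : mx).
Proof.
split; first exact: unitmx1.
by move=> K _; apply: eq_integral => x _; rewrite mulmx1.
Qed.

Lemma preserves_perm (s : 'S_n) : preserves (perm_mx s : mx).
Proof.
have [ts -> dts] := prod_tpermP s; elim: ts dts => [|[i j] ts IH] /=.
  by rewrite big_nil perm_mx1 => _; exact: preserves1.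
move=> /andP[ij dts]; rewrite big_cons perm_mxM; apply: preservesM; last exact: IH.
move: ij; rewrite /dpair /= neq_ltn => /orP[ij|ji]; first exact: preserves_tperm.
by rewrite tpermC; exact: preserves_tperm.
Qed.

End Perms.

(** By the LUP decomposition, GL is generated by permutations, which are products of
    simple transpositions, and upper triangular matrices; the lower triangular
    factor is conjugated into an upper triangular one by the longest permutation. *)
Lemma preserves_unitmx n (g : 'M[C]_n) : g \in unitmx -> preserves g.
Proof.
case: n g => [|n] g gU.
  by have -> : g = 1%:M; [apply/matrixP => -[]|exact: preserves1].
have := cormen_lup_correct g; have := cormen_lup_perm g.
have := cormen_lup_lower g; have := cormen_lup_upper g.
case: (cormen_lup g) => [[P L] U] /= Uup Llow /is_perm_mxP[s PE] PLU.
have PU : P \in unitmx by rewrite PE unitmx_perm.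
have gE : g = perm_mx s^-1 *m (L *m U).
  rewrite -[L *m U]/(L * U) -PLU -[P * g]/(P *m g) PE mulmxA -perm_mxM mulVg.
  by rewrite perm_mx1 mul1mx.
have LUU : L *m U \in unitmx by move: gU; rewrite gE unitmx_mul => /andP[].
have UU : U \in unitmx by move: LUU; rewrite unitmx_mul => /andP[].
rewrite gE; apply: preservesM; first exact: preserves_perm.
apply: preservesM; last first.
  have UT : is_trig_mx U^T by apply/is_trig_mxP => k l kl; rewrite mxE Uup.
  apply: preserves_upper => // k.
  by have := @Bminus_diag_neq0 _ _ U^T k; rewrite mxE; apply; split; rewrite ?unitmx_tr.
pose w : 'S_n.+1 := perm (@rev_ord_inj n.+1).
have ww : (w * w)%g = 1%g by apply/permP => i; rewrite permM !permE /= rev_ordK.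
pose U' := perm_mx w *m L *m perm_mx w.
have -> : L = perm_mx w *m U' *m perm_mx w.
  by rewrite /U' !mulmxA -perm_mxM ww perm_mx1 mul1mx -mulmxA -perm_mxM ww perm_mx1 mulmx1.
have U'E k l : U' k l = L (rev_ord k) (rev_ord l).
  have wV : (w^-1)%g = w by apply/eqP; rewrite eq_mulVg1 invgK ww.
  by rewrite /U' -row_permE -[X in _ *m perm_mx X]wV -col_permE !mxE !permE.
apply: preservesM; last exact: preserves_perm.
apply: preservesM; first exact: preserves_perm.
apply: preserves_upper => [|k]; last by rewrite U'E Llow// eqxx oner_eq0.
apply/is_trig_mxP => k l kl; rewrite mxE U'E Llow /=.
  by rewrite -val_eqE /= eqn_sub2lE ?gtn_eqF// ?ltnS.
by rewrite leq_sub2l// ltnS ltnW.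
Qed.

End Generation.

(** * Gram determinants *)

Section Gram.
Context (R : realType).
Local Notation C := R[i].

Definition hc m n (A : 'M[C]_(m, n)) : 'M[C]_(n, m) := (map_mx (@conjc R) A)^T.

Lemma hcE m n (A : 'M[C]_(m, n)) i j : hc A i j = (A j i)^*.
Proof. by rewrite !mxE. Qed.

Lemma hcM m n p (A : 'M[C]_(m, n)) (B : 'M[C]_(n, p)) : hc (A *m B) = hc B *m hc A.
Proof. by rewrite /hc map_mxM trmx_mul. Qed.

Lemma hcK m n (A : 'M[C]_(m, n)) : hc (hc A) = A.
Proof. by apply/matrixP => i j; rewrite !hcE conjcK. Qed.

Lemma det_hc n (A : 'M[C]_n) : \det (hc A) = (\det A)^*.
Proof. by rewrite det_tr det_map_mx. Qed.

Lemma Re_real_mul (x : R) (z : C) : complex.Re (x%:C * z) = x * complex.Re z.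
Proof. by case: z => a b /=; rewrite mul0r subr0. Qed.

Lemma conj_fixed_real (z : C) : z^* = z -> (complex.Re z)%:C = z.
Proof.
case: z => a b /eqP; rewrite eq_complex /= => /andP[_ /eqP b0].
by congr (_ +i* _); lra.
Qed.

Lemma row_col_norm n (v : 'cV[C]_n) :
  (hc v *m v) 0 0 = (\sum_i nrm2 (v i 0))%:C.
Proof.
rewrite mxE rmorph_sum; apply: eq_bigr => i _ /=.
by rewrite hcE mulrC nrm2E.
Qed.

Lemma nrm2_lin (x : R) (s a b : C) : (nrm2 (x%:C * b - s * a))%:C =
  x%:C * x%:C * (b * b^*) - x%:C * s^* * (a^* * b) - x%:C * s * (a * b^*)
  + s * s^* * (a * a^*).
Proof.
case: s a b => s1 s2 [a1 a2] [b1 b2]; apply/eqP; rewrite eq_complex /nrm2 /=.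
by apply/andP; split; apply/eqP; ring.
Qed.

(** Expand the nonnegative sum of the [|x b_i - s a_i|^2]. *)
Lemma cauchy_schwarz n (a b : 'cV[C]_n) :
  nrm2 ((hc a *m b) 0 0) <= (\sum_i nrm2 (a i 0)) * (\sum_i nrm2 (b i 0)).
Proof.
set s := (hc a *m b) 0 0; set x := \sum_i nrm2 (a i 0); set y := \sum_i nrm2 (b i 0).
have x0 : 0 <= x by apply: sumr_ge0 => i _; exact: nrm2_ge0.
have [xE|xN] := eqVneq x 0.
  suff -> : s = 0 by rewrite xE mul0r /nrm2 /= expr0n addr0.
  rewrite /s mxE big1// => i _; rewrite hcE.
  have a0 := psumr_eq0P (fun j _ => nrm2_ge0 (a j 0)) xE.
  have /eqP := a0 i isT.
  by rewrite nrm2_eq0 => /eqP ->; rewrite rmorph0 mul0r.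
have H : 0 <= \sum_i nrm2 (x%:C * b i 0 - s * a i 0).
  by apply: sumr_ge0 => i _; exact: nrm2_ge0.
suff E : \sum_i nrm2 (x%:C * b i 0 - s * a i 0) = x * (x * y - nrm2 s).
  by move: H; rewrite E pmulr_rge0 ?subr_ge0// lt_def xN.
apply: complexI; rewrite rmorph_sum /= !rmorphM rmorphB rmorphM /=.
have sE : s = \sum_i (a i 0)^* * b i 0.
  by rewrite /s mxE; apply: eq_bigr => i _; rewrite hcE.
have sE' : s^* = \sum_i a i 0 * (b i 0)^*.
  by rewrite sE rmorph_sum; apply: eq_bigr => i _; rewrite rmorphM /= conjcK.
have xE : x%:C = \sum_i a i 0 * (a i 0)^*.
  by rewrite /x rmorph_sum; apply: eq_bigr => i _; rewrite /= nrm2E.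
have yE : y%:C = \sum_i b i 0 * (b i 0)^*.
  by rewrite /y rmorph_sum; apply: eq_bigr => i _; rewrite /= nrm2E.
have -> : \sum_i (nrm2 (x%:C * b i 0 - s * a i 0))%:C =
    x%:C * x%:C * (\sum_i b i 0 * (b i 0)^*) - x%:C * s^* * (\sum_i (a i 0)^* * b i 0)
    - x%:C * s * (\sum_i a i 0 * (b i 0)^*) + s * s^* * (\sum_i a i 0 * (a i 0)^*).
  rewrite !mulr_sumr -!sumrB -big_split /=; apply: eq_bigr => i _.
  exact: nrm2_lin.
rewrite -sE -sE' -xE -yE nrm2E; ring.
Qed.

(** The two ways to eliminate in the block matrix with rows [M v] and [-w 1]. *)
Lemma det_rank1_update n (M : 'M[C]_n) (v : 'cV[C]_n) (w : 'rV[C]_n) : M \in unitmx ->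
  \det (M + v *m w) = \det M * (1 + (w *m invmx M *m v) 0 0).
Proof.
move=> MU.
have E1 : block_mx M v (- w) 1%:M =
    block_mx 1%:M v 0 1%:M *m block_mx (M + v *m w) 0 (- w) (1%:M : 'M[C]_1).
  by rewrite mulmx_block !mul1mx !mul0mx !mulmx1 !add0r mulmxN addrK.
have E2 : block_mx M v (- w) 1%:M =
    block_mx M 0 (- w) (1%:M : 'M[C]_1) *m
    block_mx 1%:M (invmx M *m v) 0 (1%:M + w *m invmx M *m v).
  rewrite mulmx_block !mulmx1 !mulmx0 !mul0mx !mul1mx !addr0 mulKVmx//.
  by rewrite mulNmx mulmxA addrC addrK.
have := congr1 determinant E1; rewrite E2 !det_mulmx !det_ublock !det_lblock.
rewrite !det1 !mulr1 !mul1r => <-; congr (_ * _).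
by rewrite det_mx11 !mxE eqxx.
Qed.

Definition gram m n (A : 'M[C]_(m, n)) : R := complex.Re (\det (A *m hc A)).

Lemma gramE m n (A : 'M[C]_(m, n)) : (gram A)%:C = \det (A *m hc A).
Proof. by apply: conj_fixed_real; rewrite -det_hc hcM hcK. Qed.

Lemma gram_mull m n (T : 'M[C]_m) (A : 'M[C]_(m, n)) :
  gram (T *m A) = nrm2 (\det T) * gram A.
Proof.
apply: complexI; rewrite rmorphM /= !gramE hcM mulmxA -[T *m A *m _]mulmxA.
by rewrite !det_mulmx det_hc nrm2E mulrAC.
Qed.

Lemma gram_mulr m n (A : 'M[C]_(m, n)) (u : 'M[C]_n) : u *m hc u = 1%:M ->
  gram (A *m u) = gram A.
Proof.
by move=> uu; rewrite /gram hcM mulmxA -[A *m u *m _]mulmxA uu mulmx1.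
Qed.

Lemma gram_square n (A : 'M[C]_n) : gram A = nrm2 (\det A).
Proof. by apply: complexI; rewrite gramE det_mulmx det_hc nrm2E. Qed.

(** For [H = A A^*], the matrix determinant lemma gives
    [det (H + v v^* ) = det H * (1 + |x|^2)] with [x = A^* H^-1 v]. The inner
    product of [x] with [y = A^* H^-1 e_i] is the [i]-th entry of [adj H v] divided by
    [det H], so the bound is the Cauchy-Schwarz inequality for [x] and [y]. *)
Lemma gram_update_ge m n (A : 'M[C]_(m, n)) (v : 'cV[C]_m) (i : 'I_m)
    (H := A *m hc A) (s := complex.Re (\adj H i i)) :
  0 < gram A -> 0 < s -> (\adj H i i)^* = \adj H i i ->
  gram A * (1 + nrm2 ((\adj H *m v) i 0) / (gram A * s)) <=
    complex.Re (\det (H + v *m hc v)).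
Proof.
move=> g0 s0 sreal; have sE := conj_fixed_real sreal.
have dH : \det H = (gram A)%:C by rewrite gramE.
have dH0 : \det H != 0 by rewrite dH -[0]/(0%:C) (inj_eq (@complexI _)) gt_eqF.
have HU : H \in unitmx by rewrite unitmxE unitfE.
have invH : invmx H = (gram A)^-1%:C *: \adj H.
  by rewrite /invmx HU dH fmorphV.
rewrite det_rank1_update// dH Re_real_mul ler_pM2l//.
have HH : hc H = H by rewrite /H hcM hcK.
have hinv : hc (invmx H) = invmx H.
  have e : hc (invmx H) *m H = 1%:M.
    rewrite -{2}HH -hcM mulmxV//; apply/matrixP => a b; rewrite hcE !mxE.
    by rewrite conjc_nat eq_sym.
  by rewrite -[LHS]mulmx1 -(mulmxV HU) mulmxA e mul1mx.
pose x := hc A *m invmx H *m v.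
pose y : 'cV[C]_n := hc A *m invmx H *m delta_mx i 0.
have quad (a b : 'cV[C]_m) : hc (hc A *m invmx H *m a) *m (hc A *m invmx H *m b) =
    hc a *m invmx H *m b.
  rewrite !hcM hcK hinv -!mulmxA; congr (_ *m _).
  by rewrite !mulmxA -[_ *m A *m hc A]mulmxA mulVmx// mul1mx.
have hd : hc (delta_mx i 0 : 'cV[C]_m) = delta_mx 0 i.
  by apply/matrixP => a b; rewrite hcE !mxE conjc_nat andbC.
have qE : (hc v *m invmx H *m v) 0 0 = (\sum_j nrm2 (x j 0))%:C.
  by rewrite -quad row_col_norm.
have yE : (s / gram A) = \sum_j nrm2 (y j 0).
  apply: complexI; rewrite -row_col_norm quad hd -rowE -colE !mxE invH !mxE.
  have -> : cofactor H i i = s%:C by rewrite /s sE mxE.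
  by rewrite -rmorphM mulrC.
have yx : (hc y *m x) 0 0 = (gram A)^-1%:C * (\adj H *m v) i 0.
  by rewrite quad hd -mulmxA -rowE invH mxE -scalemxAl mxE.
have := cauchy_schwarz y x; rewrite yx -yE nrm2M nrm2_real => CS.
rewrite raddfD /= qE /= lerD2l.
rewrite -(ler_pM2l (divr_gt0 s0 g0)); apply: le_trans CS.
rewrite le_eqVlt; apply/orP; left; apply/eqP.
by field; rewrite !gt_eqF.
Qed.

End Gram.

Section Corner.
Context (K : comNzRingType).

Lemma cornerE m n a b (X : 'M[K]_(m, n)) (i : 'I_a) (j : 'I_b) (i' : 'I_m) (j' : 'I_n) :
  i' = i :> nat -> j' = j :> nat -> corner a b X i j = X i' j'.
Proof.
move=> ii' jj'; rewrite mxE -ii' -jj'.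
by rewrite !insubT//= => im jn; congr (X _ _); exact: val_inj.
Qed.

Lemma eq_corner m n a b (X Y : 'M[K]_(m, n)) :
  (forall (i : 'I_m) (j : 'I_n), (i < a)%N -> (j < b)%N -> X i j = Y i j) ->
  corner a b X = corner a b Y.
Proof.
move=> XY; apply/matrixP => i j; rewrite !mxE.
case: insubP => // i' _ ii'; case: insubP => // j' _ jj'.
by apply: XY; rewrite ?ii' ?jj'.
Qed.

Lemma corner_mulr m n a (X : 'M[K]_(m, n)) (Y : 'M[K]_n) : (a <= m)%N ->
  corner a n (X *m Y) = corner a n X *m Y.
Proof.
move=> am; apply/matrixP => i j; rewrite (cornerE _ (i' := widen_ord am i) (j' := j))//.
rewrite !mxE; apply: eq_bigr => k _.
by rewrite (cornerE _ (i' := widen_ord am i) (j' := k)).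
Qed.

Lemma corner_mull m n a c (b : 'M[K]_m) (X : 'M[K]_(m, n)) : is_trig_mx b ->
  (a <= m)%N -> (c <= n)%N ->
  corner a c (b *m X) = corner a a b *m corner a c X.
Proof.
move=> /is_trig_mxP bt am cn; apply/matrixP => i j.
rewrite (cornerE _ (i' := widen_ord am i) (j' := widen_ord cn j))// !mxE.
pose F (k : nat) : K := if (insub k : option 'I_m) is Some k' then
  b (widen_ord am i) k' * X k' (widen_ord cn j) else 0.
transitivity (\sum_(k < m) F k).
  by apply: eq_bigr => k _; rewrite /F valK.
transitivity (\sum_(k < a) F k); last first.
  apply: eq_bigr => k _; rewrite /F insubT ?(leq_trans (ltn_ord k) am)//= => km.
  rewrite (cornerE _ (i' := widen_ord am i) (j' := widen_ord am k))//.
  rewrite (cornerE _ (i' := widen_ord am k) (j' := widen_ord cn j))//.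
  by congr (b _ _ * X _ _); exact: val_inj.
rewrite (big_ord_widen _ F am) [LHS](bigID (fun k : 'I_m => (k < a)%N)) /=.
rewrite [X in _ + X]big1 ?addr0// => k; rewrite -leqNgt => ak.
by rewrite /F valK bt ?mul0r//=; exact: leq_trans ak.
Qed.

Lemma det_corner_trig n a (b : 'M[K]_n) : is_trig_mx b -> (a <= n)%N ->
  \det (corner a a b) = \prod_(i < n | (i < a)%N) b i i.
Proof.
move=> /is_trig_mxP bt an; rewrite det_trig; last first.
  apply/is_trig_mxP => i j ij.
  by rewrite (cornerE _ (i' := widen_ord an i) (j' := widen_ord an j))// bt.
pose F (k : nat) : K := if (insub k : option 'I_n) is Some k' then b k' k' else 1.
transitivity (\prod_(k < a) F k).
  apply: eq_bigr => k _; rewrite /F insubT ?(leq_trans (ltn_ord k) an)//= => kn.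
  rewrite (cornerE _ (i' := widen_ord an k) (j' := widen_ord an k))//.
  by congr (b _ _); exact: val_inj.
by rewrite (big_ord_widen _ F an); apply: eq_bigr => k _; rewrite /F valK.
Qed.

End Corner.

Section GramCorners.
Context (R : realType) (n : nat).
Local Notation C := R[i].
Local Notation mx := 'M[C]_n.

(** For [l = n] these are the determinants in the density of [mu_p]; smaller [l] serve
    for the induction on the number of columns. *)
Definition gramc (j l : nat) (Z : mx) : R := gram (corner j l Z).

Lemma gramc0 l Z : gramc 0 l Z = 1.
Proof. by rewrite /gramc /gram det_mx00. Qed.

Lemma eq_gramc j l (Z Z' : mx) :
  (forall a b : 'I_n, (a < j)%N -> (b < l)%N -> Z a b = Z' a b) ->
  gramc j l Z = gramc j l Z'.
Proof. by move=> /eq_corner ZZ'; rewrite /gramc ZZ'. Qed.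

Lemma gramc_diag j (Z : mx) : is_unipotent Z -> (j <= n)%N -> gramc j j Z = 1.
Proof.
move=> /is_unipotentP ZU jn; rewrite /gramc gram_square.
have -> : \det (corner j j Z) = 1; last exact: nrm2_1.
rewrite -det_tr.
have -> : (corner j j Z)^T = corner j j Z^T.
  apply/matrixP => a b; rewrite mxE.
  rewrite (cornerE _ (i' := widen_ord jn b) (j' := widen_ord jn a))//.
  by rewrite (cornerE _ (i' := widen_ord jn a) (j' := widen_ord jn b))// mxE.
rewrite det_corner_trig//; last first.
  by apply/is_trig_mxP => a b ab; rewrite mxE (ZU _ _ (ltnW ab)) [b == a]gtn_eqF.
by rewrite big1// => a _; rewrite mxE ZU// eqxx.
Qed.

Definition gram_col (j : nat) (l : 'I_n) (Z : mx) : 'cV[C]_j :=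
  corner j 1 (col l Z).

Lemma gram_colE j (l : 'I_n) (Z : mx) (a : 'I_j) (a' : 'I_n) : a' = a :> nat ->
  gram_col j l Z a 0 = Z a' l.
Proof. by move=> aa'; rewrite /gram_col (cornerE _ (i' := a') (j' := 0))// mxE. Qed.

Lemma gram_mx_step (j : nat) (l : 'I_n) (Z : mx) : (j <= n)%N ->
  corner j l.+1 Z *m hc (corner j l.+1 Z) =
  corner j l Z *m hc (corner j l Z) + gram_col j l Z *m hc (gram_col j l Z).
Proof.
move=> jn; have ln := ltn_ord l; apply/matrixP => a b.
rewrite [in RHS]mxE !mxE big_ord_recr /= big_ord1; congr (_ + _).
  apply: eq_bigr => k _; rewrite !hcE.
  pose k' := widen_ord (ltnW ln) k.
  rewrite !(cornerE Z (i := a) (i' := widen_ord jn a) (j' := k'))//.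
  by rewrite !(cornerE Z (i := b) (i' := widen_ord jn b) (j' := k')).
rewrite !hcE (gram_colE _ _ (a' := widen_ord jn a))//.
rewrite (gram_colE _ _ (a' := widen_ord jn b))//.
rewrite !(cornerE Z (i := a) (i' := widen_ord jn a) (j' := l))//.
by rewrite !(cornerE Z (i := b) (i' := widen_ord jn b) (j' := l)).
Qed.

Lemma adj_gram_last (k l : nat) (Z : mx) : (k < n)%N -> (l <= n)%N ->
  (\adj (corner k.+1 l Z *m hc (corner k.+1 l Z))) ord_max ord_max =
  \det (corner k l Z *m hc (corner k l Z)).
Proof.
move=> kn ln; rewrite mxE /cofactor addnn -signr_odd odd_double expr0 mul1r.
congr (\det _); apply/matrixP => a b; rewrite !mxE; apply: eq_bigr => c _.
rewrite !hcE; have kn' := ltnW kn.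
have liftE (e : 'I_k) : corner k.+1 l Z (lift ord_max e) c = corner k l Z e c.
  rewrite (cornerE Z (i' := widen_ord kn' e) (j' := widen_ord ln c))//=.
    by rewrite (cornerE Z (i' := widen_ord kn' e) (j' := widen_ord ln c)).
  by rewrite /bump leqNgt ltn_ord.
by rewrite !liftE.
Qed.

(** Up to normalization, a Gram-Schmidt coordinate of the entry [Z k l] relative to
    the first [l] columns of the rows of index at most [k]. *)
Definition schmidt_num (k l : 'I_n) (Z : mx) : C :=
  (\adj (corner k.+1 l Z *m hc (corner k.+1 l Z)) *m gram_col k.+1 l Z) ord_max 0.

(** Passing from [l] to [l + 1] columns adds the rank one matrix [v v^*], for [v] the
    new column, to the Gram matrix. *)
Lemma gramc_step (k l : 'I_n) (Z : mx) :
  0 < gramc k.+1 l Z -> 0 < gramc k l Z ->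
  gramc k.+1 l Z * (1 + nrm2 (schmidt_num k l Z) / (gramc k.+1 l Z * gramc k l Z)) <=
    gramc k.+1 l.+1 Z.
Proof.
move=> g1 g0; have ln := ltnW (ltn_ord l).
have adjE := @adj_gram_last k l Z (ltn_ord k) ln.
have := @gram_update_ge R _ _ (corner k.+1 l Z) (gram_col k.+1 l Z) ord_max g1.
rewrite adjE -gramE -gram_mx_step//= => H.
by apply: H => //; rewrite oppr0.
Qed.

Lemma gramc_step' (k l : 'I_n) (Z : mx) :
  0 < gramc k.+1 l Z -> 0 < gramc k l Z -> gramc k.+1 l Z <= gramc k.+1 l.+1 Z.
Proof.
move=> g1 g0; apply: le_trans (gramc_step g1 g0).
apply: ler_peMr; first exact: ltW.
by rewrite lerDl divr_ge0 ?nrm2_ge0// mulr_ge0// ltW.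
Qed.

Lemma gramc_ge1 j l (Z : mx) : is_unipotent Z -> (j <= l)%N -> (l <= n)%N ->
  1 <= gramc j l Z.
Proof.
move=> ZU; elim: l j => [|l IH] j.
  by rewrite leqn0 => /eqP -> _; rewrite gramc0.
move=> jl ln; have [->|jl'] := eqVneq j l.+1; first by rewrite gramc_diag.
have {}jl : (j <= l)%N by rewrite -ltnS ltn_neqAle jl'.
case: j {jl'} jl => [|k] kl; first by rewrite gramc0.
have g1 := IH _ kl (ltnW ln); have g0 := IH _ (ltnW kl) (ltnW ln).
have kn : (k < n)%N by rewrite (ltn_trans kl).
apply: le_trans g1 _; apply: (@gramc_step' (Ordinal kn) (Ordinal ln)) => /=.
  by apply: lt_le_trans (IH _ kl (ltnW ln)).
exact: lt_le_trans g0.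
Qed.

End GramCorners.

(** * Stacked matrices and regular functions *)

Section Stack.
Context (K : comNzRingType).

(** Row operations within each of the two blocks. *)
Lemma stackM n a b (X : 'M[K]_a) (Y : 'M[K]_b) (A : 'M[K]_(a, n)) (B : 'M[K]_(b, n)) :
  (a + b)%N = n -> \det (stack (X *m A) (Y *m B)) = \det X * \det Y * \det (stack A B).
Proof.
move=> e; case: n / e A B => A B; rewrite /stack !conform_mx_id.
have -> : col_mx (X *m A) (Y *m B) = block_mx X 0 0 Y *m col_mx A B.
  by rewrite mul_block_col !mul0mx addr0 add0r.
by rewrite det_mulmx det_ublock.
Qed.

Lemma stack_mulr n a b (A : 'M[K]_(a, n)) (B : 'M[K]_(b, n)) (M : 'M[K]_n) :
  (a + b)%N = n -> stack (A *m M) (B *m M) = stack A B *m M.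
Proof.
move=> e; case: n / e A B M => A B M; rewrite /stack !conform_mx_id.
exact: esym (mul_col_mx _ _ _).
Qed.

Lemma stack_top n a b (A : 'M[K]_(a, n)) (B : 'M[K]_(b, n)) (i : 'I_a) (i' : 'I_n) j :
  (a + b)%N = n -> i = i' :> nat -> stack A B i' j = A i j.
Proof.
move=> e; case: n / e A B i' j => A B i' j ii'; rewrite /stack conform_mx_id.
have -> : i' = lshift b i by exact: val_inj.
by rewrite col_mxEu.
Qed.

Lemma stack_bottom n a b (A : 'M[K]_(a, n)) (B : 'M[K]_(b, n)) (i : 'I_b) (i' : 'I_n) j :
  (a + b)%N = n -> (a + i)%N = i' :> nat -> stack A B i' j = B i j.
Proof.
move=> e; case: n / e A B i' j => A B i' j ii'; rewrite /stack conform_mx_id.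
have -> : i' = rshift a i by exact: val_inj.
by rewrite col_mxEd.
Qed.

Lemma stack_closed (T : Type) (Q : (T -> K) -> Prop) n a b
    (A : T -> 'M[K]_(a, n)) (B : T -> 'M[K]_(b, n)) : (a + b)%N = n ->
  (forall i j, Q (fun t => A t i j)) -> (forall i j, Q (fun t => B t i j)) ->
  forall i j, Q (fun t => stack (A t) (B t) i j).
Proof.
move=> e QA QB i j; have [ia|ai] := ltnP i a.
  rewrite (_ : (fun t => _) = (fun t => A t (Ordinal ia) j)); first exact: QA.
  by apply/funext => t; exact: stack_top.
have ib : (i - a < b)%N by rewrite ltn_subLR// e.
rewrite (_ : (fun t => _) = (fun t => B t (Ordinal ib) j)); first exact: QB.
by apply/funext => t; apply: stack_bottom => //=; rewrite subnKC.
Qed.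

Lemma corner_closed (T : Type) (Q : (T -> K) -> Prop) m n a b (M : T -> 'M[K]_(m, n)) :
  Q (fun=> 0) -> (forall i j, Q (fun t => M t i j)) ->
  forall i j, Q (fun t => corner a b (M t) i j).
Proof.
move=> Q0 QM i j; rewrite (_ : (fun t => _) = fun t =>
    if (insub (i : nat), insub (j : nat)) is (Some i', Some j') then M t i' j' else 0).
  by case: insubP => [i' _ _|_] //; case: insubP => [j' _ _|_].
by apply/funext => t; rewrite mxE.
Qed.

End Stack.

Section Regular.
Context (K : fieldType) (n : nat).
Local Notation mx := 'M[K]_n.
Implicit Types f : mx -> K.

Lemma eq_regular f f' : regular_on_GL f -> (forall g, g \in unitmx -> f' g = f g) ->
  regular_on_GL f'.
Proof. by move=> [P fP] e; exists P => g gU; rewrite e// fP. Qed.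

Lemma regular_cst c : regular_on_GL (fun _ : mx => c).
Proof. by exists (mpoly.mpolyC _ c) => g _; rewrite mpoly.mevalC. Qed.

Lemma regular_entry i j : regular_on_GL (fun g : mx => g i j).
Proof.
exists (mpoly.mpolyX K (mpoly.mnm1 (lshift 1 (mxvec_index i j)))) => g _.
by rewrite mpoly.mevalXU row_mxEl mxvecE.
Qed.

Lemma regular_detV : regular_on_GL (fun g : mx => (\det g)^-1).
Proof.
exists (mpoly.mpolyX K (mpoly.mnm1 (rshift (n * n) (@ord0 0)))) => g _.
by rewrite mpoly.mevalXU row_mxEr mxE eqxx mulr1n.
Qed.

Lemma regularD f f' : regular_on_GL f -> regular_on_GL f' ->
  regular_on_GL (fun g => f g + f' g).
Proof.
by move=> [P fP] [P' fP']; exists (P + P') => g gU; rewrite fP// fP'// mpoly.mevalD.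
Qed.

Lemma regularM f f' : regular_on_GL f -> regular_on_GL f' ->
  regular_on_GL (fun g => f g * f' g).
Proof.
by move=> [P fP] [P' fP']; exists (P * P') => g gU; rewrite fP// fP'// mpoly.mevalM.
Qed.

Lemma regular_ring : ring_closed (@regular_on_GL K n).
Proof. by split; [exact: regular_cst|exact: regularD|exact: regularM]. Qed.

Lemma regularX f m : regular_on_GL f -> regular_on_GL (fun g => f g ^+ m).
Proof. exact: (closedX regular_ring). Qed.

Lemma regular_det m (M : mx -> 'M[K]_m) : (forall i j, regular_on_GL (fun g => M g i j)) ->
  regular_on_GL (fun g => \det (M g)).
Proof. exact: (closed_det regular_ring). Qed.

Lemma regular_detXz (e : int) : regular_on_GL (fun g : mx => \det g ^ e).
Proof.
case: e => m; last by apply: eq_regular (regularX m.+1 regular_detV) _ => g _; rewrite exprVn.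
by apply: regularX; apply: regular_det => i j; exact: regular_entry.
Qed.

End Regular.

(** * Finite volume *)

(** The integral of a product of functions of one coordinate each is the product of
    their integrals. *)
Lemma power_measure_prod_lty d (T : measurableType d) (R : realType)
    (mu : {sigma_finite_measure set T -> \bar R}) (phi : T -> R) m :
  measurable_fun setT phi -> (forall z, 0 <= phi z) ->
  (\int[mu]_z (phi z)%:E < +oo)%E ->
  (\int[power_measure mu m]_t (\prod_(i < m) phi (tnth t i))%:E < +oo)%E.
Proof.
move=> mphi phi0 phioo; have mP k : measurable_fun setT
    (fun t : k.-tuple T => \prod_(i < k) phi (tnth t i)).
  by apply: measurable_bigprod => i _; exact: measurableT_comp (measurable_tnth _).
have P0 k (t : k.-tuple T) : 0 <= \prod_(i < k) phi (tnth t i).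
  by apply: prodr_ge0 => i _.
elim: m => [|m IH].
  under eq_integral do rewrite big_ord0.
  rewrite integral_cst// mul1e [X in (X < _)%E](_ : _ = 1%E) ?ltry//.
  exact: diracT.
rewrite power_measure_tonelli1; last 2 first.
- by apply/measurable_EFinP; exact: mP.
- by move=> t; rewrite lee_fin.
rewrite (eq_integral (fun x => (phi x)%:E *
  \int[power_measure mu m]_t (\prod_(i < m) phi (tnth t i))%:E)%E); last first.
  move=> x _; rewrite -ge0_integralZl//; last 3 first.
  - by apply/measurable_EFinP; exact: mP.
  - by move=> t _; rewrite lee_fin.
  - by rewrite lee_fin.
  apply: eq_integral => t _; rewrite -EFinM big_ord_recl tnth0; congr (_ * _)%:E.
  by apply: eq_bigr => i _; rewrite tnthS.
have I0 : (0 <= \int[power_measure mu m]_t (\prod_(i < m) phi (tnth t i))%:E)%E.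
  by apply: integral_ge0 => t _; rewrite lee_fin.
rewrite ge0_integralZr//; last 2 first.
- exact/measurable_EFinP.
- by move=> x _; rewrite lee_fin.
have I1 : (0 <= \int[mu]_x (phi x)%:E)%E by apply: integral_ge0 => x _; rewrite lee_fin.
by rewrite lte_mul_pinfty// ge0_fin_numE.
Qed.

Section Volume.
Context (R : realType) (n : nat).
Local Notation C := R[i].
Local Notation mx := 'M[C]_n.

Let gram_pair (k l : 'I_n) (Z : mx) := gramc k.+1 l Z * gramc k l Z.

(** The normalization makes the squared modulus the increment in the estimate of
    the Gram determinants; the Jacobian of these coordinates telescopes to 1. *)
Definition schmidt_coord (k l : 'I_n) (Z : mx) : C :=
  schmidt_num k l Z * ((Num.sqrt (gram_pair k l Z))^-1)%:C.

Lemma cmeas_corner d (T : measurableType d) (M : T -> mx) a b :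
  (forall k l, cmeas (fun x => M x k l)) ->
  forall k l, cmeas (fun x => corner a b (M x) k l).
Proof.
move=> mM; apply: (@corner_closed C T (@cmeas R d T) n n a b M _ mM).
exact: cmeas_cst.
Qed.

Lemma cmeas_gram_mx d (T : measurableType d) (M : T -> mx) a b :
  (forall k l, cmeas (fun x => M x k l)) ->
  forall k l, cmeas (fun x => (corner a b (M x) *m hc (corner a b (M x))) k l).
Proof.
move=> mM; apply: cmeas_mulmx; first exact: cmeas_corner.
move=> k l; under eq_fun do rewrite hcE.
by apply: cmeas_conj; exact: cmeas_corner.
Qed.

Lemma measurable_gramc d (T : measurableType d) (M : T -> mx) a b :
  (forall k l, cmeas (fun x => M x k l)) ->
  measurable_fun setT (fun x => gramc a b (M x)).
Proof.
move=> mM; have mG := @cmeas_gram_mx _ _ M a b mM.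
by have [] := @cmeas_det R d T a (fun x => corner a b (M x) *m hc (corner a b (M x))) mG.
Qed.

Lemma cmeas_schmidt_coord d (T : measurableType d) (M : T -> mx) k l :
  (forall k l, cmeas (fun x => M x k l)) ->
  cmeas (fun x => schmidt_coord k l (M x)).
Proof.
move=> mM; apply: cmeasM; last first.
  apply: cmeas_real; apply: measurable_funV.
  have -> : (fun x => Num.sqrt (gram_pair k l (M x))) =
      (fun x => powR (Num.max 0 (gram_pair k l (M x))) 2^-1).
    apply/funext => x; rewrite powR12_sqrt ?le_max ?lexx//.
    by case: (leP 0 (gram_pair k l (M x))) => // /ltW/ler0_sqrtr ->; rewrite sqrtr0.
  apply: (measurableT_comp (measurable_powR _)).
  apply: measurable_maxr; first exact: measurable_cst.
  by apply: measurable_funM; exact: measurable_gramc.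
apply: cmeas_mulmx => [a b|a b].
  rewrite (_ : (fun x => _) = (fun x => cofactor
    (corner k.+1 l (M x) *m hc (corner k.+1 l (M x))) b a)).
    apply: cmeasM; first exact: cmeas_cst.
    apply: cmeas_det => c e.
    rewrite (_ : (fun x => _) = fun x =>
      (corner k.+1 l (M x) *m hc (corner k.+1 l (M x))) (lift b c) (lift a e)).
      exact: cmeas_gram_mx.
    by apply/funext => x; rewrite !mxE.
  by apply/funext => x; rewrite mxE.
have kn := ltn_ord k.
rewrite (_ : (fun x => _) = fun x => M x (widen_ord kn a) l); first exact: mM.
by apply/funext => x; rewrite [b]ord1 (gram_colE _ _ (a' := widen_ord kn a)).
Qed.

Let gp (Z : mx) (k l : 'I_n) : is_unipotent Z -> (k < l)%N ->
  0 < gramc k.+1 l Z /\ 0 < gramc k l Z.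
Proof.
move=> ZU kl; have ln := ltnW (ltn_ord l).
by split; apply: lt_le_trans (gramc_ge1 ZU _ ln) => //; exact: ltnW.
Qed.

Lemma nrm2_schmidt_coord (Z : mx) (k l : 'I_n) : is_unipotent Z -> (k < l)%N ->
  nrm2 (schmidt_coord k l Z) =
  nrm2 (schmidt_num k l Z) / (gramc k.+1 l Z * gramc k l Z).
Proof.
move=> ZU kl; have [g1 g0] := gp ZU kl.
by rewrite nrm2M nrm2_real exprVn sqr_sqrtr// mulr_ge0// ltW.
Qed.

Lemma schmidt_num_delta (A : mx) (k l : 'I_n) (z : C) :
  schmidt_num k l (A + z *: delta_mx k l) =
  schmidt_num k l A + (gramc k l A)%:C * z.
Proof.
have kn := ltn_ord k; have ln := ltn_ord l.
have cE : corner k.+1 l (A + z *: delta_mx k l) = corner k.+1 l A.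
  apply: eq_corner => a b _ bl; rewrite add_delta_mxE.
  by rewrite [b == l]ltn_eqF// andbF mulr0 addr0.
have gcolE : gram_col k.+1 l (A + z *: delta_mx k l) =
    gram_col k.+1 l A + z *: delta_mx ord_max 0.
  apply/matrixP => a b; rewrite [b]ord1 add_delta_mxE.
  rewrite !(gram_colE _ _ (a' := widen_ord kn a))// add_delta_mxE !eqxx !andbT.
  by rewrite -val_eqE.
rewrite /schmidt_num cE gcolE mulmxDr mxE; congr (_ + _).
rewrite -scalemxAr mxE -colE mxE mulrC; congr (_ * _).
by rewrite adj_gram_last// ?gramE// ltnW.
Qed.

Let cauchyC (z : C) : R := (1 + nrm2 z)^-1 ^+ 2.

(** Multiply the one-column estimates over all columns: the factors
    [gramc j l] telescope, starting from [gramc l l = 1]. *)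
Lemma prod_schmidt_coord_le (Z : mx) : is_unipotent Z ->
  \prod_(l < n) \prod_(k < n | (k < l)%N) (1 + nrm2 (schmidt_coord k l Z)) <=
  \prod_(1 <= j < n) gramc j n Z.
Proof.
move=> ZU; suff H l : (l <= n)%N ->
    \prod_(l' < n | (l' < l)%N) \prod_(k < n | (k < l')%N)
      (1 + nrm2 (schmidt_coord k l' Z)) <= \prod_(1 <= j < l) gramc j l Z.
  apply: le_trans (H n (leqnn n)).
  by rewrite le_eqVlt; apply/orP; left; apply/eqP/eq_bigl => l; rewrite ltn_ord.
elim: l => [|l IH] ln; first by rewrite big_geq// big_pred0.
pose L := Ordinal ln.
rewrite (bigD1 L)//= mulrC (eq_bigl (fun l' : 'I_n => (l' < l)%N)); last first.
  by move=> l'; rewrite ltnS [RHS]ltn_neqAle andbC -val_eqE.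
rewrite big_add1 /=.
have nat_ord (F : nat -> R) : \prod_(0 <= j < l) F j = \prod_(k < n | (k < l)%N) F k.
  by rewrite big_mkord (big_ord_widen _ F (ltnW ln)).
apply: (@le_trans _ _ ((\prod_(0 <= j < l) gramc j.+1 l Z) *
    \prod_(k < n | (k < l)%N) (1 + nrm2 (schmidt_coord k L Z)))).
  apply: ler_pM => //.
  - by apply: prodr_ge0 => l' _; apply: prodr_ge0 => k _; rewrite addr_ge0// nrm2_ge0.
  - by apply: prodr_ge0 => k _; rewrite addr_ge0// nrm2_ge0.
  apply: le_trans (IH (ltnW ln)) _.
  case: (l) (ltnW ln) => [|l'] ln'; first by rewrite !big_geq.
  rewrite [X in _ <= X]big_nat_recr//= (gramc_diag ZU ln') mulr1.
  by rewrite big_add1.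
rewrite !nat_ord -big_split /=; apply: ler_prod => k kl.
have [g1 g0] := @gp Z k L ZU kl.
apply/andP; split.
  by apply: mulr_ge0; [exact: ltW|rewrite addr_ge0// nrm2_ge0].
by rewrite nrm2_schmidt_coord//; exact: (gramc_step (l := L)).
Qed.

(** The integrand is at most the product over [k < l] of
    [(1 + |w_kl|^2)^-2] in the Gram-Schmidt coordinates [w], which are a
    triangular change of variables of Jacobian 1. *)
Lemma finite_volume :
  (\int[dZ R n]_x ((\prod_(1 <= j < n) gramc j n (coords_mx x))^-1 ^+ 2)%:E < +oo)%E.
Proof.
pose K (Z : mx) : R := \prod_(kl : 'I_n * 'I_n | (kl.1 < kl.2)%N) cauchyC (Z kl.1 kl.2).
have K0 Z : 0 <= K Z by apply: prodr_ge0 => kl _; exact: sqr_ge0.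
pose W (k l : 'I_n) (Z : mx) : R := `|gramc k l Z / gramc k.+1 l Z|.
have mE k l : cmeas (fun x : coords R n => coords_mx x k l) by exact: cmeas_coords.
have mcauchy d (T : measurableType d) (f : T -> C) : cmeas f ->
    measurable_fun setT (fun x => cauchyC (f x)).
  move=> mf; apply: measurable_funX; apply: measurable_funV.
  by apply: measurable_funD; [exact: measurable_cst|exact: measurable_nrm2].
have mN k l : cmeas (fun x : coords R n => schmidt_coord k l (coords_mx x)).
  exact: cmeas_schmidt_coord.
have mK (M : coords R n -> mx) : (forall k l : 'I_n, (k < l)%N -> cmeas (fun x => M x k l)) ->
    measurable_fun setT (fun x => K (M x)).
  move=> mM; apply: measurable_bigprod => kl klt; apply: mcauchy; exact: mM.
have mW k l : measurable_fun setT (fun x : coords R n => W k l (coords_mx x)).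
  apply: measurableT_comp => //.
  by apply: measurable_funM; [|apply: measurable_funV]; exact: measurable_gramc.
have WE (x : coords R n) :
    \prod_(kl : 'I_n * 'I_n | (kl.1 < kl.2)%N) W kl.1 kl.2 (coords_mx x) = 1.
  rewrite (prod_pairs (fun k l => W k l (coords_mx x))).
  rewrite (exchange_big_dep xpredT)//= big1// => l _.
  have ln := ltnW (ltn_ord l); set Z := coords_mx x.
  have ZU : is_unipotent Z by exact: coords_unipotent.
  rewrite -(big_ord_widen _ (fun k => `|gramc k l Z / gramc k.+1 l Z|) ln).
  suff H m : (m <= l)%N ->
      \prod_(k < m) `|gramc k l Z / gramc k.+1 l Z| = (gramc m l Z)^-1.
    by rewrite H// gramc_diag// invr1.
  elim: m => [|m IH] ml; first by rewrite big_ord0 gramc0 invr1.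
  have g1 := lt_le_trans ltr01 (gramc_ge1 ZU ml ln).
  have g0 := lt_le_trans ltr01 (gramc_ge1 ZU (ltnW ml) ln).
  rewrite big_ord_recr /= (IH (ltnW ml)) ger0_norm; last first.
    by apply: divr_ge0; exact: ltW.
  by rewrite mulrA mulVf ?mul1r// gt_eqF.
apply: (@le_lt_trans _ _ (\int[dZ R n]_x (K (coords_mx x))%:E)%E); last first.
  have : (\int[dZ R n]_x (\prod_i cauchyC (toC (tnth x i)))%:E < +oo)%E.
    apply: (power_measure_prod_lty (phi := fun z => cauchyC (toC z))).
    - by apply: mcauchy; apply: cmeas_toC; exact: measurable_id.
    - by move=> z; exact: sqr_ge0.
    - exact: integral_cauchyC_lty.
  congr (_ < +oo)%E; apply: eq_integral => x _; congr EFin.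
  rewrite /K -(prod_position (fun kl => cauchyC (coords_mx x kl.1 kl.2))).
  by apply: eq_bigr => i _; rewrite coords_mx_position.
have <- : (\int[dZ R n]_x ((\prod_(kl : 'I_n * 'I_n | (kl.1 < kl.2)%N)
      W kl.1 kl.2 (coords_mx x)) * K (unip_mx schmidt_coord (coords_mx x)))%:E =
   \int[dZ R n]_x (K (coords_mx x))%:E)%E; last first.
  apply: ge0_le_integral => //.
  + by move=> x _; rewrite lee_fin sqr_ge0.
  + apply/measurable_EFinP; apply: measurable_funX; apply: measurable_funV.
    by apply: measurable_bigprod => j _; exact: measurable_gramc.
  + apply/measurable_EFinP.
    apply: measurable_funM.
      by apply: measurable_bigprod => kl _; exact: mW.
    apply: mK => k l kl.
    rewrite (_ : (fun x => _) = fun x : coords R n => schmidt_coord k l (coords_mx x)).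
      exact: mN.
    by apply/funext => x; rewrite unip_mxE kl.
  + move=> x _; rewrite lee_fin WE mul1r.
    have ZU := coords_unipotent x; have P := prod_schmidt_coord_le ZU.
    rewrite /K (prod_pairs (fun k l => cauchyC (unip_mx schmidt_coord (coords_mx x) k l))).
    rewrite (exchange_big_dep xpredT)//=.
    rewrite (eq_bigr (fun l : 'I_n => (\prod_(k < n | (k < l)%N)
       (1 + nrm2 (schmidt_coord k l (coords_mx x))))^-1 ^+ 2)); last first.
      move=> l _; rewrite -prodfV -prodrXl; apply: eq_bigr => k kl.
      by rewrite unip_mxE kl.
    rewrite prodrXl prodfV ler_pXn2r ?nnegrE ?invr_ge0//.
    * rewrite lef_pV2 ?posrE//.
        by apply: lt_le_trans P; apply: prodr_gt0 => l _; apply: prodr_gt0 => k _;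
          rewrite ltr_pwDl// nrm2_ge0.
      by apply: prodr_gt0 => l _; apply: prodr_gt0 => k _; rewrite ltr_pwDl// nrm2_ge0.
    * apply: le_trans P; apply: prodr_ge0 => l _; apply: prodr_ge0 => k _.
      by rewrite addr_ge0// nrm2_ge0.
    * by apply: prodr_ge0 => l _; apply: prodr_ge0 => k _; rewrite addr_ge0// nrm2_ge0.
(* The coordinates are ordered by columns, then by rows. *)
apply: (@unipotent_change R n (fun k l : 'I_n => (l * n + k)%N) schmidt_coord W K).
- by move=> k l _; exact: mN.
- by move=> k l _; exact: mW.
- by move=> k l Z; exact: normr_ge0.
- move=> k l Z Z' kl ZU ZU' ZZ'.
  have Ecol (a b : 'I_n) : (b < l)%N -> Z a b = Z' a b.
    move=> bl; have [ab|ba] := ltnP a b; last first.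
      by rewrite (elimT (is_unipotentP _) ZU)// (elimT (is_unipotentP _) ZU').
    apply: ZZ' => //; apply/orP; left.
    apply: (@leq_trans (b * n + n)); first by rewrite ltn_add2l.
    by rewrite -mulSnr (leq_trans _ (leq_addr _ _))// leq_mul2r bl orbT.
  have Eg j : gramc j l Z = gramc j l Z' by apply: eq_gramc => a b _; exact: Ecol.
  have EN : schmidt_num k l Z = schmidt_num k l Z'.
    rewrite /schmidt_num (@eq_corner _ _ _ _ _ Z Z'); last by move=> a b _; exact: Ecol.
    congr ((_ *m _) _ _); have kn := ltn_ord k; apply/matrixP => a b; rewrite [b]ord1.
    rewrite !(gram_colE _ _ (a' := widen_ord kn a))//; apply: ZZ' => /=.
      by apply: leq_trans kl; exact: ltn_ord.
    have := ltn_ord a; rewrite ltnS leq_eqVlt => /orP[/eqP ak|ak].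
      apply/orP; right; rewrite xpair_eqE eqxx andbT; apply/eqP; exact: val_inj.
    by rewrite ltn_add2l ak.
  split; last by rewrite /W (Eg k) (Eg k.+1).
  rewrite /schmidt_coord EN; congr (_ * (Num.sqrt _)^-1%:C).
  exact: (congr2 *%R (Eg _) (Eg _)).
- move=> k l A f kl AU Akl mf f0; have [g1 g0] := gp AU kl.
  have Eg (z : C) j : gramc j l (A + z *: delta_mx k l) = gramc j l A.
    apply: eq_gramc => a b _ bl; rewrite add_delta_mxE.
    by rewrite [b == l]ltn_eqF// andbF mulr0 addr0.
  have s0 : Num.sqrt (gram_pair k l A) != 0 by rewrite gt_eqF// sqrtr_gt0 mulr_gt0.
  apply: (@fiber_affine _ (gramc k l A / Num.sqrt (gram_pair k l A))%:C
     (schmidt_coord k l A)) => //.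
  + by rewrite -[0]/(0%:C) (inj_eq (@complexI _)) mulf_neq0 ?invr_eq0// gt_eqF.
  + move=> z; rewrite /W !Eg nrm2_real ger0_norm; last by apply: divr_ge0; exact: ltW.
    rewrite exprMn exprVn sqr_sqrtr; last by apply: mulr_ge0; exact: ltW.
    by rewrite /gram_pair; field; rewrite !gt_eqF.
  + move=> z; rewrite /schmidt_coord /gram_pair !Eg schmidt_num_delta rmorphM /=.
    by ring.
- by apply: mK => k l _; exact: mE.
- exact: K0.
Qed.

End Volume.

(** * Weights and the unitary group *)

Section Weights.
Context (R : realType) (n : nat).
Hypothesis n_gt0 : (0 < n)%N.
Local Notation C := R[i].
Local Notation mx := 'M[C]_n.

(** The product of powers of Gram determinants that transforms by
    [prod_i |b_ii|^(-2 e_i)] under [b] in [B^-]. *)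
Definition gweight (e : nat -> int) (g : mx) : R :=
  (\prod_(1 <= j < n) gramc j n g ^ (e j - e j.-1)) * nrm2 (\det g) ^ (- e n.-1).

Lemma gramc_Bminus j (b g : mx) : in_Bminus b -> (j <= n)%N ->
  gramc j n (b *m g) = (\prod_(i < n | (i < j)%N) nrm2 (b i i)) * gramc j n g.
Proof.
move=> [bt _] jn; rewrite /gramc corner_mull// gram_mull det_corner_trig//.
by rewrite nrm2_prod.
Qed.

(** Summation by parts for the exponents. *)
Lemma abel_prod (e : nat -> int) (x : 'I_n -> R) m : (forall i, x i != 0) ->
  (0 < m <= n)%N ->
  (\prod_(1 <= j < m) (\prod_(i < n | (i < j)%N) x i) ^ (e j - e j.-1)) *
    (\prod_(i < n | (i < m)%N) x i) ^ (- e m.-1) =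
  \prod_(i < n | (i < m)%N) x i ^ (- e i).
Proof.
move=> x0; pose y (k : nat) : R := if (insub k : option 'I_n) is Some k' then x k' else 1.
pose z (k : nat) : R := y k ^ (- e k).
have P j : (j <= n)%N -> \prod_(i < n | (i < j)%N) x i = \prod_(0 <= i < j) y i.
  move=> jn; rewrite big_mkord (big_ord_widen _ y jn); apply: eq_bigr => i _.
  by rewrite /y valK.
have Q j : (j <= n)%N -> \prod_(i < n | (i < j)%N) x i ^ (- e i) = \prod_(0 <= i < j) z i.
  move=> jn; rewrite big_mkord (big_ord_widen _ z jn); apply: eq_bigr => i _.
  by rewrite /z /y valK.
have P0 j : \prod_(0 <= i < j) y i != 0.
  rewrite big_mkord; apply/prodf_neq0 => i _; rewrite /y; case: insubP => [i' _ _|_]; first exact: x0.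
  exact: oner_neq0.
case: m => // m /= mn; rewrite P// Q//.
rewrite (eq_big_nat _ _ (F2 := fun j => (\prod_(0 <= i < j) y i) ^ (e j - e j.-1))); last first.
  by move=> j /andP[_ jm]; rewrite P// (leq_trans (ltnW jm)).
elim: m {mn} => [|m IH]; first by rewrite big_geq// !big_nat1 mul1r.
rewrite big_nat_recr//= [in LHS](big_nat_recr m.+1)//= [RHS](big_nat_recr m.+1)//= -IH.
rewrite /z expfzMl addrC expfzDr ?P0// -!mulrA; congr (_ * (_ * _)).
by rewrite mulrA -expfzDr ?P0// subrr expr0z mul1r.
Qed.

Lemma gweight_Bminus (e : nat -> int) (b g : mx) : in_Bminus b ->
  gweight e (b *m g) = (\prod_i nrm2 (b i i) ^ (- e i)) * gweight e g.
Proof.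
move=> Bb; have x0 i : nrm2 (b i i) != 0 by rewrite nrm2_eq0 Bminus_diag_neq0.
have := @abel_prod e (fun i => nrm2 (b i i)) n x0; rewrite n_gt0 leqnn => /(_ isT).
rewrite [RHS](eq_bigl xpredT); last by move=> i; rewrite ltn_ord.
move=> <-; have E1 : \prod_(1 <= j < n) gramc j n (b *m g) ^ (e j - e j.-1) =
    \prod_(1 <= j < n) (\prod_(i < n | (i < j)%N) nrm2 (b i i)) ^ (e j - e j.-1) *
    \prod_(1 <= j < n) gramc j n g ^ (e j - e j.-1).
  rewrite -big_split; apply: eq_big_nat => j /andP[_ jn].
  by rewrite (gramc_Bminus _ Bb (ltnW jn)) expfzMl.
have E2 : nrm2 (\det (b *m g)) ^ (- e n.-1) =
    (\prod_(i < n | (i < n)%N) nrm2 (b i i)) ^ (- e n.-1) * nrm2 (\det g) ^ (- e n.-1).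
  rewrite det_mulmx nrm2M expfzMl; apply: (congr2 *%R); last by [].
  rewrite det_trig; last exact: Bb.1.
  rewrite nrm2_prod; apply: (congr1 (fun x => x ^ (- e n.-1))).
  by apply: eq_bigl => i; rewrite ltn_ord.
apply: (etrans (congr2 *%R E1 E2)); exact: mulrACA.
Qed.

Lemma deltaE (b : mx) : in_Bminus b ->
  delta b = \prod_(k < n) nrm2 (b k k) ^ ((k : nat)%:Z *+ 2 - n.-1%:Z).
Proof.
move=> Bb; have x0 i : nrm2 (b i i) != 0 by rewrite nrm2_eq0 Bminus_diag_neq0.
rewrite /delta; under eq_bigr do rewrite big_split /=.
rewrite big_split /= [X in X * _](exchange_big_dep xpredT)//= -big_split /=.
apply: eq_bigr => k _; set x := nrm2 (b k k).
have kltn : (k < n)%N by exact: ltn_ord.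
have kn : (k <= n.-1)%N by rewrite -ltnS prednK.
have -> : \prod_(i < n | (i < k)%N) x = x ^+ k.
  by rewrite -(big_ord_widen _ (fun=> x) (ltnW (ltn_ord k))) prodr_const card_ord.
have -> : \prod_(l < n | (k < l)%N) x^-1 = x ^- (n.-1 - k)%N.
  rewrite -exprVn; have H : (\prod_(l < n | (k < l)%N) x^-1) * x^-1 ^+ k.+1 = x^-1 ^+ n.
    transitivity (\prod_(l < n) x^-1); last by rewrite prodr_const card_ord.
    rewrite [RHS](bigID (fun l : 'I_n => (k < l)%N)) /=.
    congr (_ * _); rewrite (eq_bigl (fun l : 'I_n => (l < k.+1)%N)).
      by rewrite -(big_ord_widen _ (fun=> x^-1) kltn) prodr_const card_ord.
    by move=> l; rewrite -leqNgt.
  apply: (@mulIf _ (x^-1 ^+ k.+1)); first by rewrite expf_neq0// invr_eq0 x0.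
  rewrite H -exprD; congr (_ ^+ _).
  by rewrite addnS subnK// prednK.
rewrite -[x ^+ k]/(x ^ k%:Z) -[x ^- _]/((x ^ (n.-1 - k)%N%:Z)^-1) invr_expz.
by rewrite -expfzDr ?x0//; congr (_ ^ _); rewrite -subzn// mulr2n; ring.
Qed.

Lemma gramc_unitary j (u g : mx) : u *m hc u = 1%:M -> (j <= n)%N ->
  gramc j n (g *m u) = gramc j n g.
Proof. by move=> uu jn; rewrite /gramc (corner_mulr _ _ jn) (gram_mulr _ uu). Qed.

Lemma det_unitary m (u : 'M[C]_m) : u *m hc u = 1%:M -> nrm2 (\det u) = 1.
Proof. by move=> uu; rewrite -gram_square /gram uu det1. Qed.

Lemma gweight_unitary e (u g : mx) : u *m hc u = 1%:M ->
  gweight e (g *m u) = gweight e g.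
Proof.
move=> uu; rewrite /gweight det_mulmx nrm2M (det_unitary uu) mulr1.
apply: (congr2 *%R); last by [].
by apply: eq_big_nat => j /andP[_ jn]; rewrite (gramc_unitary g uu (ltnW jn)).
Qed.

Lemma gweight1 e : gweight e 1%:M = 1.
Proof.
have U1 : is_unipotent (1%:M : mx) by apply/is_unipotentP => k l _; rewrite mxE.
rewrite /gweight det1 nrm2_1 exp1rz mulr1 big_nat big1// => j /andP[_ jn].
rewrite /gramc /gram.
have -> : corner j n (1%:M : mx) *m hc (corner j n (1%:M : mx)) = 1%:M :> 'M[C]_j.
  have jn' := ltnW jn.
  have cE (a : 'I_j) (c : 'I_n) :
      corner j n (1%:M : mx) a c = (widen_ord jn' a == c)%:R.
    by rewrite (cornerE _ (i' := widen_ord jn' a) (j' := c))// mxE.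
  apply/matrixP => a b; rewrite !mxE (bigD1 (widen_ord jn' a))//= big1 ?addr0.
    by rewrite hcE !cE eqxx mul1r conjc_nat -val_eqE /= eq_sym.
  by move=> c ca; rewrite cE eq_sym (negbTE ca) mul0r.
by rewrite det1 /= exp1rz.
Qed.

(** The shift is the weight of [delta]: [density p] times [f * conj f'], with
    [f, f'] of weight [p], extends to a density on [B^-\GL]. *)
Definition shifted_weight (p : seq int) (j : nat) : int :=
  p`_j - (j%:Z *+ 2 - n.-1%:Z).

Lemma density_gweight (p : seq int) (Z : Nplus R n) :
  density p Z = gweight (shifted_weight p) (val Z).
Proof.
rewrite /gweight (unipotent_det (valP Z)) nrm2_1 exp1rz mulr1.
apply: eq_big_nat => j /andP[j1 _]; congr (_ ^ _).
case: j j1 => // j _; rewrite /shifted_weight /= intS !mulr2n; ring.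
Qed.

(** The first factor cancels the growth of functions of weight [p], the second one is
    integrable. *)
Lemma density_decomp (p : seq int) (Z : Nplus R n) :
  density p Z = gweight (fun j => p`_j) (val Z) *
    (\prod_(1 <= j < n) gramc j n (val Z))^-1 ^+ 2.
Proof.
have g0 j : (0 < j < n)%N -> gramc j n (val Z) != 0.
  move=> /andP[_ jn]; rewrite gt_eqF//; apply: lt_le_trans (gramc_ge1 (valP Z) _ _) => //.
  exact: ltnW.
rewrite /gweight (unipotent_det (valP Z)) nrm2_1 exp1rz mulr1.
rewrite -prodfV -prodrXl -big_split /=; apply: eq_big_nat => j j1.
rewrite -[complex.Re _]/(gramc j n (val Z)) (_ : _^-1 ^+ 2 = gramc j n (val Z) ^ (-2)).
  rewrite -expfzDr ?g0//.
  by congr (_ ^ _); rewrite opprB.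
by rewrite exprVn.
Qed.

Lemma density_gt0 (p : seq int) (Z : Nplus R n) : 0 < density p Z.
Proof.
rewrite /density big_nat; apply: prodr_gt0 => j /andP[_ jn]; apply: exprz_gt0.
rewrite -[complex.Re _]/(gramc j n (val Z)).
by apply: lt_le_trans (gramc_ge1 (valP Z) _ _) => //; exact: ltnW.
Qed.

End Weights.

Section Schmidt.
Context (R : realType) (n : nat).
Local Notation C := R[i].
Local Notation mx := 'M[C]_n.

(** Gram-Schmidt orthogonalization of the rows of [g]. *)
Lemma Bminus_unitary (g : mx) : g \in unitmx ->
  exists b u : mx, [/\ in_Bminus b, u *m hc u = 1%:M & g = b *m u].
Proof.
move=> gU; pose u := schmidt g.
have uu : u *m hc u = 1%:M.
  have /unitarymxP <- := schmidt_unitarymx g (leqnn n); congr (_ *m _).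
  by apply/matrixP => i j; rewrite !mxE.
have uu' : hc u *m u = 1%:M by exact: mulmx1C.
exists (g *m hc u), u; rewrite -mulmxA uu' mulmx1; split => //; split; last first.
  by rewrite unitmx_mul gU; case: (mulmx1_unit uu') => ->.
apply/is_trig_mxP => i j ij.
have sub := row_schmidt_sub g i.
pose c : 'cV[C]_n := col j (hc u).
have : (row i g <= kermx c)%MS.
  apply: submx_trans sub _; apply/sumsmx_subP => k ki; rewrite genmxE.
  apply/sub_kermxP; apply/matrixP => a b; rewrite !ord1.
  have := congr1 (fun M : mx => M k j) uu; rewrite !mxE.
  rewrite [k == j]ltn_eqF ?(leq_ltn_trans ki)// => E.
  by apply: (etrans _ E); apply: eq_bigr => m _; rewrite !mxE.
move=> /sub_kermxP/matrixP/(_ 0 0); rewrite !mxE => E.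
by apply: (etrans _ E); apply: eq_bigr => k _; rewrite !mxE.
Qed.

Lemma unitary_entry_le (u : mx) i j : u *m hc u = 1%:M -> nrm2 (u i j) <= 1.
Proof.
move=> uu; have := congr1 (fun M : mx => M i i) uu; rewrite !mxE eqxx => E.
have {}E : \sum_k nrm2 (u i k) = 1.
  apply: complexI; rewrite rmorph_sum /= -[RHS]E; apply: eq_bigr => k _.
  by rewrite hcE nrm2E.
rewrite -E (bigD1 j)//= lerDl; apply: sumr_ge0 => k _; exact: nrm2_ge0.
Qed.

Lemma nrm2_norm (z : C) : (nrm2 z)%:C = `|z| ^+ 2.
Proof. by rewrite -add_Re2_Im2. Qed.

Lemma nrm2_le1 (z : C) : nrm2 z <= 1 -> `|z| <= 1.
Proof.
by move=> z1; rewrite -(@expr_le1 _ 2)// -nrm2_norm -[1]/(1%:C) lecR.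
Qed.

(** The entries of a unitary matrix and the inverse of its determinant have modulus
    at most 1. *)
Lemma regular_bounded_unitary (f : mx -> C) : regular_on_GL f ->
  exists B : R, 0 <= B /\ forall u, u *m hc u = 1%:M -> nrm2 (f u) <= B.
Proof.
move=> [P fP]; pose S : C := \sum_(m <- mpoly.msupp P) `|mpoly.mcoeff m P|.
exists (complex.Re (S ^+ 2)).
have S0 : 0 <= S by apply: sumr_ge0.
have S2 : 0 <= S ^+ 2 by exact: exprn_ge0.
have SE : (complex.Re (S ^+ 2))%:C = S ^+ 2 by rewrite RRe_real// realE S2.
split=> [|u uu]; first by rewrite -lecR SE.
have uU : u \in unitmx by case: (mulmx1_unit uu).
rewrite -lecR SE nrm2_norm ler_pXn2r ?nnegrE// fP// mpoly.mevalE.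
apply: le_trans (ler_norm_sum _ _ _) _; apply: ler_sum => m _.
rewrite normrM ler_piMr// normr_prod prodr_ile1// => i _; rewrite normr_ge0 normrX /=.
apply: exprn_ile1 => //; apply: nrm2_le1.
case: (split_ordP i) => k ->; rewrite ?row_mxEl ?row_mxEr; last first.
  by rewrite [k]ord1 mxE eqxx mulr1n nrm2V (det_unitary uu) invr1.
by case/mxvec_indexP: k => a b; rewrite mxvecE; exact: unitary_entry_le.
Qed.

End Schmidt.

(** * Integrals of complex functions *)

Section ComplexIntegral.
Context d (T : measurableType d) (R : realType) (mu : {measure set T -> \bar R}).
Local Notation C := R[i].
Implicit Types f g : T -> C.

Lemma eq_Cintegral f g : f =1 g -> Cintegral mu f = Cintegral mu g.
Proof. by move=> /funext ->. Qed.

Lemma Cintegrable_dominated f (h : T -> R) : cmeas f ->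
  mu.-integrable setT (EFin \o h) -> (forall x, nrm2 (f x) <= h x ^+ 2) ->
  (forall x, 0 <= h x) -> Cintegrable mu f.
Proof.
move=> [mf1 mf2] ih fh h0; have le_abs x (a b : R) : nrm2 (a +i* b) <= h x ^+ 2 ->
    (`|a| <= h x) /\ (`|b| <= h x).
  rewrite /nrm2 /= => H; split; rewrite -(@ler_pXn2r _ 2) ?nnegrE// real_normK ?num_real//;
    by apply: le_trans H; rewrite ?lerDl ?lerDr sqr_ge0.
split; apply: (le_integrable measurableT _ _ ih) => //.
- exact/measurable_EFinP.
- move=> x _ /=; rewrite lee_fin [`|h x|]ger0_norm//.
  by have := fh x; case: (f x) => a b /le_abs[].
- exact/measurable_EFinP.
- move=> x _ /=; rewrite lee_fin [`|h x|]ger0_norm//.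
  by have := fh x; case: (f x) => a b /le_abs[].
Qed.

Lemma CintegrableD f g : Cintegrable mu f -> Cintegrable mu g ->
  Cintegrable mu (fun x => f x + g x).
Proof.
move=> [f1 f2] [g1 g2]; split.
  apply: eq_integrable (integrableD measurableT f1 g1) => // x _ /=.
  by rewrite raddfD EFinD.
apply: eq_integrable (integrableD measurableT f2 g2) => // x _ /=.
by rewrite raddfD EFinD.
Qed.

Lemma CintegralD f g : Cintegrable mu f -> Cintegrable mu g ->
  Cintegral mu (fun x => f x + g x) = Cintegral mu f + Cintegral mu g.
Proof.
move=> [f1 f2] [g1 g2]; rewrite /Cintegral; under eq_Rintegral do rewrite raddfD.
under [X in _ +i* X = _]eq_Rintegral do rewrite raddfD.
by rewrite !RintegralD.
Qed.

Lemma integrable_lin (a b : R) (u v : T -> R) :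
  mu.-integrable setT (EFin \o u) -> mu.-integrable setT (EFin \o v) ->
  mu.-integrable setT (EFin \o (fun x => a * u x + b * v x)).
Proof.
move=> iu iv; apply: eq_integrable
  (integrableD measurableT (integrableZl measurableT a iu) (integrableZl measurableT b iv)) => //.
Qed.

Lemma Rintegral_lin (a b : R) (u v : T -> R) :
  mu.-integrable setT (EFin \o u) -> mu.-integrable setT (EFin \o v) ->
  \int[mu]_x (a * u x + b * v x) = a * \int[mu]_x u x + b * \int[mu]_x v x.
Proof.
move=> iu iv; rewrite RintegralD ?RintegralZl//.
  by apply: eq_integrable (integrableZl measurableT a iu).
by apply: eq_integrable (integrableZl measurableT b iv).
Qed.

Lemma CintegrableZ (c : C) f : Cintegrable mu f -> Cintegrable mu (fun x => c * f x).
Proof.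
move=> [f1 f2]; split.
  apply: eq_integrable (integrable_lin (complex.Re c) (- complex.Im c) f1 f2) => // x _ /=.
  by rewrite complex_ReM mulNr.
apply: eq_integrable (integrable_lin (complex.Re c) (complex.Im c) f2 f1) => // x _ /=.
by rewrite complex_ImM.
Qed.

Lemma CintegralZ (c : C) f : Cintegrable mu f ->
  Cintegral mu (fun x => c * f x) = c * Cintegral mu f.
Proof.
move=> [f1 f2]; rewrite /Cintegral.
have -> : (\int[mu]_x complex.Re (c * f x) =
    \int[mu]_x (complex.Re c * complex.Re (f x) + (- complex.Im c) * complex.Im (f x)))%R.
  by apply: eq_Rintegral => x _; rewrite complex_ReM mulNr.
have -> : (\int[mu]_x complex.Im (c * f x) =
    \int[mu]_x (complex.Re c * complex.Im (f x) + complex.Im c * complex.Re (f x)))%R.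
  by apply: eq_Rintegral => x _; rewrite complex_ImM.
rewrite !Rintegral_lin//; case: c => a b /=; apply/eqP; rewrite eq_complex /=.
by apply/andP; split; apply/eqP; ring.
Qed.

Lemma Cintegrable0 : Cintegrable mu (fun=> 0).
Proof. by split; exact: integrable0. Qed.

Lemma Cintegral0 : Cintegral mu (fun=> 0) = 0.
Proof. by rewrite /Cintegral /= !Rintegral_cst//= !mul0r. Qed.

Lemma Cintegrable_sum (I : Type) (r : seq I) (f : I -> T -> C) :
  (forall i, Cintegrable mu (f i)) -> Cintegrable mu (fun x => \sum_(i <- r) f i x).
Proof.
move=> fi; elim: r => [|i r IH].
  by under eq_fun do rewrite big_nil; exact: Cintegrable0.
by under eq_fun do rewrite big_cons; exact: CintegrableD.
Qed.

Lemma Cintegral_sum (I : Type) (r : seq I) (f : I -> T -> C) :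
  (forall i, Cintegrable mu (f i)) ->
  Cintegral mu (fun x => \sum_(i <- r) f i x) = \sum_(i <- r) Cintegral mu (f i).
Proof.
move=> fi; elim: r => [|i r IH].
  by under eq_fun do rewrite big_nil; rewrite Cintegral0 big_nil.
under eq_fun do rewrite big_cons; rewrite big_cons CintegralD ?IH//.
exact: Cintegrable_sum.
Qed.

Lemma Cintegral_conj f : Cintegrable mu f ->
  Cintegral mu (fun x => (f x)^*) = (Cintegral mu f)^*.
Proof.
move=> [f1 f2]; rewrite /Cintegral /=; congr (_ +i* _).
  by apply: eq_Rintegral => x _; case: (f x).
rewrite -mulN1r -RintegralZl//; apply: eq_Rintegral => x _; rewrite mulN1r.
by case: (f x).
Qed.

End ComplexIntegral.

Section ProductIntegral.
Context d1 d2 (T1 : measurableType d1) (T2 : measurableType d2) (R : realType).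
Variables (m1 : {sigma_finite_measure set T1 -> \bar R})
  (m2 : {sigma_finite_measure set T2 -> \bar R}).
Local Notation C := R[i].

Lemma integrable_tensor (u : T1 -> R) (v : T2 -> R) :
  m1.-integrable setT (EFin \o u) -> m2.-integrable setT (EFin \o v) ->
  (product_measure1 m1 m2).-integrable setT (EFin \o (fun z => u z.1 * v z.2)).
Proof.
move=> iu iv; have mu_ : measurable_fun setT u by exact/measurable_EFinP/(measurable_int m1).
have mv : measurable_fun setT v by exact/measurable_EFinP/(measurable_int m2).
have muv : measurable_fun setT (fun z : T1 * T2 => u z.1 * v z.2).
  apply: measurable_funM; first exact: measurableT_comp mu_ (@measurable_fst _ _ _ _).
  exact: measurableT_comp mv (@measurable_snd _ _ _ _).
apply/integrable12ltyP; first exact/measurable_EFinP.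
have /integrableP[_ iu_] := iu; have /integrableP[_ iv_] := iv.
have Iv0 : (0 <= \int[m2]_y `|(v y)%:E|)%E by exact: integral_ge0.
have Iu0 : (0 <= \int[m1]_y `|(u y)%:E|)%E by exact: integral_ge0.
rewrite (eq_integral (fun x => `|(u x)%:E| * \int[m2]_y `|(v y)%:E|)%E).
  rewrite ge0_integralZr//; last first.
    by apply: measurableT_comp => //; exact/measurable_EFinP.
  by rewrite lte_mul_pinfty// ge0_fin_numE.
move=> x _; rewrite -ge0_integralZl//; last first.
  by apply: measurableT_comp => //; exact/measurable_EFinP.
by apply: eq_integral => y _ /=; rewrite -EFinM normrM.
Qed.

Lemma Rintegral_tensor (u : T1 -> R) (v : T2 -> R) :
  m1.-integrable setT (EFin \o u) -> m2.-integrable setT (EFin \o v) ->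
  \int[product_measure1 m1 m2]_z (u z.1 * v z.2) = \int[m1]_x u x * \int[m2]_y v y.
Proof.
move=> iu iv; rewrite /Rintegral -integral12_prod_meas1; last exact: integrable_tensor.
rewrite -fineM; last 2 first.
- exact: integrable_fin_num.
- exact: integrable_fin_num.
congr fine; rewrite -(fineK (integrable_fin_num measurableT iv)).
rewrite -integralZr//; apply: eq_integral => x _.
rewrite /fubini_F /= fineK ?integrable_fin_num//.
by rewrite -integralZl//; apply: eq_integral => y _; rewrite EFinM.
Qed.

Lemma Cintegrable_tensor (f : T1 -> C) (g : T2 -> C) :
  Cintegrable m1 f -> Cintegrable m2 g ->
  Cintegrable (product_measure1 m1 m2) (fun z => f z.1 * g z.2).
Proof.
move=> [f1 f2] [g1 g2]; split.
  apply: eq_integrable (integrable_lin 1 (-1) (integrable_tensor f1 g1)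
     (integrable_tensor f2 g2)) => // z _ /=.
  by rewrite complex_ReM mul1r mulN1r.
apply: eq_integrable (integrable_lin 1 1 (integrable_tensor f1 g2)
   (integrable_tensor f2 g1)) => // z _ /=.
by rewrite complex_ImM !mul1r.
Qed.

Lemma Cintegral_tensor (f : T1 -> C) (g : T2 -> C) :
  Cintegrable m1 f -> Cintegrable m2 g ->
  Cintegral (product_measure1 m1 m2) (fun z => f z.1 * g z.2) =
  Cintegral m1 f * Cintegral m2 g.
Proof.
move=> [f1 f2] [g1 g2]; rewrite /Cintegral /=.
set F := product_measure1 m1 m2.
have -> : (\int[F]_z complex.Re (f z.1 * g z.2) =
    \int[F]_z (1 * (complex.Re (f z.1) * complex.Re (g z.2)) +
      (-1) * (complex.Im (f z.1) * complex.Im (g z.2))))%R.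
  by apply: eq_Rintegral => z _; rewrite complex_ReM mul1r mulN1r.
have -> : (\int[F]_z complex.Im (f z.1 * g z.2) =
    \int[F]_z (1 * (complex.Re (f z.1) * complex.Im (g z.2)) +
      1 * (complex.Im (f z.1) * complex.Re (g z.2))))%R.
  by apply: eq_Rintegral => z _; rewrite complex_ImM !mul1r.
rewrite (Rintegral_lin 1 (-1) (integrable_tensor f1 g1) (integrable_tensor f2 g2)).
rewrite (Rintegral_lin 1 1 (integrable_tensor f1 g2) (integrable_tensor f2 g1)).
rewrite (Rintegral_tensor f1 g1) (Rintegral_tensor f2 g2).
by rewrite (Rintegral_tensor f1 g2) (Rintegral_tensor f2 g1) !mul1r mulN1r.
Qed.

End ProductIntegral.

(** * The inner product on regular covariant functions *)

Lemma sesquilinear_scale (R : realType) (c a b : R[i]) :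
  c * a * (c * b)^* = (nrm2 c)%:C * (a * b^*).
Proof.
case: c a b => c1 c2 [a1 a2] [b1 b2]; apply/eqP; rewrite eq_complex /nrm2 /=.
by apply/andP; split; apply/eqP; ring.
Qed.

Section InnerProduct.
Context (R : realType) (n : nat).
Hypothesis n_gt0 : (0 < n)%N.
Local Notation C := R[i].
Local Notation mx := 'M[C]_n.
Variable p : n.-tuple int.

Definition regular_covariant (f : mx -> C) : Prop := regular_on_GL f /\ covariant p f.

Lemma cmeas_regular (f : mx -> C) d (T : measurableType d) (M : T -> mx) :
  regular_on_GL f -> (forall x, M x \in unitmx) ->
  (forall k l, cmeas (fun x => M x k l)) -> cmeas (fun x => f (M x)).
Proof.
move=> [P fP] MU mM; under eq_fun => x do rewrite fP// mpoly.mevalE.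
apply: cmeas_sum => m; apply: cmeasM; first exact: cmeas_cst.
apply: cmeas_prod => i; apply: cmeasX; case: (split_ordP i) => k ->.
  case/mxvec_indexP: k => a b; under eq_fun do rewrite row_mxEl mxvecE; exact: mM.
have -> : (fun x => row_mx (mxvec (M x)) ((\det (M x))^-1)%:M 0 (rshift (n * n) k)) =
    (fun x => (\det (M x))^-1).
  by apply/funext => x; rewrite row_mxEr [k]ord1 mxE eqxx mulr1n.
by apply: cmeasV; exact: cmeas_det.
Qed.

Lemma regular_covariant_translate (f : mx -> C) g : g \in unitmx ->
  regular_covariant f -> regular_covariant (fun h => f (h *m g)).
Proof.
move=> gU [rf cf]; split; first exact: regular_on_GL_shift.
by move=> b h Bb hU; rewrite -mulmxA cf// unitmx_mul hU.
Qed.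

Definition ip_integrand (f f' : mx -> C) (x : coords R n) : C :=
  f (coords_mx x) * (f' (coords_mx x))^* * (density p (of_coords x))%:C.

Definition ip (f f' : mx -> C) : C := Cintegral (dZ R n) (ip_integrand f f').

Lemma measurable_density :
  measurable_fun setT (fun x : coords R n => density p (of_coords x)).
Proof.
apply: measurable_bigprod => j _; apply: measurable_funXz.
by apply: (@measurable_gramc R n _ _ (fun x : coords R n => coords_mx x));
  exact: cmeas_coords.
Qed.

Lemma cmeas_regular_coords (f : mx -> C) : regular_covariant f ->
  cmeas (fun x : coords R n => f (coords_mx x)).
Proof.
move=> [rf _]; apply: (cmeas_regular rf); first exact: coords_unit.
exact: cmeas_coords.
Qed.

(** The left hand side is invariant under [B^-], hence bounded by its values on
    the compact unitary group. *)
Lemma regular_covariant_bound (f : mx -> C) : regular_covariant f ->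
  exists B : R, 0 <= B /\ forall g, g \in unitmx ->
    nrm2 (f g) * gweight (fun j => p`_j) g <= B.
Proof.
move=> [rf cf]; have [B [B0 fB]] := regular_bounded_unitary rf.
exists B; split=> // g /Bminus_unitary[b [u [Bb uu ->]]].
have uU : u \in unitmx by case: (mulmx1_unit uu).
rewrite cf// gweight_Bminus// nrm2M nrm2_prod -[u]mul1mx gweight_unitary// gweight1.
rewrite mulr1 mulrAC -big_split /= big1 ?mul1r ?mul1mx ?fB// => i _.
by rewrite nrm2Xz -expfzDr ?subrr ?expr0z// nrm2_eq0 Bminus_diag_neq0.
Qed.

Lemma regular_covariant_density_bound (f : mx -> C) : regular_covariant f ->
  exists B : R, 0 <= B /\ forall x : coords R n,
    nrm2 (f (coords_mx x)) * density p (of_coords x) <=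
    B * (\prod_(1 <= j < n) gramc j n (coords_mx x))^-1 ^+ 2.
Proof.
move=> rf; have [B [B0 fB]] := regular_covariant_bound rf; exists B; split=> // x.
rewrite density_decomp mulrA ler_wpM2r ?sqr_ge0//; apply: fB; exact: coords_unit.
Qed.

Let vol (x : coords R n) : R := (\prod_(1 <= j < n) gramc j n (coords_mx x))^-1 ^+ 2.

Let integrable_vol : (dZ R n).-integrable setT (EFin \o vol).
Proof.
have mvol : measurable_fun setT vol.
  apply: measurable_funX; apply: measurable_funV; apply: measurable_bigprod => j _.
  by apply: (@measurable_gramc R n _ _ (fun x : coords R n => coords_mx x));
    exact: cmeas_coords.
apply/integrableP; split; first exact/measurable_EFinP.
have := @finite_volume R n; congr (_ < +oo)%E.
by apply: eq_integral => x _ /=; rewrite ger0_norm// sqr_ge0.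
Qed.

Lemma ip_integrable (f f' : mx -> C) : regular_covariant f -> regular_covariant f' ->
  Cintegrable (dZ R n) (ip_integrand f f').
Proof.
move=> rf rf'; have [B [B0 fB]] := regular_covariant_density_bound rf.
have [B' [B'0 fB']] := regular_covariant_density_bound rf'.
have d0 (x : coords R n) : 0 < density p (of_coords x) by exact: density_gt0.
apply: (@Cintegrable_dominated _ _ _ _ _ (fun x => (B + B') * vol x)).
- apply: cmeasM; last by apply: cmeas_real; exact: measurable_density.
  apply: cmeasM; first exact: cmeas_regular_coords.
  by apply: cmeas_conj; exact: cmeas_regular_coords.
- exact: (integrableZl measurableT (B + B') integrable_vol).
- move=> x; rewrite /ip_integrand !nrm2M nrm2_conj nrm2_real.
  have Hb := fB x; have Ha := fB' x; have D0 := d0 x.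
  have b0 := nrm2_ge0 (f (coords_mx x)); have a0 := nrm2_ge0 (f' (coords_mx x)).
  have v0 : 0 <= vol x by exact: sqr_ge0.
  rewrite -/(vol x) in Ha Hb; set b := nrm2 (f _) in b0 Hb *.
  set a := nrm2 (f' _) in a0 Ha *; set D := density _ _ in D0 Ha Hb *.
  set v := vol x in v0 Ha Hb *.
  have -> : b * a * D ^+ 2 = (b * D) * (a * D) by ring.
  have bD0 : 0 <= b * D by rewrite mulr_ge0// ltW.
  have aD0 : 0 <= a * D by rewrite mulr_ge0// ltW.
  have Bv : 0 <= B * v by exact: mulr_ge0.
  have B'v : 0 <= B' * v by exact: mulr_ge0.
  rewrite expr2 [(B + B') * v]mulrDl; apply: ler_pM => //.
    by apply: le_trans Hb _; rewrite lerDl.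
  by apply: le_trans Ha _; rewrite lerDr.
- by move=> x; rewrite mulr_ge0 ?addr_ge0// sqr_ge0.
Qed.

(** Apply the invariance of nonnegative densities to the positive and negative
    parts of [K]. *)
Lemma signed_preserves (K : mx -> R) (g : mx) : g \in unitmx ->
  (forall b h, in_Bminus b -> h \in unitmx -> K (b *m h) = delta b * K h) ->
  (forall M : coords R n -> mx, (forall x, M x \in unitmx) ->
    (forall k l, cmeas (fun x => M x k l)) -> measurable_fun setT (fun x => K (M x))) ->
  (\int[dZ R n]_x (K (coords_mx x *m g))%:E = \int[dZ R n]_x (K (coords_mx x))%:E)%E.
Proof.
move=> gU Kcov Kmeas; have [_ Qg] := preserves_unitmx gU.
have delta0 (b : mx) : 0 <= delta b.
  by apply: prodr_ge0 => k _; apply: prodr_ge0 => l _; rewrite divr_ge0 ?nrm2_ge0.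
have dens (s : R) : top_density (fun h => Num.max (s * K h) 0).
  split.
  - by move=> h; rewrite le_max lexx orbT.
  - move=> b h Bb hU; rewrite Kcov// mulrCA -[X in Num.max _ X](mulr0 (delta b)).
    by rewrite maxr_pMr.
  - move=> M MU mM; apply: measurable_maxr; last exact: measurable_cst.
    by apply: measurable_funM; [exact: measurable_cst|exact: Kmeas].
rewrite integralE [RHS]integralE; congr (_ - _)%E.
- have := Qg _ (dens 1); congr (_ = _); apply: eq_integral => x _;
  by rewrite funeposE mul1r EFin_max.
- have := Qg _ (dens (-1)); congr (_ = _); apply: eq_integral => x _;
  by rewrite funenegE mulN1r EFin_max.
Qed.

(** The integrand extends to a density on GL because the translation by a unitary
    matrix does not change Gram determinants. *)
Lemma ip_unitary (f f' : mx -> C) (u : mx) :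
  regular_covariant f -> regular_covariant f' -> u *m hc u = 1%:M ->
  ip (fun h => f (h *m u)) (fun h => f' (h *m u)) = ip f f'.
Proof.
move=> [rf cf] [rf' cf'] uu; have uU : u \in unitmx by case: (mulmx1_unit uu).
have key (part : C -> R) : (forall (r : R) z, part (r%:C * z) = r * part z) ->
    (forall d (T : measurableType d) (h : T -> C), cmeas h ->
      measurable_fun setT (fun x => part (h x))) ->
    \int[dZ R n]_x part (ip_integrand (fun h => f (h *m u)) (fun h => f' (h *m u)) x) =
    \int[dZ R n]_x part (ip_integrand f f' x).
  move=> partZ partm; pose K h := part (f h * (f' h)^*) * gweight (shifted_weight n p) h.
  have KE (h : mx -> C) (h' : mx -> C) x :
      part (h (coords_mx x) * (h' (coords_mx x))^* * (density p (of_coords x))%:C) =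
      part (h (coords_mx x) * (h' (coords_mx x))^*) *
        gweight (shifted_weight n p) (coords_mx x).
    by rewrite mulrC partZ mulrC density_gweight.
  rewrite /Rintegral; congr fine.
  transitivity (\int[dZ R n]_x (K (coords_mx x *m u))%:E)%E.
    apply: eq_integral => x _; congr EFin; rewrite /K gweight_unitary//.
    exact: (KE (fun h => f (h *m u)) (fun h => f' (h *m u))).
  rewrite signed_preserves//.
  - by apply: eq_integral => x _; congr EFin; rewrite /ip_integrand KE.
  - move=> b h Bb hU; rewrite /K cf// cf'// gweight_Bminus// deltaE//.
    set be := \prod_(j < n) b j j ^ p`_j.
    have -> : be * f h * (be * f' h)^* = (nrm2 be)%:C * (f h * (f' h)^*).
      exact: sesquilinear_scale.
    rewrite partZ mulrACA; congr (_ * _).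
    rewrite /be nrm2_prod -big_split /=; apply: eq_bigr => k _.
    rewrite nrm2Xz -expfzDr ?nrm2_eq0 ?Bminus_diag_neq0//; congr (_ ^ _).
    by rewrite /shifted_weight; ring.
  - move=> M MU mM; apply: measurable_funM.
      apply: partm; apply: cmeasM; first exact: (cmeas_regular rf).
      by apply: cmeas_conj; exact: (cmeas_regular rf').
    apply: measurable_funM.
      by apply: measurable_bigprod => j _; apply: measurable_funXz; exact: measurable_gramc.
    by apply: measurable_funXz; apply: measurable_nrm2; exact: cmeas_det.
rewrite /ip /Cintegral; congr (_ +i* _); apply: key.
- exact: Re_real_mul.
- by move=> d T h [].
- by move=> r [a b] /=; rewrite mul0r addr0.
- by move=> d T h [].
Qed.

Lemma ipD (f1 f2 f' : mx -> C) : regular_covariant f1 -> regular_covariant f2 ->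
  regular_covariant f' -> ip (fun h => f1 h + f2 h) f' = ip f1 f' + ip f2 f'.
Proof.
move=> r1 r2 r'; rewrite -CintegralD; try exact: ip_integrable.
by apply: eq_Cintegral => x; rewrite /ip_integrand !mulrDl.
Qed.

Lemma ipZ (c : C) (f f' : mx -> C) : regular_covariant f -> regular_covariant f' ->
  ip (fun h => c * f h) f' = c * ip f f'.
Proof.
move=> r r'; rewrite -CintegralZ; last exact: ip_integrable.
by apply: eq_Cintegral => x; rewrite /ip_integrand !mulrA.
Qed.

Lemma ip_conj (f f' : mx -> C) : regular_covariant f -> regular_covariant f' ->
  ip f' f = (ip f f')^*.
Proof.
move=> r r'; rewrite -Cintegral_conj; last exact: ip_integrable.
apply: eq_Cintegral => x; rewrite /ip_integrand.
case: (f _) (f' _) => [a b] [a' b']; apply/eqP; rewrite eq_complex /=.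
by apply/andP; split; apply/eqP; ring.
Qed.

Lemma eq_ip (f1 f2 f1' f2' : mx -> C) :
  (forall g, g \in unitmx -> f1 g = f2 g) -> (forall g, g \in unitmx -> f1' g = f2' g) ->
  ip f1 f1' = ip f2 f2'.
Proof.
move=> f12 f12'; apply: eq_Cintegral => x.
by rewrite /ip_integrand f12 ?f12'// coords_unit.
Qed.

Lemma regular_covariantD (f1 f2 : mx -> C) : regular_covariant f1 ->
  regular_covariant f2 -> regular_covariant (fun h => f1 h + f2 h).
Proof.
move=> [r1 c1] [r2 c2]; split; first exact: regularD.
by move=> b g Bb gU; rewrite c1// c2// mulrDr.
Qed.

Lemma regular_covariantZ (c : C) (f : mx -> C) : regular_covariant f ->
  regular_covariant (fun h => c * f h).
Proof.
move=> [r cf]; split; first exact: (regularM (regular_cst _ c)).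
by move=> b g Bb gU; rewrite cf// mulrCA.
Qed.

Lemma regular_covariant_sum (I : Type) (r : seq I) (F : I -> mx -> C) :
  (forall i, regular_covariant (F i)) ->
  regular_covariant (fun h => \sum_(i <- r) F i h).
Proof.
move=> rF; elim: r => [|i r IH].
  under eq_fun do rewrite big_nil; split; last by move=> b g _ _; rewrite mulr0.
  exact: regular_cst.
by under eq_fun do rewrite big_cons; exact: regular_covariantD.
Qed.

Lemma ip_sum (I : Type) (r : seq I) (F : I -> mx -> C) f' :
  (forall i, regular_covariant (F i)) -> regular_covariant f' ->
  ip (fun h => \sum_(i <- r) F i h) f' = \sum_(i <- r) ip (F i) f'.
Proof.
move=> rF r'; elim: r => [|i r IH].
  rewrite big_nil -[RHS](Cintegral0 (dZ R n)); apply: eq_Cintegral => x.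
  by rewrite /ip_integrand big_nil !mul0r.
rewrite big_cons -IH -ipD//; last exact: regular_covariant_sum.
by apply: eq_ip => // g _; rewrite big_cons.
Qed.

End InnerProduct.

(** * Kernels of finite rank and Laurent polynomials *)

Section FiniteRank.
Context (K : fieldType) (X Y : Type) (PX : X -> Prop) (PY : Y -> Prop).
Implicit Types F G : X -> Y -> K.

Definition finite_rank F : Prop := exists s : seq ((X -> K) * (Y -> K)),
  forall x y, PX x -> PY y -> F x y = \sum_(ab <- s) ab.1 x * ab.2 y.

Lemma finite_rank_eq F G : finite_rank F ->
  (forall x y, PX x -> PY y -> G x y = F x y) -> finite_rank G.
Proof. by move=> [s FE] GF; exists s => x y px py; rewrite GF// FE. Qed.

Lemma finite_rank_l (a : X -> K) : finite_rank (fun x _ => a x).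
Proof. by exists [:: (a, fun=> 1)] => x y _ _; rewrite big_seq1 mulr1. Qed.

Lemma finite_rank_r (b : Y -> K) : finite_rank (fun _ y => b y).
Proof. by exists [:: (fun=> 1, b)] => x y _ _; rewrite big_seq1 mul1r. Qed.

Lemma finite_rank_cst c : finite_rank (fun _ _ => c).
Proof. exact: (finite_rank_l (fun=> c)). Qed.

Lemma finite_rankD F G : finite_rank F -> finite_rank G ->
  finite_rank (fun x y => F x y + G x y).
Proof.
move=> [s FE] [t GE]; exists (s ++ t) => x y px py.
by rewrite big_cat FE// GE.
Qed.

Lemma finite_rankM F G : finite_rank F -> finite_rank G ->
  finite_rank (fun x y => F x y * G x y).
Proof.
move=> [s FE] [t GE].
exists [seq ((fun x => ab.1 x * cd.1 x), (fun y => ab.2 y * cd.2 y)) | ab <- s, cd <- t].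
move=> x y px py; rewrite big_allpairs_dep FE// GE// mulr_suml; apply: eq_bigr => ab _.
by rewrite mulr_sumr; apply: eq_bigr => cd _ /=; rewrite mulrACA.
Qed.

Lemma finite_rank_ring :
  ring_closed (fun F : X * Y -> K => finite_rank (fun x y => F (x, y))).
Proof.
split; first exact: finite_rank_cst.
  by move=> F G rF rG; exact: finite_rankD.
by move=> F G rF rG; exact: finite_rankM.
Qed.

Let minor F r (xs : 'I_r -> X) (ys : 'I_r -> Y) : 'M[K]_r :=
  \matrix_(i, j) F (xs i) (ys j).

(** A kernel of finite rank is recovered from finitely many of its rows and columns:
    border a nonvanishing minor of maximal size by one more row and column. *)
Lemma finite_rank_reproducing F : finite_rank F ->
  exists r (xs : 'I_r -> X) (ys : 'I_r -> Y) (N : 'M[K]_r),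
    [/\ forall i, PX (xs i), forall j, PY (ys j) &
     forall x y, PX x -> PY y ->
       F x y = \sum_i \sum_j F x (ys j) * N j i * F (xs i) y].
Proof.
move=> [s FE]; pose good r := exists (xs : 'I_r -> X) (ys : 'I_r -> Y),
  [/\ forall i, PX (xs i), forall j, PY (ys j) & minor F xs ys \in unitmx].
have good0 : exists r, `[< good r >].
  exists 0%N; apply/asboolP.
  exists (fun i : 'I_0 => match (notF (ltn_ord i)) return X with end).
  exists (fun i : 'I_0 => match (notF (ltn_ord i)) return Y with end).
  by split; try case; rewrite ?unitmxE ?det_mx00 ?unitr1.
have good_size r : `[< good r >] -> (r <= size s)%N.
  move=> /asboolP[xs [ys [pxs pys]]] U.
  pose A : 'M[K]_(r, size s) := \matrix_(i, k) (nth ((fun=> 0), (fun=> 0)) s k).1 (xs i).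
  pose B : 'M[K]_(size s, r) := \matrix_(k, j) (nth ((fun=> 0), (fun=> 0)) s k).2 (ys j).
  have ME : minor F xs ys = A *m B.
    apply/matrixP => i j; rewrite !mxE FE// (big_nth ((fun=> 0), (fun=> 0))) big_mkord.
    by apply: eq_bigr => k _; rewrite !mxE.
  rewrite -(mxrank_unit U) ME; apply: leq_trans (mxrankM_maxl _ _) _.
  exact: rank_leq_col.
case: (ex_maxnP good0 good_size) => r /asboolP[xs [ys [pxs pys U]]] rmax.
exists r, xs, ys, (invmx (minor F xs ys)); split=> // x y px py.
set M := minor F xs ys in U *.
pose xs' (i : 'I_(r + 1)) := if fintype.split i is inl i' then xs i' else x.
pose ys' (i : 'I_(r + 1)) := if fintype.split i is inl i' then ys i' else y.
pose c : 'cV[K]_r := \col_i F (xs i) y.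
pose w : 'rV[K]_r := \row_j F x (ys j).
have M'E : minor F xs' ys' = block_mx M c w (F x y)%:M.
  apply/matrixP => i j; rewrite mxE /xs' /ys'.
  case: (split_ordP i) => i' ->; case: (split_ordP j) => j' ->;
  rewrite ?(unsplitK (inl _)) ?(unsplitK (inr _)) ?block_mxEul ?block_mxEur
    ?block_mxEdl ?block_mxEdr !mxE //.
  by rewrite !ord1 eqxx mulr1n.
have sing : \det (minor F xs' ys') = 0.
  apply/eqP/negPn; rewrite -unitfE -unitmxE; apply/negP => U'.
  suff /rmax : `[< good (r + 1)%N >] by rewrite addn1 ltnn.
  apply/asboolP; exists xs', ys'; split=> // i; rewrite /xs' /ys'; by case: fintype.split.
have : block_mx M c w (F x y)%:M =
    block_mx 1%:M 0 (w *m invmx M) 1%:M *m block_mx M c 0 ((F x y)%:M - w *m invmx M *m c).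
  rewrite mulmx_block !mul1mx !mul0mx !addr0 mulmxKV//.
  by rewrite [w *m _ *m c + _]addrC subrK.
move=> /(congr1 determinant); rewrite -M'E sing det_mulmx det_lblock det_ublock !det1.
rewrite !mul1r => /esym/eqP; rewrite mulf_eq0 -[X in X || _]negbK -unitfE -unitmxE U /=.
rewrite det_mx11 !mxE eqxx mulr1n subr_eq0 => /eqP ->.
by apply: eq_bigr => i _; rewrite !mxE mulr_suml; apply: eq_bigr => j _; rewrite !mxE.
Qed.

End FiniteRank.

Section Laurent.
Context (R : realType).
Local Notation C := R[i].
Implicit Types phi : C -> C.

(** Only the values off 0 matter, so that a Laurent polynomial is a polynomial
    divided by a power of the variable. *)
Definition laurent phi : Prop := exists N (q : {poly C}),
  forall t, t != 0 -> t ^+ N * phi t = q.[t].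

Lemma laurent_eq phi psi : laurent phi -> (forall t, t != 0 -> psi t = phi t) -> laurent psi.
Proof. by move=> [N [q E]] e; exists N, q => t t0; rewrite e// E. Qed.

Lemma laurent_cst c : laurent (fun=> c).
Proof. by exists 0%N, c%:P => t _; rewrite mul1r hornerC. Qed.

Lemma laurent_id : laurent id.
Proof. by exists 0%N, 'X => t _; rewrite mul1r hornerX. Qed.

Lemma laurentV : laurent GRing.inv.
Proof. by exists 1%N, 1 => t t0; rewrite hornerC divff. Qed.

Lemma laurentM phi psi : laurent phi -> laurent psi -> laurent (fun t => phi t * psi t).
Proof.
move=> [N [q E]] [N' [q' E']]; exists (N + N')%N, (q * q') => t t0.
by rewrite hornerM -E// -E'// exprD mulrACA.
Qed.

Lemma laurentD phi psi : laurent phi -> laurent psi -> laurent (fun t => phi t + psi t).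
Proof.
move=> [N [q E]] [N' [q' E']].
exists (N + N')%N, ('X^N' * q + 'X^N * q') => t t0.
by rewrite hornerD !hornerM !hornerXn -E// -E'// exprD; ring.
Qed.

Lemma laurent_ring : ring_closed laurent.
Proof. by split; [exact: laurent_cst|exact: laurentD|exact: laurentM]. Qed.

Lemma laurentX phi m : laurent phi -> laurent (fun t => phi t ^+ m).
Proof. exact: (closedX laurent_ring). Qed.

Lemma laurent_sum (I : Type) (r : seq I) (phi : I -> C -> C) :
  (forall i, laurent (phi i)) -> laurent (fun t => \sum_(i <- r) phi i t).
Proof. by move=> L; exact: (closed_sum laurent_ring). Qed.

Lemma laurent_prod (I : Type) (r : seq I) (phi : I -> C -> C) :
  (forall i, laurent (phi i)) -> laurent (fun t => \prod_(i <- r) phi i t).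
Proof. by move=> L; exact: (closed_prod laurent_ring). Qed.

Lemma laurent_conj phi : laurent phi -> laurent (fun t => (phi t^*)^*).
Proof.
move=> [N [q E]]; exists N, (map_poly (@conjc R) q) => t t0.
have t'0 : t^* != 0 by rewrite conjc_eq0.
have e := congr1 (@conjc R) (E _ t'0).
have -> : (map_poly (@conjc R) q).[t] = (q.[t^*])^*.
  by rewrite -[t in LHS]conjcK horner_map.
by rewrite -e rmorphM rmorphXn /= conjcK.
Qed.

(** The points [(m + i) / (m - i)] of the unit circle are infinitely many zeros of
    the difference. *)
Lemma laurent_circle_eq phi psi : laurent phi -> laurent psi ->
  (forall t, t * t^* = 1 -> phi t = psi t) -> forall t, t != 0 -> phi t = psi t.
Proof.
move=> Lphi Lpsi circle; have Lpsi' := laurentM (laurent_cst (-1)) Lpsi.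
have [N [q E]] := laurentD Lphi Lpsi'.
suff q0 : q = 0.
  move=> t t0; have /eqP := E t t0; rewrite q0 horner0 mulf_eq0 expf_eq0 (negbTE t0) andbF /=.
  by rewrite mulN1r subr_eq0 => /eqP.
pose z (m : nat) : C := (m%:R +i* 1) / (m%:R -i* 1).
have den m : (m%:R -i* 1) != 0 :> C.
  by rewrite eq_complex /= oppr_eq0 oner_eq0 andbF.
have num m : (m%:R +i* 1) != 0 :> C by rewrite eq_complex /= oner_eq0 andbF.
have z1 m : z m * (z m)^* = 1.
  have zc : (z m)^* = (m%:R -i* 1) / (m%:R +i* 1).
    apply: (etrans (rmorphM (@conjc R) _ _)); congr (_ * _).
    by apply: (etrans (conjc_inv _)); rewrite /= opprK.
  apply: (etrans (congr1 ( *%R (z m)) zc)).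
  by rewrite /z; field; rewrite den num.
have z0 m : z m != 0 by rewrite mulf_neq0// invr_eq0.
have zinj : injective z.
  move=> m m' /eqP; rewrite /z eqr_div// => /eqP [_ H].
  have {}H : m%:R * 2 = m'%:R * 2 :> R by lra.
  by move/mulIf : H => /(_ _)/eqP; rewrite pnatr_eq0 => /(_ isT); rewrite eqr_nat => /eqP.
apply/eqP/negPn/negP => q0.
have roots : all (root q) (map z (iota 0 (size q))).
  apply/allP => _ /mapP[m _ ->]; apply/rootP; rewrite -E//.
  by rewrite circle// mulN1r subrr mulr0.
have := max_poly_roots q0 roots.
by rewrite size_map size_iota ltnn map_inj_uniq// iota_uniq => /(_ isT).
Qed.

End Laurent.

(** * Adjoints of right translations *)

Section Adjoint.
Context (R : realType) (n : nat).
Hypothesis n_gt0 : (0 < n)%N.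
Local Notation C := R[i].
Local Notation mx := 'M[C]_n.
Variable p : n.-tuple int.
Local Notation regcov := (@regular_covariant R n p).

(** These [g] form a monoid that contains the unitary matrices. *)
Definition has_adjoint (g : mx) : Prop := g \in unitmx /\
  forall f f', regcov f -> regcov f' ->
    ip p (fun h => f (h *m g)) f' = ip p f (fun h => f' (h *m hc g)).

Lemma hc_unit (g : mx) : (hc g \in unitmx) = (g \in unitmx).
Proof. by rewrite !unitmxE det_hc !unitfE conjc_eq0. Qed.

Lemma has_adjoint_unitary (u : mx) : u *m hc u = 1%:M -> has_adjoint u.
Proof.
move=> uu; have [uU u'U] := mulmx1_unit uu; split=> // f f' rf rf'.
rewrite -(ip_unitary n_gt0 rf (regular_covariant_translate u'U rf') uu).
by apply: eq_ip => // g _; rewrite -mulmxA uu mulmx1.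
Qed.

Lemma has_adjointM (g h : mx) : has_adjoint g -> has_adjoint h -> has_adjoint (g *m h).
Proof.
move=> [gU ag] [hU ah]; split; first by rewrite unitmx_mul gU.
move=> f f' rf rf'; rewrite hcM.
have rfh : regcov (fun k => f (k *m h)) by exact: regular_covariant_translate.
have rfg : regcov (fun k => f' (k *m hc g)).
  by apply: regular_covariant_translate => //; rewrite hc_unit.
transitivity (ip p (fun k => f (k *m g *m h)) f').
  by apply: eq_ip => // k _; rewrite mulmxA.
apply: (etrans (ag _ _ rfh rf')); apply: (etrans (ah _ _ rf rfg)).
by apply: eq_ip => // k _; rewrite mulmxA.
Qed.

Definition scale_at k (t : C) : mx := diag_mx (\row_j if j == k then t else 1).

Lemma det_scale_at k t : \det (scale_at k t) = t.
Proof.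
rewrite det_diag (bigD1 k)//= mxE eqxx big1 ?mulr1// => j jk.
by rewrite mxE (negbTE jk).
Qed.

Lemma scale_at_unit k t : (scale_at k t \in unitmx) = (t != 0).
Proof. by rewrite unitmxE det_scale_at unitfE. Qed.

Lemma hc_scale_at k t : hc (scale_at k t) = scale_at k t^*.
Proof.
apply/matrixP => i j; rewrite hcE !mxE [j == i]eq_sym.
have [->|_] := eqVneq i j; last by rewrite !mulr0n; exact: conjc0.
by rewrite !mulr1n; case: eqP => // _; exact: conjc1.
Qed.

Lemma scale_atM k s t : scale_at k s *m scale_at k t = scale_at k (s * t).
Proof.
rewrite mulmx_diag; congr diag_mx; apply/rowP => j; rewrite !mxE.
by case: eqP => // _; rewrite mul1r.
Qed.

Lemma scale_at1 k : scale_at k 1 = 1%:M.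
Proof. by apply/matrixP => i j; rewrite !mxE if_same. Qed.

Lemma laurent_translate k (f : mx -> C) (h : mx) : regular_on_GL f -> h \in unitmx ->
  laurent (fun t => f (h *m scale_at k t)).
Proof.
move=> [P fP] hU; apply: laurent_eq; last first.
  by move=> t t0; rewrite fP ?unitmx_mul ?hU ?scale_at_unit// mpoly.mevalE.
apply: laurent_sum => m; apply: laurentM; first exact: laurent_cst.
apply: laurent_prod => i; apply: laurentX; case: (split_ordP i) => j ->.
  case/mxvec_indexP: j => a b.
  apply: (@laurent_eq _ (fun t => h a b * (if b == k then t else 1))).
    by apply: laurentM; [exact: laurent_cst|case: eqP => _; [exact: laurent_id|exact: laurent_cst]].
  by move=> t _; rewrite row_mxEl mxvecE mul_mx_diag !mxE.
apply: (@laurent_eq _ (fun t => (\det h)^-1 * t^-1)).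
  by apply: laurentM; [exact: laurent_cst|exact: laurentV].
by move=> t _; rewrite row_mxEr [j]ord1 mxE eqxx mulr1n det_mulmx det_scale_at invfM.
Qed.

Lemma finite_rank_translate k (f : mx -> C) : regular_on_GL f ->
  finite_rank (fun t : C => t != 0) (fun h : mx => h \in unitmx)
    (fun t h => f (h *m scale_at k t)).
Proof.
move=> [P fP]; pose Q (phi : C * mx -> C) :=
  finite_rank (fun t : C => t != 0) (fun h => h \in unitmx) (fun t h => phi (t, h)).
have Qring : ring_closed Q by exact: finite_rank_ring.
have [Qc _ QM] := Qring.
have Ql (a : C -> C) : Q (fun th => a th.1) by exact: (finite_rank_l _ _ a).
have Qr (a : mx -> C) : Q (fun th => a th.2) by exact: (finite_rank_r _ _ a).
pose E (th : C * mx) i := row_mx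
  (mxvec (\matrix_(a, b) ((if b == k then th.1 else 1) * th.2 a b)))
  (th.1^-1 * (\det th.2)^-1)%:M 0 i.
have QE i : Q (E^~ i).
  rewrite /E; case: (split_ordP i) => j ->.
    case/mxvec_indexP: j => a b; under eq_fun do rewrite row_mxEl mxvecE mxE.
    exact: (QM _ _ (Ql (fun t => if b == k then t else 1)) (Qr (fun h => h a b))).
  rewrite [j]ord1; under eq_fun do rewrite row_mxEr mxE eqxx mulr1n.
  exact: (QM _ _ (Ql GRing.inv) (Qr (fun h => (\det h)^-1))).
suff QP : Q (fun th => mpoly.meval (E th) P).
  apply: finite_rank_eq QP _ => t h t0 hU.
  rewrite fP ?unitmx_mul ?hU ?scale_at_unit//; apply: mpoly.meval_eq => i.
  rewrite /E det_mulmx det_scale_at invfM mulrC; congr (row_mx (mxvec _) _ 0 i).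
  by apply/matrixP => a b; rewrite mul_mx_diag !mxE mulrC.
under eq_fun do rewrite mpoly.mevalE.
apply: (closed_sum Qring) => m _; apply: (QM _ _ (Qc _)).
by apply: (closed_prod Qring) => i _; exact: (closedX Qring).
Qed.

(** The kernel [f (h *m scale_at k t)] in [t] and [h] has finite rank, so its inner
    product with [f'] is a combination of finitely many of its values
    [f (h_j *m scale_at k t)]. *)
Lemma laurent_ip k f f' : regcov f -> regcov f' ->
  laurent (fun t => ip p (fun h => f (h *m scale_at k t)) f').
Proof.
move=> rf rf'.
have [r [ts [hs [N [ts0 hsU fE]]]]] := finite_rank_reproducing (finite_rank_translate k rf.1).
have rts i : regcov (fun h => f (h *m scale_at k (ts i))).
  by apply: regular_covariant_translate => //; rewrite scale_at_unit.
apply: (@laurent_eq _ (fun t => \sum_i \sum_j f (hs j *m scale_at k t) *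
    (N j i * ip p (fun h => f (h *m scale_at k (ts i))) f'))).
  apply: laurent_sum => i; apply: laurent_sum => j; apply: laurentM; last exact: laurent_cst.
  by apply: laurent_translate => //; exact: rf.1.
move=> t t0.
transitivity (ip p (fun h => \sum_i \sum_j f (hs j *m scale_at k t) * N j i *
    f (h *m scale_at k (ts i))) f').
  by apply: eq_ip => // h hU; rewrite fE.
rewrite ip_sum//; last by move=> i; apply: regular_covariant_sum => j; exact: regular_covariantZ.
apply: eq_bigr => i _; rewrite ip_sum//; last by move=> j; exact: regular_covariantZ.
by apply: eq_bigr => j _; rewrite ipZ// mulrA.
Qed.

(** Both sides are Laurent polynomials in [t], and on the unit circle the
    matrix is unitary. *)
Lemma has_adjoint_scale_at k t : t != 0 -> has_adjoint (scale_at k t).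
Proof.
move=> t0; split; first by rewrite scale_at_unit.
move=> f f' rf rf'; move: t t0; apply: laurent_circle_eq; first exact: laurent_ip.
  apply: laurent_eq (laurent_conj (laurent_ip k rf' rf)) _ => t t0.
  rewrite hc_scale_at ip_conj//; apply: regular_covariant_translate => //.
  by rewrite scale_at_unit conjc_eq0.
move=> t tt; have [|_] := @has_adjoint_unitary (scale_at k t); last exact.
by rewrite hc_scale_at scale_atM tt scale_at1.
Qed.

Lemma has_adjoint_diag (d : 'rV[C]_n) : (forall j, d 0 j != 0) -> has_adjoint (diag_mx d).
Proof.
move=> d0; have H m : has_adjoint (diag_mx (\row_(j < n) if (j < m)%N then d 0 j else 1)).
  elim: m => [|m IH].
    apply: has_adjoint_unitary.
    have -> : diag_mx (\row_(j < n) if (j < 0)%N then d 0 j else 1) = 1%:M :> mx.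
      by apply/matrixP => i j; rewrite !mxE.
    by rewrite mul1mx; apply/matrixP => i j; rewrite hcE !mxE rmorph_nat [j == i]eq_sym.
  have [mn|nm] := ltnP m n; last first.
    congr has_adjoint: IH; congr diag_mx; apply/rowP => j; rewrite !mxE.
    by rewrite (leq_trans (ltn_ord j)) // (leq_trans (ltn_ord j)) // (leq_trans nm).
  have := has_adjointM IH (has_adjoint_scale_at (Ordinal mn) (d0 (Ordinal mn))).
  congr has_adjoint; rewrite mulmx_diag; congr diag_mx; apply/rowP => j; rewrite !mxE.
  rewrite ltnS [(j <= m)%N]leq_eqVlt -val_eqE /=; case: eqP => [jm|_]; rewrite ?mulr1//.
  by rewrite jm ltnn mul1r; congr (d 0 _); apply/val_inj.
have := H n; congr has_adjoint; congr diag_mx; apply/rowP => j.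
by rewrite mxE ltn_ord.
Qed.

(** Singular value decomposition reduces the claim to unitary and diagonal [g]. *)
Lemma has_adjoint_unitmx (g : mx) : g \in unitmx -> has_adjoint g.
Proof.
move=> gU; pose A := g *m hc g.
have hcT m (M : 'M[C]_(m, n)) : (map_mx Num.conj M^T) = hc M by apply/matrixP => i j; rewrite !mxE.
have AN : A \is normalmx.
  by apply/normalmxP; rewrite hcT /A hcM hcK.
have [P [D [PU AE]]] : exists P (D : 'rV[C]_n), P *m hc P = 1%:M /\ A = hc P *m diag_mx D *m P.
  exists (spectralmx A), (spectral_diag A).
  have PU := spectral_unitarymx A; split; first by rewrite -hcT; exact/unitarymxP.
  by rewrite -hcT -(invmx_unitary PU); exact: (orthomx_spectralP AN).
pose B := P *m g; have BE : B *m hc B = diag_mx D.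
  rewrite /B hcM mulmxA -[P *m g *m _]mulmxA -/A AE !mulmxA PU mul1mx -mulmxA PU.
  exact: mulmx1.
have [PP' P'U] := mulmx1_unit PU; have BU : B \in unitmx by rewrite unitmx_mul PP'.
pose s i : R := \sum_k nrm2 (B i k).
have DE i : D 0 i = (s i)%:C.
  have := congr1 (fun M : mx => M i i) BE; rewrite !mxE eqxx mulr1n => <-.
  by rewrite rmorph_sum; apply: eq_bigr => k _; rewrite hcE /= nrm2E.
have D0 i : D 0 i != 0.
  have : diag_mx D \in unitmx by rewrite -BE unitmx_mul BU hc_unit.
  rewrite unitmxE det_diag unitfE => /prodf_neq0; exact.
have s0 i : 0 < s i.
  rewrite lt_def sumr_ge0 ?andbT => [|k _]; last exact: nrm2_ge0.
  by have := D0 i; rewrite DE; apply: contra => /eqP ->.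
pose d : 'rV[C]_n := \row_i (Num.sqrt (s i))%:C.
pose d' : 'rV[C]_n := \row_i ((Num.sqrt (s i))^-1)%:C.
have sq0 i : Num.sqrt (s i) != 0 by rewrite gt_eqF// sqrtr_gt0.
have hd' : hc (diag_mx d') = diag_mx d'.
  apply/matrixP => i j; rewrite hcE !mxE [j == i]eq_sym; have [->|_] := eqVneq i j.
    by rewrite !mulr1n; exact: conjc_real.
  by rewrite !mulr0n; exact: conjc0.
have uu : (diag_mx d' *m B) *m hc (diag_mx d' *m B) = 1%:M.
  rewrite hcM mulmxA -[_ *m B *m _]mulmxA BE hd' !mulmx_diag.
  apply/matrixP => i j; rewrite !mxE DE -!rmorphM /=.
  suff -> : (Num.sqrt (s i))^-1 * s i / Num.sqrt (s i) = 1 by [].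
  by rewrite -[X in _ * X / _](sqr_sqrtr (ltW (s0 i))) expr2 mulKf// mulfV.
have dd : diag_mx d *m (diag_mx d' *m B) = B.
  rewrite mulmxA mulmx_diag.
  have -> : diag_mx (\row_j (d 0 j * d' 0 j)) = 1%:M.
    by apply/matrixP => i j; rewrite !mxE -rmorphM divff.
  exact: mul1mx.
have -> : g = hc P *m (diag_mx d *m (diag_mx d' *m B)).
  by rewrite dd /B mulmxA (mulmx1C PU) mul1mx.
apply: has_adjointM; first by apply: has_adjoint_unitary; rewrite hcK (mulmx1C PU).
apply: has_adjointM; last exact: has_adjoint_unitary.
by apply: has_adjoint_diag => i; rewrite mxE fmorph_eq0.
Qed.

End Adjoint.

(** * The kernel on GL(n+1) x GL(n) *)

Lemma prod_ltS (K : fieldType) n (F : 'I_n -> K) (i : 'I_n) :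
  \prod_(j < n | (j < i.+1)%N) F j = \prod_(j < n | (j < i)%N) F j * F i.
Proof.
rewrite (bigD1 i)//= mulrC; congr (_ * _); apply: eq_bigl => j.
by rewrite ltnS [(j < i)%N]ltn_neqAle andbC.
Qed.

Lemma prod_geS (K : fieldType) n (F : 'I_n -> K) (i : 'I_n) :
  \prod_(j < n | (i <= j)%N) F j = \prod_(j < n | (i.+1 <= j)%N) F j * F i.
Proof.
rewrite (bigD1 i)//= mulrC; congr (_ * _); apply: eq_bigl => j.
by rewrite [(i < j)%N]ltn_neqAle andbC eq_sym.
Qed.

Section LeadingMinors.
Context (K : fieldType) (n : nat) (b : 'M[K]_n).
Hypotheses (bt : is_trig_mx b) (bU : b \in unitmx).

Local Notation minor m := (\det (corner m m b)).

Lemma minor0 : minor 0 = 1.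
Proof. exact: det_mx00. Qed.

Lemma minorS (i : 'I_n) : minor i.+1 = minor i * b i i.
Proof.
by rewrite !det_corner_trig ?prod_ltS//; exact: ltnW.
Qed.

Lemma minor_neq0 m : (m <= n)%N -> minor m != 0.
Proof.
move=> mn; rewrite det_corner_trig//; apply/prodf_neq0 => i _.
by move: bU; rewrite unitmxE (det_trig bt) unitfE => /prodf_neq0; exact.
Qed.

(** Summation by parts for the exponents of the leading minors. *)
Lemma minor_abel (q : seq int) : size q = n ->
  \prod_(a < n.+1) minor a ^ ((0 :: q)`_a - q`_a) = \prod_(j < n) b j j ^ q`_j.
Proof.
move=> sq; have H m : (m <= n)%N -> \prod_(a < m.+1) minor a ^ ((0 :: q)`_a - q`_a) =
    (\prod_(j < n | (j < m)%N) b j j ^ q`_j) * minor m ^ (- q`_m).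
  elim: m => [|m IH] mn.
    by rewrite big_ord1 big_pred0// mul1r minor0 !exp1rz.
  rewrite big_ord_recr /= IH; last exact: ltnW.
  rewrite (prod_ltS _ (Ordinal mn)) -!mulrA; congr (_ * _).
  rewrite expfzDr ?minor_neq0// (minorS (Ordinal mn)) /=.
  have m0 := minor_neq0 (ltnW mn).
  by rewrite [X in _ * (X * _)]expfzMl -!mulrA mulrA -expfzDr// addNr expr0z mul1r.
rewrite H// [X in _ * _ ^ (- X)]nth_default ?sq// oppr0 expr0z mulr1.
by apply: eq_bigl => j; exact: ltn_ord.
Qed.

End LeadingMinors.

Section Kernel.
Context (R : realType) (n : nat).
Local Notation C := R[i].
Variables (p : (n + 1).-tuple int) (q : n.-tuple int).
Implicit Types (h : 'M[C]_(n + 1)) (g k : 'M[C]_n).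

Definition PhiGL h g a : C :=
  \det (stack (corner (n + 1 - a) (n + 1) h) (corner a (n + 1) (row_mx g (0 : 'cV_n)))).

Definition PsiGL h g a : C := \det (stack (corner (n - a) n (lsubmx h)) (corner a n g)).

Definition Phi_exp a : int := p`_(n - a) + (0 :: (q : seq int))`_a.
Definition Psi_exp a : int := - p`_(n - a) - q`_a.

(** The end factors, [PhiGL h g 0 = \det h] and [PsiGL h g n = \det g], and
    [PsiGL h g 0], a leading minor of [h], are 1 on unipotent matrices. *)
Definition kernel h g : C :=
  \prod_(a < n.+1) (PhiGL h g a ^ Phi_exp a * PsiGL h g a ^ Psi_exp a).

Lemma exp_sum a : Phi_exp a + Psi_exp a = (0 :: (q : seq int))`_a - q`_a.
Proof. by rewrite /Phi_exp /Psi_exp addrACA subrr add0r. Qed.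

(** All transformation rules of the kernel follow from those of the minors. *)
Lemma kernel_scale h h' g g' (u v : nat -> C) :
  (forall a, (a <= n)%N -> PhiGL h' g' a = u a * PhiGL h g a) ->
  (forall a, (a <= n)%N -> PsiGL h' g' a = v a * PsiGL h g a) ->
  kernel h' g' = \prod_(a < n.+1) (u a ^ Phi_exp a * v a ^ Psi_exp a) * kernel h g.
Proof.
move=> uE vE; rewrite /kernel -big_split; apply: eq_bigr => a _ /=.
have an : (a <= n)%N by rewrite -ltnS.
by rewrite uE// vE// !expfzMl mulrACA.
Qed.

Lemma PhiGL_mull b h g a : is_trig_mx b -> (a <= n)%N ->
  PhiGL (b *m h) g a = \det (corner (n + 1 - a) (n + 1 - a) b) * PhiGL h g a.
Proof.
move=> bt an; rewrite /PhiGL corner_mull ?leq_subr//.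
rewrite -[X in stack _ X]mul1mx stackM ?det1 ?mulr1 ?mul1mx//.
by rewrite subnK// (leq_trans an)// leq_addr.
Qed.

Lemma PhiGL_mulr b h g a : is_trig_mx b -> (a <= n)%N ->
  PhiGL h (b *m g) a = \det (corner a a b) * PhiGL h g a.
Proof.
move=> bt an; rewrite /PhiGL -[X in row_mx _ X](mulmx0 _ b) -mul_mx_row.
rewrite corner_mull// -[X in stack X _]mul1mx stackM ?det1 ?mul1r ?mul1mx//.
by rewrite subnK// (leq_trans an)// leq_addr.
Qed.

Lemma PsiGL_mull b h g a : is_trig_mx b -> (a <= n)%N ->
  PsiGL (b *m h) g a = \det (corner (n - a) (n - a) b) * PsiGL h g a.
Proof.
move=> bt an; rewrite /PsiGL.
have -> : lsubmx (b *m h) = b *m lsubmx h.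
  by rewrite -[in LHS](hsubmxK h) mul_mx_row row_mxKl.
rewrite corner_mull ?leq_subr//; last by rewrite (leq_trans (leq_subr _ _))// leq_addr.
by rewrite -[X in stack _ X]mul1mx stackM ?det1 ?mulr1 ?mul1mx// subnK.
Qed.

Lemma PsiGL_mulr b h g a : is_trig_mx b -> (a <= n)%N ->
  PsiGL h (b *m g) a = \det (corner a a b) * PsiGL h g a.
Proof.
move=> bt an; rewrite /PsiGL corner_mull//.
by rewrite -[X in stack X _]mul1mx stackM ?det1 ?mul1r ?mul1mx// subnK.
Qed.

Lemma PhiGL_translate h g k a : (a <= n)%N ->
  PhiGL (h *m embed_GL k) (g *m k) a = \det k * PhiGL h g a.
Proof.
move=> an; rewrite /PhiGL.
have -> : row_mx (g *m k) 0 = row_mx g (0 : 'cV_n) *m embed_GL k.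
  by rewrite mul_row_block !mul0mx mulmx0 !addr0.
rewrite !corner_mulr ?leq_subr// stack_mulr; last first.
  by rewrite subnK// (leq_trans an)// leq_addr.
by rewrite det_mulmx mulrC det_ublock det1 mulr1.
Qed.

Lemma PsiGL_translate h g k a : (a <= n)%N ->
  PsiGL (h *m embed_GL k) (g *m k) a = \det k * PsiGL h g a.
Proof.
move=> an; rewrite /PsiGL.
have -> : lsubmx (h *m embed_GL k) = lsubmx h *m k.
  by rewrite -[in LHS](hsubmxK h) mul_row_block mulmx0 addr0 row_mxKl.
rewrite !corner_mulr//; last by rewrite (leq_trans (leq_subr _ _))// leq_addr.
by rewrite stack_mulr ?subnK// det_mulmx mulrC.
Qed.

(** All minors are multiplied by [\det k], and the exponents sum to 0. *)
Lemma kernel_translate h g k : k \in unitmx ->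
  kernel (h *m embed_GL k) (g *m k) = kernel h g.
Proof.
move=> kU; have k0 : \det k != 0 by rewrite -unitfE -unitmxE.
rewrite (@kernel_scale h _ g _ (fun=> \det k) (fun=> \det k)); last 2 first.
- by move=> a an; exact: PhiGL_translate.
- by move=> a an; exact: PsiGL_translate.
suff -> : \prod_(a < n.+1) (\det k ^ Phi_exp a * \det k ^ Psi_exp a) = 1 by rewrite mul1r.
have H m : \prod_(a < m.+1) (\det k ^ Phi_exp a * \det k ^ Psi_exp a) = \det k ^ (- q`_m).
  elim: m => [|m IH].
    by rewrite big_ord1 -expfzDr// exp_sum /= sub0r.
  by rewrite big_ord_recr /= IH -expfzDr// exp_sum -expfzDr//=; rewrite addrA addNr add0r.
by rewrite H nth_default ?size_tuple// oppr0 expr0z.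
Qed.

Lemma kernel_covariant_r h : covariant q (kernel h).
Proof.
move=> b g [bt bU] gU.
rewrite (@kernel_scale h _ g _ (fun a => \det (corner a a b)) (fun a => \det (corner a a b))).
- congr (_ * _); rewrite -(minor_abel bt bU (size_tuple q)); apply: eq_bigr => a _.
  by rewrite -expfzDr ?exp_sum// (minor_neq0 bt bU)// -ltnS.
- by move=> a an; exact: PhiGL_mulr.
- by move=> a an; exact: PsiGL_mulr.
Qed.

Lemma kernel_covariant_l g : covariant p (kernel^~ g).
Proof.
move=> b h [bt bU] hU; pose D m : C := \det (corner m m b).
rewrite (@kernel_scale h _ g _ (fun a => D (n + 1 - a)%N) (fun a => D (n - a)%N)); last 2 first.
- by move=> a an; exact: PhiGL_mull.
- by move=> a an; exact: PsiGL_mull.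
congr (_ * _).
have D0 m : (m <= n)%N -> D m != 0.
  by move=> mn; apply: minor_neq0; rewrite // (leq_trans mn)// leq_addr.
have DS (i : 'I_(n + 1)) : D i.+1 = D i * b i i by exact: minorS.
have b0 (i : 'I_(n + 1)) : b i i != 0.
  by move: bU; rewrite unitmxE (det_trig bt) unitfE => /prodf_neq0; exact.
have step (e e' : int) (i : 'I_(n + 1)) : (i <= n)%N ->
    D i.+1 ^ (- e) * (D i.+1 ^ (p`_i + e) * D i ^ (- p`_i - e')) = b i i ^ p`_i * D i ^ (- e').
  move=> i_n; have x0 := D0 i i_n; have y0 : D i.+1 != 0 by rewrite DS mulf_neq0.
  rewrite mulrA -expfzDr// DS addrCA addNr addr0.
  by rewrite expfzMl -mulrA mulrCA -expfzDr// addNKr.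
have H m : (m <= n)%N -> \prod_(a < m.+1) (D (n + 1 - a)%N ^ Phi_exp a * D (n - a)%N ^ Psi_exp a)
   = (\prod_(j < n + 1 | (n - m <= j)%N) b j j ^ p`_j) * D (n - m)%N ^ (- q`_m).
  elim: m => [|m IH] mn.
    have nn : (n < n + 1)%N by rewrite addn1.
    rewrite big_ord1 !subn0 (prod_geS _ (Ordinal nn)) big_pred0; last first.
      by move=> j; apply/negbTE; rewrite -leqNgt -ltnS -(addn1 n) ltn_ord.
    have := step 0 q`_0 (Ordinal nn) (leqnn n).
    by rewrite oppr0 expr0z !mul1r /= (congr1 D (addn1 n)) /Phi_exp /Psi_exp /= subn0.
  have im : (n - m.+1 < n + 1)%N by rewrite addn1 ltnS leq_subr.
  rewrite big_ord_recr /= IH ?(ltnW mn)// (prod_geS _ (Ordinal im)) /=.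
  have Sm : (n - m.+1).+1 = (n - m)%N by rewrite subnSK.
  rewrite -!mulrA Sm; congr (_ * _).
  have := step q`_m q`_m.+1 (Ordinal im) (leq_subr _ _).
  have -> : (n + 1 - m.+1)%N = (n - m)%N by rewrite addn1 subSS.
  by rewrite /= Sm /Phi_exp /Psi_exp.
rewrite H// [X in _ * _ ^ (- X)]nth_default ?size_tuple// oppr0 expr0z mulr1.
by apply: eq_bigl => j; rewrite subnn.
Qed.

End Kernel.

Section KernelRegular.
Context (R : realType) (n : nat).
Local Notation C := R[i].
Variables (p : (n + 1).-tuple int) (q : n.-tuple int).
Hypothesis pq : interlacing p (dual_sig q).
Implicit Types (h : 'M[C]_(n + 1)) (g k : 'M[C]_n).

Lemma dual_sigE j : (j < n)%N -> (dual_sig q)`_j = - q`_(n - j.+1).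
Proof.
by move=> jn; rewrite /dual_sig /= (nth_map 0) ?size_rev ?size_tuple// nth_rev size_tuple.
Qed.

Lemma Phi_exp_ge0 a : (0 < a <= n)%N -> 0 <= Phi_exp p q a.
Proof.
case: a => // a /andP[_ an]; have jn : (n - a.+1 < n)%N by rewrite ltn_subrL (leq_trans _ an).
have := pq jn; rewrite dual_sigE// subnSK// subKn 1?ltnW// => /andP[_].
by rewrite /Phi_exp /= lerNl -subr_ge0 opprK addrC.
Qed.

Lemma Psi_exp_ge0 a : (a < n)%N -> 0 <= Psi_exp p q a.
Proof.
move=> an; have jn : (n - a.+1 < n)%N by rewrite ltn_subrL (leq_trans _ an).
have := pq jn; rewrite dual_sigE// subnSK// subKn 1?ltnW// => /andP[+ _].
by rewrite /Psi_exp /= -subr_ge0 addrC.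
Qed.

Lemma PhiGL0 h g : PhiGL h g 0 = \det h.
Proof.
congr determinant; apply/matrixP => i j; have i0 : (i < n + 1 - 0)%N by rewrite subn0.
by rewrite (stack_top _ _ (i := Ordinal i0)) ?subn0 ?addn0//; exact: cornerE.
Qed.

Lemma PsiGLn h g : PsiGL h g n = \det g.
Proof.
congr determinant; apply/matrixP => i j.
by rewrite (stack_bottom _ _ (i := i)) ?subnn//; exact: cornerE.
Qed.

Lemma PsiGL0 h g : is_unipotent h -> PsiGL h g 0 = 1.
Proof.
move=> /forallP hP; apply: unipotent_det; apply/forallP => i; apply/forallP => j.
have i0 : (i < n - 0)%N by rewrite subn0.
rewrite (stack_top _ _ (i := Ordinal i0)) ?subn0 ?addn0//.
rewrite (cornerE _ (i' := lshift 1 i) (j' := j))// mxE.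
have /forallP/(_ (lshift 1 j)) := hP (lshift 1 i).
by rewrite (inj_eq (@lshift_inj _ _)).
Qed.

Let Phi_size a : (a <= n)%N -> (n + 1 - a + a = n + 1)%N.
Proof. by move=> an; rewrite subnK// (leq_trans an)// leq_addr. Qed.

Lemma PhiGL_entry (T : Type) (Q : (T -> C) -> Prop) (M : T -> 'M[C]_(n + 1))
    (N : T -> 'M[C]_n) a : (a <= n)%N -> Q (fun=> 0) ->
  (forall i j, Q (fun t => M t i j)) -> (forall i j, Q (fun t => N t i j)) ->
  forall i j, Q (fun t => stack (corner (n + 1 - a) (n + 1) (M t))
    (corner a (n + 1) (row_mx (N t) (0 : 'cV_n))) i j).
Proof.
move=> an Q0 QM QN; apply: stack_closed; rewrite ?Phi_size//; first exact: corner_closed.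
apply: corner_closed => // i j; case: (split_ordP j) => j' ->.
  by under eq_fun do rewrite row_mxEl.
by under eq_fun do rewrite row_mxEr mxE.
Qed.

Lemma PsiGL_entry (T : Type) (Q : (T -> C) -> Prop) (M : T -> 'M[C]_(n + 1))
    (N : T -> 'M[C]_n) a : (a <= n)%N -> Q (fun=> 0) ->
  (forall i j, Q (fun t => M t i j)) -> (forall i j, Q (fun t => N t i j)) ->
  forall i j, Q (fun t => stack (corner (n - a) n (lsubmx (M t))) (corner a n (N t)) i j).
Proof.
move=> an Q0 QM QN; apply: stack_closed; rewrite ?subnK//; last exact: corner_closed.
by apply: corner_closed => // i j; under eq_fun do rewrite mxE.
Qed.

(** Interlacing makes the exponents of all minors nonnegative, except for the
    factors [\det h] and [\det g], which are invertible. *)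
Lemma kernel_closed (T : Type) (Q : (T -> C) -> Prop) (M : T -> 'M[C]_(n + 1))
    (N : T -> 'M[C]_n) : ring_closed Q ->
  (forall i j, Q (fun t => M t i j)) -> (forall i j, Q (fun t => N t i j)) ->
  (forall e : int, Q (fun t => \det (M t) ^ e)) ->
  (forall e : int, Q (fun t => \det (N t) ^ e)) ->
  Q (fun t => kernel p q (M t) (N t)).
Proof.
move=> Qring QM QN QdM QdN; have [Qc _ Qmul] := Qring.
apply: (closed_prod Qring) => a _; have an : (a <= n)%N by rewrite -ltnS.
apply: Qmul.
  have [a0|a0] := posnP a; first by under eq_fun do rewrite a0 PhiGL0.
  have := @Phi_exp_ge0 a; rewrite a0 an => /(_ isT); case: (Phi_exp p q a) => // m _.
  by apply: (closedX Qring); apply: (closed_det Qring); exact: PhiGL_entry.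
have [an'|na] := ltnP a n; last first.
  have -> : a = n :> nat by apply/eqP; rewrite eqn_leq an.
  by under eq_fun do rewrite PsiGLn.
have := Psi_exp_ge0 an'; case: (Psi_exp p q a) => // m _.
by apply: (closedX Qring); apply: (closed_det Qring); exact: PsiGL_entry.
Qed.

Lemma kernel_regular_l g : regular_on_GL (kernel p q ^~ g).
Proof.
apply: (@kernel_closed _ (@regular_on_GL C (n + 1)) id (fun=> g)).
- exact: regular_ring.
- exact: regular_entry.
- by move=> i j; exact: regular_cst.
- exact: regular_detXz.
- by move=> e; exact: regular_cst.
Qed.

Lemma kernel_regular_r h : regular_on_GL (kernel p q h).
Proof.
apply: (@kernel_closed _ (@regular_on_GL C n) (fun=> h) id).
- exact: regular_ring.
- by move=> i j; exact: regular_cst.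
- exact: regular_entry.
- by move=> e; exact: regular_cst.
- exact: regular_detXz.
Qed.

Lemma kernel_finite_rank : finite_rank (fun h => h \in unitmx) (fun g => g \in unitmx)
  (kernel p q).
Proof.
pose Q (phi : 'M[C]_(n + 1) * 'M[C]_n -> C) :=
  finite_rank (fun h => h \in unitmx) (fun g => g \in unitmx) (fun h g => phi (h, g)).
apply: (@kernel_closed _ Q fst snd).
- exact: finite_rank_ring.
- by move=> i j; exact: (finite_rank_l _ _ (fun h => h i j)).
- by move=> i j; exact: (finite_rank_r _ _ (fun g => g i j)).
- by move=> e; exact: (finite_rank_l _ _ (fun h => \det h ^ e)).
- by move=> e; exact: (finite_rank_r _ _ (fun g => \det g ^ e)).
Qed.

Lemma kernel_L (U : Nplus R n) (Z : Nplus R (n + 1)) : (0 < n)%N ->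
  L p q U Z = kernel p q (val Z) (val U).
Proof.
move=> n0; rewrite /kernel big_split /=; congr (_ * _).
  rewrite -(big_mkord xpredT (fun a => PhiGL (val Z) (val U) a ^ Phi_exp p q a)).
  rewrite [RHS]big_ltn// PhiGL0 (unipotent_det (valP Z)) exp1rz mul1r.
  by apply: eq_big_nat => -[].
rewrite -(big_mkord xpredT (fun a => PsiGL (val Z) (val U) a ^ Psi_exp p q a)).
rewrite [RHS]big_ltn// PsiGL0 ?(valP Z)// exp1rz mul1r big_nat_recr//=.
by rewrite PsiGLn (unipotent_det (valP U)) exp1rz mulr1.
Qed.

End KernelRegular.

Section NonzeroPoint.
Context (R : realType) (n : nat).
Local Notation C := R[i].

Let h0 : 'M[C]_(n + 1) := block_mx 1%:M (const_mx 1) 0 1%:M.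
Let g0 : 'M[C]_n := \matrix_(i, j) (j == rev_ord i)%:R.

Lemma det_neq0 m (M : 'M[C]_m) :
  (forall v : 'I_m -> C, (forall i, \sum_j M i j * v j = 0) -> forall j, v j = 0) ->
  \det M != 0.
Proof.
move=> inj; rewrite -det_tr; apply/det0P => -[v v0 vM]; case/eqP: v0.
apply/rowP => j; rewrite mxE; apply: inj => i.
have := congr1 (fun w : 'rV_m => w 0 i) vM; rewrite !mxE => E.
by apply: (etrans _ E); apply: eq_bigr => k _; rewrite mxE mulrC.
Qed.

Lemma PhiGL_point a : (a <= n)%N -> PhiGL h0 g0 a != 0.
Proof.
move=> an; have e : (n + 1 - a + a = n + 1)%N by rewrite subnK// (leq_trans an)// leq_addr.
apply: det_neq0 => v; set M := stack _ _ => Mv.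
have top (i : 'I_(n + 1)) : (i < n + 1 - a)%N -> \sum_j h0 i j * v j = 0.
  move=> ia; rewrite -[RHS](Mv i); apply: eq_bigr => j _.
  by rewrite (stack_top _ _ (i := Ordinal ia))// (cornerE _ (i' := i) (j' := j)).
have topl (i : 'I_n) : (i < n + 1 - a)%N -> v (lshift 1 i) + v (rshift n 0) = 0.
  move=> ia; rewrite -[RHS](top (lshift 1 i))// big_split_ord /= big_ord1.
  rewrite block_mxEur mxE mul1r; congr (_ + _); rewrite (bigD1 i)//= big1 ?addr0.
    by rewrite block_mxEul mxE eqxx mul1r.
  by move=> j ji; rewrite block_mxEul mxE eq_sym (negbTE ji) mul0r.
have bot (i : 'I_n) : (i < a)%N -> v (lshift 1 (rev_ord i)) = 0.
  move=> ia; have ri : (n + 1 - a + i < n + 1)%N by rewrite -[X in (_ < X)%N]e ltn_add2l.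
  rewrite -[RHS](Mv (Ordinal ri)).
  rewrite -[LHS]mul1r [RHS](bigD1 (lshift 1 (rev_ord i)))//= big1 ?addr0.
    rewrite (stack_bottom _ _ (i := Ordinal ia))//.
    by rewrite (cornerE _ (i' := i) (j' := lshift 1 (rev_ord i)))// row_mxEl mxE eqxx.
  move=> j ji; rewrite (stack_bottom _ _ (i := Ordinal ia))//.
  rewrite (cornerE _ (i' := i) (j' := j))//; case: (split_ordP j) ji => j' -> ji.
    by rewrite row_mxEl mxE -(inj_eq (@lshift_inj _ 1)) (negbTE ji) mul0r.
  by rewrite row_mxEr mxE mul0r.
have v2 : v (rshift n 0) = 0.
  have [a0|a0] := posnP a.
    have := top (rshift n 0); rewrite a0 subn0 ltn_ord => /(_ isT).
    rewrite big_split_ord /= big_ord1 block_mxEdr mxE eqxx mul1r big1 ?add0r//.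
    by move=> j _; rewrite block_mxEdl mxE mul0r.
  have ia : (a.-1 < n)%N by rewrite prednK.
  have b := bot (Ordinal ia); rewrite /= prednK// leqnn in b.
  rewrite -[RHS](topl (rev_ord (Ordinal ia))) ?b ?add0r//= prednK//.
  by rewrite ltn_sub2r ?addn1// ltnS.
have v1 (i : 'I_n) : v (lshift 1 i) = 0.
  have [ia|ai] := ltnP i (n + 1 - a); first by have := topl i ia; rewrite v2 addr0.
  rewrite -(rev_ordK i); apply: bot => /=; rewrite ltn_subLR ?ltn_ord//.
  by move: ai; rewrite leq_subLR addn1 addnC addSn ltnS => /ltnW.
by move=> j; case: (split_ordP j) => j' -> //; rewrite [j']ord1.
Qed.

Lemma PsiGL_point a : (a <= n)%N -> PsiGL h0 g0 a != 0.
Proof.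
move=> an; have e : (n - a + a = n)%N by rewrite subnK.
apply: det_neq0 => v; set M := stack _ _ => Mv i.
have [ia|ai] := ltnP i (n - a).
  rewrite -[RHS](Mv i) -[LHS]mul1r [RHS](bigD1 i)//= big1 ?addr0.
    rewrite (stack_top _ _ (i := Ordinal ia))// (cornerE _ (i' := lshift 1 i) (j' := i))//.
    by rewrite mxE block_mxEul mxE eqxx.
  move=> j ji; rewrite (stack_top _ _ (i := Ordinal ia))//.
  rewrite (cornerE _ (i' := lshift 1 i) (j' := j))// mxE block_mxEul mxE.
  by rewrite eq_sym (negbTE ji) mul0r.
have ra : (rev_ord i < a)%N.
  by rewrite /= ltn_subLR ?ltn_ord// addSn ltnS addnC -leq_subLR.
have ri : (n - a + rev_ord i < n)%N by rewrite -[X in (_ < X)%N]e ltn_add2l.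
rewrite -[RHS](Mv (Ordinal ri)) -[LHS]mul1r [RHS](bigD1 i)//= big1 ?addr0.
  rewrite (stack_bottom _ _ (i := Ordinal ra))//.
  by rewrite (cornerE _ (i' := rev_ord i) (j' := i))// mxE rev_ordK eqxx.
move=> j ji; rewrite (stack_bottom _ _ (i := Ordinal ra))//.
by rewrite (cornerE _ (i' := rev_ord i) (j' := j))// mxE rev_ordK (negbTE ji) mul0r.
Qed.

(** Let [g] have the rows [e_n, ..., e_1] and [h] the rows [e_i + e_(n+1)], for
    [i <= n], and [e_(n+1)]. Then the stacked rows are linearly independent in each
    [Phi] and [Psi]. *)
Lemma kernel_neq0 (p : (n + 1).-tuple int) (q : n.-tuple int) :
  exists h g, [/\ h \in unitmx, g \in unitmx & kernel p q h g != 0 :> C].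
Proof.
exists h0, g0; split.
- by rewrite unitmxE -(PhiGL0 h0 g0) unitfE PhiGL_point.
- by rewrite unitmxE -(PsiGLn h0 g0) unitfE PsiGL_point.
apply/prodf_neq0 => a _; have an : (a <= n)%N by rewrite -ltnS.
by rewrite mulf_neq0// expfz_neq0// ?PhiGL_point ?PsiGL_point.
Qed.

End NonzeroPoint.

(** * Definiteness of the inner product *)

Lemma lebesgueC_setT (R : realType) : @lebesgueC R setT != 0%E.
Proof.
have l0 : lebesgue_measure (setT : set (measurableTypeR R)) != 0%E.
  rewrite gt_eqF// (@lt_le_trans _ _ (lebesgue_measure `[0%R, 1%R]%classic))//; last first.
    by apply: le_measure => //; exact: mem_set.
  by rewrite lebesgue_measure_itv /= lte_fin ltr01 oppr0 adde0 lte_fin.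
by rewrite -setXTT [lebesgueC _]product_measure1E// mule_neq0.
Qed.

Lemma power_measure_setT (R : realType) m : power_measure (@lebesgueC R) m setT != 0%E.
Proof.
elim: m => [|m IH]; first by rewrite [power_measure _ _ _]diracT oner_neq0.
rewrite -[X in X != _]mul1e -integral_cst// power_measure_tonelli1//.
rewrite (eq_integral (fun=> power_measure (@lebesgueC R) m setT)); last first.
  by move=> x _; rewrite integral_cst// mul1e.
by rewrite integral_cst// mule_neq0// lebesgueC_setT.
Qed.

Section Definite.
Context (R : realType) (n : nat).
Hypothesis n_gt0 : (0 < n)%N.
Local Notation C := R[i].
Local Notation mx := 'M[C]_n.
Variable p : n.-tuple int.
Local Notation regcov := (@regular_covariant R n p).

Lemma separately_poly_regular (f : mx -> C) : regular_on_GL f ->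
  separately_poly (fun x : coords R n => f (coords_mx x)).
Proof.
move=> [P fP] t i.
have /choice[E EP] k : exists e : {poly C}, forall z,
    row_mx (mxvec (coords_mx (upd t i z))) ((\det (coords_mx (upd t i z)))^-1)%:M 0 k = e.[toC z].
  case: (split_ordP k) => k' ->; last first.
    exists 1 => z; rewrite row_mxEr [k']ord1 mxE eqxx mulr1n hornerC.
    by rewrite (unipotent_det (coords_unipotent _)) invr1.
  case/mxvec_indexP: k' => a b; have [e eP] := separately_poly_entry a b t i.
  by exists e => z; rewrite row_mxEl mxvecE eP.
exists (\sum_(m <- mpoly.msupp P) (mpoly.mcoeff m P)%:P * \prod_k E k ^+ mpoly.fun_of_multinom m k) => z.
rewrite fP ?coords_unit// mpoly.mevalE horner_sum; apply: eq_bigr => m _.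
rewrite hornerM hornerC horner_prod; congr (_ * _); apply: eq_bigr => k _.
by rewrite horner_exp EP.
Qed.

(** On unipotent matrices [f] is a polynomial, hence nonzero almost everywhere, and
    the density is positive. *)
Lemma ip_definite_unipotent (f : mx -> C) x0 : regcov f ->
  f (coords_mx x0) != 0 -> ip p f f != 0.
Proof.
move=> rf f0; apply/eqP => ip0.
have ff (x : coords R n) : ip_integrand p f f x =
    (nrm2 (f (coords_mx x)) * density p (of_coords x))%:C.
  by rewrite /ip_integrand -nrm2E -rmorphM.
have [iff _] := ip_integrable n_gt0 rf rf.
pose phi x : R := complex.Re (ip_integrand p f f x).
have phi0 x : 0 <= phi x.
  by rewrite /phi ff /= mulr_ge0 ?nrm2_ge0// ltW// density_gt0.
have int0 : (\int[dZ R n]_x `|(phi x)%:E| = 0)%E.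
  rewrite (eq_integral (EFin \o phi)); last first.
    by move=> x _ /=; rewrite ger0_norm.
  rewrite -(fineK (integrable_fin_num measurableT iff)).
  by have E := congr1 (@complex.Re R) ip0; apply: (congr1 EFin E).
have mphi : measurable_fun setT (EFin \o phi) by exact: measurable_int iff.
have [/(_ int0) [N [mN N0 sub]] _] := ae_eq_integral_abs (dZ R n) measurableT mphi.
pose Z := [set x : coords R n | f (coords_mx x) = 0].
have mf : cmeas (fun x : coords R n => f (coords_mx x)) by exact: cmeas_regular_coords rf.
have Z0 : dZ R n Z = 0%E.
  by apply: (power_measure_zeros mf _ f0); apply: separately_poly_regular; exact: rf.1.
have mZ : measurable Z by exact: measurable_zeros.
have : (dZ R n (setT : set (coords R n)) = 0)%E.
  have -> : setT = N `|` Z :> set (coords R n).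
    apply/seteqP; split=> // x _; have [fx|fx] := eqVneq (f (coords_mx x)) 0; first by right.
    left; apply: sub => /= /(_ Logic.I) /eqP; rewrite eqe /phi ff /= mulf_eq0 nrm2_eq0.
    by rewrite (negbTE fx) gt_eqF// density_gt0.
  by apply: null_set_setU.
by apply/eqP; exact: power_measure_setT.
Qed.

(** If [ip p f f = 0], then [f] vanishes on the unipotent matrices, so that
    [ip p f] is zero. By the adjunction all translates of [f] have norm zero as well,
    hence they also vanish at the identity. *)
Lemma ip_definite (f : mx -> C) h : regcov f -> h \in unitmx -> f h != 0 -> ip p f f != 0.
Proof.
move=> rf hU fh; apply/eqP => ip0.
have fN (x : coords R n) : f (coords_mx x) = 0.
  by apply/eqP/negPn/negP => /(ip_definite_unipotent rf); rewrite ip0 eqxx.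
have rh := regular_covariant_translate hU rf.
have : ip p (fun g => f (g *m h)) (fun g => f (g *m h)) != 0.
  apply: (@ip_definite_unipotent _ (mx_coords (1%:M : mx)) rh).
  rewrite mx_coordsK ?mul1mx//; apply/forallP => i; apply/forallP => j.
  by apply/implyP => _; rewrite mxE.
move=> /eqP; apply; have [_ ->] // := has_adjoint_unitmx n_gt0 p hU.
rewrite -(Cintegral0 (dZ R n)); apply: eq_Cintegral => x.
by rewrite /ip_integrand fN !mul0r.
Qed.

End Definite.

(** * The pairing *)

Lemma rearrange (K : comRingType) (a b c x y d e : K) :
  a * b * c * x * y * (d * e) = b * ((x * a * d) * (y * c * e)).
Proof. ring. Qed.

Lemma linear_middle (K : comRingType) (c a u v w d : K) :
  a * (c * u + v) * w * d = c * (a * u * w * d) + a * v * w * d.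
Proof. ring. Qed.

Lemma linear_last (K : comRingType) (c a u v w d : K) :
  a * w * (c * u + v) * d = c * (a * w * u * d) + a * w * v * d.
Proof. ring. Qed.

Section Pairing.
Context (R : realType) (n : nat).
Hypothesis n_gt0 : (0 < n)%N.
Local Notation C := R[i].
Variables (p : (n + 1).-tuple int) (q : n.-tuple int).
Hypothesis pq : interlacing p (dual_sig q).
Local Notation K := (@kernel R n p q).
Local Notation regp := (@regular_covariant R (n + 1) p).
Local Notation regq := (@regular_covariant R n q).

Let n1_gt0 : (0 < n + 1)%N. Proof. by rewrite addn1. Qed.

Lemma kernel_regcov_l g : regp (K^~ g).
Proof. by split; [exact: kernel_regular_l|exact: kernel_covariant_l]. Qed.

Lemma kernel_regcov_r h : regq (K h).
Proof. by split; [exact: kernel_regular_r|exact: kernel_covariant_r]. Qed.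

(** The intertwining operator with kernel [kernel], an integral over [U]. *)
Definition transform (f' : 'M[C]_n -> C) : 'M[C]_(n + 1) -> C := fun h => ip q (K h) f'.

(** By finite rank, the kernel is a finite sum of products [K (h, g_j) K (h_i, g)] with
    constant coefficients, each of which contributes a product of two inner
    products. *)
Lemma pairing_transform phi psi (f : 'M[C]_(n + 1) -> C) (f' : 'M[C]_n -> C) :
  extends p phi f -> extends q psi f' ->
  [/\ J_converges p q phi psi, regp (transform f') & J p q phi psi = ip p f (transform f')].
Proof.
move=> [rf cf phiE] [rf' cf' psiE].
have Rf : regp f by []. have Rf' : regq f' by [].
have [r [hs [gs [N [hsU gsU KE]]]]] := finite_rank_reproducing (kernel_finite_rank R pq).
have Rl j : regp (K^~ (gs j)) := kernel_regcov_l _.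
have Rr i : regq (K (hs i)) := kernel_regcov_r _.
pose c i j := N j i * ip q (K (hs i)) f'.
have TE h : h \in unitmx -> transform f' h = \sum_i \sum_j c i j * K h (gs j).
  move=> hU; rewrite /transform.
  transitivity (ip q (fun g => \sum_i \sum_j (K h (gs j) * N j i) * K (hs i) g) f').
    by apply: eq_ip => // g gU; rewrite KE.
  rewrite ip_sum//; last first.
    by move=> i; apply: regular_covariant_sum => j; exact: regular_covariantZ.
  apply: eq_bigr => i _; rewrite ip_sum//; last by move=> j; exact: regular_covariantZ.
  by apply: eq_bigr => j _; rewrite ipZ// /c -mulrA mulrC.
have RS : regp (fun h => \sum_i \sum_j c i j * K h (gs j)).
  by apply: regular_covariant_sum => i; apply: regular_covariant_sum => j;
    exact: regular_covariantZ.
have RT : regp (transform f').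
  split; first exact: eq_regular RS.1 TE.
  move=> b h Bb hU; rewrite !TE ?unitmx_mul ?hU ?andbT//; first exact: RS.2.
  by case: Bb.
have conjM3 (u v w : C) : (u * v * w)^* = u^* * v^* * w^*.
  by rewrite rmorphM [X in X * _]rmorphM.
have JE : J_integrand p q phi psi = fun x => \sum_i \sum_j (N j i)^* *
    (ip_integrand p f (K^~ (gs j)) x.1 * ip_integrand q f' (K (hs i)) x.2).
  apply/funext => x; rewrite /J_integrand kernel_L// KE ?unipotent_unitmx//= phiE psiE /=.
  rewrite rmorph_sum !mulr_suml; apply: eq_bigr => i _.
  rewrite rmorph_sum !mulr_suml; apply: eq_bigr => j _.
  apply: (etrans (congr2 *%R (congr1 (fun t => t * _ * _) (conjM3 _ _ _)) (rmorphM _ _ _))).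
  exact: rearrange.
have It i j := Cintegrable_tensor (ip_integrable n1_gt0 Rf (Rl j)) (ip_integrable n_gt0 Rf' (Rr i)).
split=> //.
  rewrite /J_converges JE.
  by apply: Cintegrable_sum => i; apply: Cintegrable_sum => j; exact: CintegrableZ.
rewrite /J JE Cintegral_sum; last first.
  by move=> i; apply: Cintegrable_sum => j; exact: CintegrableZ.
rewrite (ip_conj n1_gt0 RT Rf).
have -> : ip p (transform f') f = \sum_i \sum_j c i j * ip p (K^~ (gs j)) f.
  rewrite (eq_ip p TE (fun g _ => erefl (f g))) ip_sum//; last first.
    by move=> i; apply: regular_covariant_sum => j; exact: regular_covariantZ.
  apply: eq_bigr => i _; rewrite ip_sum//; last by move=> j; exact: regular_covariantZ.
  by apply: eq_bigr => j _; rewrite ipZ.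
rewrite rmorph_sum; apply: eq_bigr => i _.
rewrite Cintegral_sum; last by move=> j; exact: CintegrableZ.
rewrite rmorph_sum; apply: eq_bigr => j _.
rewrite CintegralZ// Cintegral_tensor; try exact: ip_integrable.
apply/esym/(etrans (conjM3 _ _ _)).
apply: (etrans (congr2 *%R (congr1 ( *%R _) (esym (ip_conj n_gt0 (Rr i) Rf')))
  (esym (ip_conj n1_gt0 (Rl j) Rf)))).
exact: (etrans (esym (mulrA _ _ _)) (congr1 ( *%R (N j i)^*)
  (mulrC (ip q f' (K (hs i))) (ip p f (K^~ (gs j)))))).
Qed.

Lemma hc_embed (g : 'M[C]_n) : hc (embed_GL g) = embed_GL (hc g).
Proof.
rewrite /hc /embed_GL map_block_mx tr_block_mx !map_mx0 !trmx0; congr block_mx.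
by rewrite map_mx1 trmx1.
Qed.

Lemma embed_unit (g : 'M[C]_n) : g \in unitmx -> embed_GL g \in unitmx.
Proof. by rewrite !unitmxE det_ublock det1 mulr1. Qed.

(** Move the translation to the kernel by the adjunction and use that the
    kernel is invariant. *)
Lemma transform_translate f' g h : regq f' -> g \in unitmx -> h \in unitmx ->
  transform (fun k => f' (k *m g)) (h *m hc (embed_GL g)) = transform f' h.
Proof.
move=> rf' gU hU; have g'U : hc g \in unitmx by rewrite hc_unit.
have [_ adj] := has_adjoint_unitmx n_gt0 q g'U.
have := adj _ _ (kernel_regcov_r (h *m hc (embed_GL g))) rf'.
rewrite (hcK g) => adj'; apply: (etrans (esym adj')).
by apply: eq_ip => [k kU|//]; rewrite (hc_embed g) (kernel_translate _ _ _ _ g'U).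
Qed.

End Pairing.

Lemma extends_rho (R : realType) n (p : n.-tuple int) (g : 'M[R[i]]_n) phi :
  g \in unitmx -> Vspace p phi ->
  extends p (rho p g phi) (fun h => extension p phi (h *m g)).
Proof.
move=> gU /extensionP[reg cov _]; split; [exact: regular_on_GL_shift| |by move=> Z].
by move=> b h Bb hU; rewrite -mulmxA cov// unitmx_mul hU.
Qed.

Theorem proposition1p4 (R : realType) (n : nat) (hn : (0 < n)%N)
    (p : (n + 1).-tuple int) (q : n.-tuple int)
    (hp : is_signature p) (hq : is_signature q)
    (hpq : interlacing p (dual_sig q)) :
  [/\ (* the integral converges absolutely *)
      forall (phi : Nplus R (n + 1) -> R[i]) (psi : Nplus R n -> R[i]),
        Vspace p phi -> Vspace q psi -> J_converges p q phi psi,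
      (* linearity in each variable *)
      forall (c : R[i]) (phi1 phi2 : Nplus R (n + 1) -> R[i])
          (psi : Nplus R n -> R[i]),
        Vspace p phi1 -> Vspace p phi2 -> Vspace q psi ->
        J p q (fun Z => c * phi1 Z + phi2 Z) psi =
        c * J p q phi1 psi + J p q phi2 psi,
      forall (c : R[i]) (phi : Nplus R (n + 1) -> R[i])
          (psi1 psi2 : Nplus R n -> R[i]),
        Vspace p phi -> Vspace q psi1 -> Vspace q psi2 ->
        J p q phi (fun U => c * psi1 U + psi2 U) =
        c * J p q phi psi1 + J p q phi psi2,
      (* nonzero *)
      exists (phi : Nplus R (n + 1) -> R[i]) (psi : Nplus R n -> R[i]),
        [/\ Vspace p phi, Vspace q psi & J p q phi psi != 0] &
      (* invariance *)
      forall (g : 'M[R[i]]_n) (phi : Nplus R (n + 1) -> R[i])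
          (psi : Nplus R n -> R[i]),
        g \in unitmx ->
        Vspace p phi -> Vspace q psi ->
        J p q (rho p (embed_GL g) phi) (rho q g psi) = J p q phi psi].
Proof.
have n1 : (0 < n + 1)%N by rewrite addn1.
have conv (phi : Nplus R (n + 1) -> R[i]) (psi : Nplus R n -> R[i]) :
    Vspace p phi -> Vspace q psi -> J_converges p q phi psi.
  by move=> [f ff] [f' ff']; case: (pairing_transform hn hpq ff ff').
split; first exact: conv.
- move=> c phi1 phi2 psi V1 V2 W; have I1 := conv _ _ V1 W; have I2 := conv _ _ V2 W.
  rewrite /J -(CintegralZ c I1) -(CintegralD (CintegrableZ c I1) I2).
  by apply: eq_Cintegral => x; exact: linear_middle.
- move=> c phi psi1 psi2 V W1 W2; have I1 := conv _ _ V W1; have I2 := conv _ _ V W2.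
  rewrite /J -(CintegralZ c I1) -(CintegralD (CintegrableZ c I1) I2).
  by apply: eq_Cintegral => x; exact: linear_last.
- have [h [g [hU gU K0]]] := kernel_neq0 R p q.
  have RK := kernel_regcov_r hpq h.
  pose psi (U : Nplus R n) := kernel p q h (val U).
  have psiE : extends q psi (kernel p q h) by split=> //; [exact: RK.1|exact: RK.2].
  pose f := transform p q (kernel p q h).
  have f0E : extends p (fun=> 0) (fun=> 0 : R[i]).
    split=> //; first exact: regular_cst.
    by move=> b k _ _; rewrite mulr0.
  have [_ Rf _] := pairing_transform hn hpq f0E psiE.
  exists (fun Z => f (val Z)), psi.
  have fE : extends p (fun Z => f (val Z)) f by split=> //; [exact: Rf.1|exact: Rf.2].
  split; [by exists f|by exists (kernel p q h)|].
  have [_ _ ->] := pairing_transform hn hpq fE psiE.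
  apply: (@ip_definite _ _ n1 _ _ h) => //.
  exact: (ip_definite hn RK gU K0).
- move=> g phi psi gU V W; have EU := embed_unit gU.
  have [_ _ ->] := pairing_transform hn hpq (extends_rho EU V) (extends_rho gU W).
  have [_ RT ->] := pairing_transform hn hpq (extensionP V) (extensionP W).
  have [rf cf _] := extensionP V; have [rf' cf' _] := extensionP W.
  have [_ RT' _] := pairing_transform hn hpq (extensionP V) (extends_rho gU W).
  have [_ adj] := has_adjoint_unitmx n1 p EU.
  apply: (etrans (adj _ _ (conj rf cf) RT')).
  apply: eq_ip => [//|h hU].
  exact: (transform_translate hn hpq (conj rf' cf') gU hU).
Qed.
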